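(* Let $x^0\in\mathbb{R}^n$ and assume the Kalman condition $\mathrm{rank}(B,AB,\dots,A^{n-1}B)=n$. Let $(v(b))_{b\in\mathcal{T}}$ be the family constructed below. Then there exists $\lambda_0>0$ such that for all $\lambda\in\mathbb{R}$ with $|\lambda|<\lambda_0$, the series $v:=\sum_{b\in\mathcal{T}}\lambda^{|b|}v(b)$ converges in $L^2((0,T),\mathbb{R}^m)$ and the solution $x\in\mathcal{S}$ of $x'=Ax+Bv+\lambda F(x)$, $x(0)=x^0$, satisfies $x(T)=0$.
   Context: Setting: $T>0$, $n,m\in\mathbb{N}^*$, $A\in\mathcal{M}_n(\mathbb{R})$, $B$ a real $n\times m$ matrix with transpose $B^*$. $\mathcal{S}:=\mathcal{C}^0([0,T],\mathbb{R}^n)\cap H^1([0,T],\mathbb{R}^n)$, $\mathcal{I}:=\mathbb{R}^n\times L^2((0,T),\mathbb{R}^n)$ with fixed Banach norms. Hypothesis (H1): $F(x)=\sum_{p\ge2}F_p(x,\dots,x)$ with $F_p:\mathcal{S}^p\to L^2((0,T),\mathbb{R}^n)$ continuous $p$-linear, and $\sum_{p}\|F_p\|z^p$ converges for all $z\in\mathbb{C}$. Adjoint problem $(\mathcal{P}')$: $y\in\mathcal{S}$, $-y'=A^*y$, $y(0)=y^0$. Trees: $\mathcal{T}$ = planar rooted trees (children ordered) in which every internal vertex has $\ge2$ children; $\|b\|$ = number of leaves, $|b|$ = number of internal vertices; $\circ$ = one-vertex tree; $B_+(b_1,\dots,b_r)$ ($r\ge2$) attaches roots of $b_1,\dots,b_r$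 to a new root, every $b\ne\circ$ being uniquely of this form, and then $B_-(b)=b_1\bullet\cdots\bullet b_r$; $E\propto c$ replaces the $i$-th leaf of $c$ by $E_i$. $\Phi(\circ):\mathcal{I}\to\mathcal{S}$, $(x^0,f)\mapsto$ solution of $x'=Ax+f$, $x(0)=x^0$; $\Phi(B_+(b_1,\dots,b_r))(w):=\Phi(\circ)(0,F_r(\Phi(b_1)(w^{(1)}),\dots,\Phi(b_r)(w^{(r)})))$ with $w^{(j)}$ consecutive blocks of lengths $\|b_j\|$. $(\Phi\ast u)(b):=\sum_{c\in\mathcal{T}}\sum_{E\in\mathcal{T}^{\|c\|},E\propto c=b}\Phi(c)(u(E_1),\dots,u(E_{\|c\|}))$ and $F[(\Phi\ast u)(b_1\bullet\cdots\bullet b_r)]:=F_r((\Phi\ast u)(b_1),\dots,(\Phi\ast u)(b_r))$. Construction: recursively on $|b|$, $v(b):=B^*\tilde y(b)$ where $\tilde y(b)$ solves $(\mathcal{P}')$ with initial value a minimizer of $J(b):\mathbb{R}^n\to\mathbb{R}$, with $J(\circ)(y^0)=\frac12\int_0^T|B^*\tilde y|^2dt+\langle x^0,y^0\rangle$ and, for $b\ne\circ$, $J(b)(y^0)=\frac12\int_0^T|B^*\tilde y|^2dt+\int_0^T\langle\tilde y,F[(\Phi\ast u)(B_-(b))]\rangle dt$, $\tilde y$ the solution of $(\mathcal{P}')$ with initial value $y^0$; here $u(\circ):=(x^0,Bv(\circ))$ and $u(c):=(0,Bv(c))$ for $c\ne\circ$. *)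

(* Defs.v *)
From HB Require Import structures.
From mathcomp Require Import all_boot all_order all_algebra.
From mathcomp Require Import all_classical all_reals all_analysis.
Set Implicit Arguments. Unset Strict Implicit. Unset Printing Implicit Defensive.
Import Order.TTheory GRing.Theory Num.Theory.
Import numFieldNormedType.Exports.
From Stdlib Require Import ClassicalEpsilon.

Local Open Scope classical_set_scope.
Local Open Scope ring_scope.

(* Planar rooted trees in which every internal vertex has >= 2 (ordered)
   children: [Node b1 b2 [:: b3; ...; br]] is B_+(b1,...,br), [Leaf] is the
   one-vertex tree. *)

Inductive tree : Type := Leaf | Node of tree & tree & seq tree.

Fixpoint encode (t : tree) : GenTree.tree unit :=
  match t with
  | Leaf => GenTree.Node 0 [::]
  | Node a b l => GenTree.Node 1 (encode a :: encode b :: map encode l)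
  end.
Fixpoint decode (g : GenTree.tree unit) : option tree :=
  match g with
  | GenTree.Node 0 _ => Some Leaf
  | GenTree.Node _ (ga :: gb :: gl) =>
     match decode ga, decode gb with
     | Some a, Some b => Some (Node a b (pmap id (map decode gl)))
     | _, _ => None end
  | _ => None
  end.
Lemma encodeK : pcancel encode decode.
Proof.
rewrite /pcancel; fix IH 1; case=> [|a b l] /=; first reflexivity; rewrite (IH a) (IH b).
have H := (fix go (l0 : seq tree) : map decode (map encode l0) = map Some l0 :=
  match l0 return map decode (map encode l0) = map Some l0 with
  | [::] => erefl
  | c :: l1 => f_equal2 cons (IH c) (go l1) end) l.
rewrite H; congr (Some (Node a b _)); by elim: l {H} => //= c l ->.
Qed.
HB.instance Definition _ := Countable.copy tree (pcan_type encodeK).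

Definition children (t : tree) : seq tree :=
  match t with Leaf => [::] | Node a b l => [:: a, b & l] end.

Fixpoint leaves (t : tree) : nat :=
  match t with
  | Leaf => 1
  | Node a b l => leaves a + leaves b + sumn (map leaves l)
  end.

Fixpoint internal (t : tree) : nat :=
  match t with
  | Leaf => 0
  | Node a b l => 1 + internal a + internal b + sumn (map internal l)
  end.

Fixpoint graft (t : tree) (E : seq tree) : tree :=
  match t with
  | Leaf => head Leaf E
  | Node a b l =>
      let E1 := drop (leaves a) E in
      Node (graft a (take (leaves a) E)) (graft b (take (leaves b) E1))
        ((fix go (l : seq tree) (E : seq tree) : seq tree :=
            match l with
            | [::] => [::]
            | c :: l' => graft c (take (leaves c) E) :: go l' (drop (leaves c) E)
            end) l (drop (leaves b) E1))
  end.

Section Analysis.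
Variable R : realType.
Local Notation mu := (@lebesgue_measure R).

Definition Icc (a b : R) : set R := [set t | a <= t <= b].

Definition vint k (f : R -> 'cV[R]_k) (a b : R) : 'cV[R]_k :=
  \col_i (\int[mu]_(t in Icc a b) f t i 0).

Definition inner k (x y : 'cV[R]_k) : R := \sum_i x i 0 * y i 0.
Definition vnorm k (x : 'cV[R]_k) : R := Num.sqrt (inner x x).

Variable T : R.

Definition L2 k (f : R -> 'cV[R]_k) : Prop :=
  forall i, measurable_fun (Icc 0 T) (fun t => f t i 0) /\
    (\int[mu]_(t in Icc 0 T) ((f t i 0) ^+ 2)%:E < +oo)%E.

Definition L2norm k (f : R -> 'cV[R]_k) : R :=
  Num.sqrt (\sum_i \int[mu]_(t in Icc 0 T) (f t i 0) ^+ 2).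

Definition H1deriv k (x g : R -> 'cV[R]_k) : Prop :=
  L2 g /\ forall t, 0 <= t <= T -> x t = x 0 + vint g 0 t.

Definition Sfun k (x : R -> 'cV[R]_k) : Prop :=
  {within Icc 0 T, continuous x} /\ exists g, H1deriv x g.

Definition Snorm k (x g : R -> 'cV[R]_k) : R := vnorm (x 0) + L2norm g.

Definition is_sol k (M : 'M[R]_k) (x0 : 'cV[R]_k) (f : R -> 'cV[R]_k)
  (x : R -> 'cV[R]_k) : Prop :=
  Sfun x /\ forall t, 0 <= t <= T -> x t = x0 + vint (fun s => M *m x s + f s) 0 t.

Definition odesol k (M : 'M[R]_k) (x0 : 'cV[R]_k) (f : R -> 'cV[R]_k) : R -> 'cV[R]_k :=
  epsilon (inhabits (fun _ => 0))
    (fun x => is_sol M x0 f x /\ forall t, ~ Icc 0 T t -> x t = 0).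

Variables (n m : nat).

Definition upd p (xs : 'I_p -> R -> 'cV[R]_n) (i : 'I_p) (y : R -> 'cV[R]_n) :
  'I_p -> R -> 'cV[R]_n := fun j => if j == i then y else xs j.

Definition H1hyp (F : forall p, ('I_p -> R -> 'cV[R]_n) -> R -> 'cV[R]_n) : Prop :=
  [/\ (forall p xs, (2 <= p)%N -> (forall i, Sfun (xs i)) -> L2 (F p xs)),
      (forall p xs ys, (2 <= p)%N -> (forall i, Sfun (xs i)) -> (forall i, Sfun (ys i)) ->
         (forall i t, Icc 0 T t -> xs i t = ys i t) ->
         ae_eq mu (Icc 0 T) (F p xs) (F p ys)),
      (forall p xs i (a : R) y z, (2 <= p)%N -> (forall j, Sfun (xs j)) -> Sfun y -> Sfun z ->
         ae_eq mu (Icc 0 T) (F p (upd xs i (fun t => a *: y t + z t)))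
           (fun t => a *: F p (upd xs i y) t + F p (upd xs i z) t)) &
      exists M : nat -> R,
        [/\ forall p, 0 <= M p,
            forall p xs gs, (2 <= p)%N -> (forall i, Sfun (xs i) /\ H1deriv (xs i) (gs i)) ->
              L2norm (F p xs) <= M p * \prod_i Snorm (xs i) (gs i) &
            forall z : R, 0 <= z -> cvgn (series (fun p => M p * z ^+ p))]].

Definition Fsum_to (F : forall p, ('I_p -> R -> 'cV[R]_n) -> R -> 'cV[R]_n)
  (x G : R -> 'cV[R]_n) : Prop :=
  L2 G /\ forall eps : R, 0 < eps -> exists N0 : nat, forall N, (N0 <= N)%N ->
    L2norm (fun t => \sum_(2 <= p < N) F p (fun _ => x) t - G t) < eps.

Definition kalman (A : 'M[R]_n) (B : 'M[R]_(n, m)) :=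
  \mxrow_(k < n) (A ^+ k *m B).

Definition tree_sum_L2 k (w : tree -> R -> 'cV[R]_k) (V : R -> 'cV[R]_k) : Prop :=
  forall eps : R, 0 < eps -> exists S0 : set tree, finite_set S0 /\
    forall S : set tree, finite_set S -> S0 `<=` S ->
      L2norm (fun t => \sum_(b \in S) w b t - V t) < eps.

Variables (A : 'M[R]_n) (B : 'M[R]_(n, m))
  (F : forall p, ('I_p -> R -> 'cV[R]_n) -> R -> 'cV[R]_n) (x0 : 'cV[R]_n).

Definition input := ('cV[R]_n * (R -> 'cV[R]_n))%type.

Fixpoint Phi (b : tree) (w : seq input) : R -> 'cV[R]_n :=
  match b with
  | Leaf => odesol A (head (0, fun _ => 0) w).1 (head (0, fun _ => 0) w).2
  | Node a c l =>
      let w1 := drop (leaves a) w in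
      let ps := Phi a (take (leaves a) w) :: Phi c (take (leaves c) w1) ::
        (fix go (l : seq tree) (w : seq input) : seq (R -> 'cV[R]_n) :=
           match l with
           | [::] => [::]
           | d :: l' => Phi d (take (leaves d) w) :: go l' (drop (leaves d) w)
           end) l (drop (leaves c) w1) in
      odesol A 0 (@F (size ps) (fun j => nth (fun _ => 0) ps j))
  end.

Definition adj (y0 : 'cV[R]_n) : R -> 'cV[R]_n := odesol (- A^T) y0 (fun _ => 0).

Variable y0 : tree -> 'cV[R]_n.

Definition vfam (b : tree) : R -> 'cV[R]_m := fun t => B^T *m adj (y0 b) t.

Definition ufam (b : tree) : input :=
  (match b with Leaf => x0 | _ => 0 end, fun t => B *m vfam b t).

Definition decomps (b : tree) : set (tree * seq tree) :=
  [set p | size p.2 = leaves p.1 /\ graft p.1 p.2 = b].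

Definition star (b : tree) : R -> 'cV[R]_n :=
  fun t => \sum_(p \in decomps b) Phi p.1 (map ufam p.2) t.

Definition J (b : tree) (z : 'cV[R]_n) : R :=
  2^-1 * (\int[mu]_(t in Icc 0 T) (vnorm (B^T *m adj z t)) ^+ 2) +
  match b with
  | Leaf => inner x0 z
  | Node a c l =>
      \int[mu]_(t in Icc 0 T)
        inner (adj z t) (@F (size [:: a, c & l]) (fun j => star (nth Leaf [:: a, c & l] j)) t)
  end.

Definition constructed : Prop := forall b z, J b (y0 b) <= J b z.

End Analysis.

(* Main.v *)
(* The Kalman condition makes the Gramian of the adjoint observation [B^* y] invertible, so the control
   minimizing [J(b)] is bounded by a constant times its source [F[(Phi * u)(B_-(b))]]. Multilinearity
   of the [F_p] shows that [(Phi * u)(b)] solves [x' = A x + B v(b) + F[(Phi * u)(B_-(b))]], and the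
   Euler-Lagrange equation of [J(b)] together with the duality between this equation and the adjoint
   one gives [(Phi * u)(b)(T) = 0]. With [w(b) = |lambda|^|b| ||(Phi * u)(b)||], a sum [S] of the
   [w(b)] over trees of bounded height satisfies [S_(h+1) <= w(o) + |lambda| K sum_p M_p S_h^p],
   which for small [lambda] stays below [w(o) + 1]. Hence all series over trees converge absolutely,
   and expanding [F_p(x, ..., x)] along [b = B_+(b_1, ..., b_p)] identifies the sum
   [x = sum_b lambda^|b| (Phi * u)(b)] with the solution of the nonlinear problem; it vanishes at [T]
   term by term. *)
Require Import Defs.
From HB Require Import structures.
From mathcomp Require Import all_boot all_order all_algebra.
From mathcomp Require Import all_classical all_reals all_analysis.
From mathcomp Require Import measurable_realfun ring lra.
From Stdlib Require ClassicalEpsilon.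
Import Order.TTheory GRing.Theory Num.Theory.
Import numFieldNormedType.Exports.
Local Open Scope classical_set_scope.
Local Open Scope ring_scope.
Set Implicit Arguments.
Unset Strict Implicit.
Unset Printing Implicit Defensive.

(** The nonlinear solution is never summed in the space of trajectories. Only the two series of
    square-integrable functions, the controls and the sources, are summed; [x] is then the solution
    of the linear problem driven by these sums, and continuity of the linear solution map makes
    finite tree sums converge to it, both in the trajectory norm and at time [T]. It remains to see
    that the summed source is sum_p F_p(x, ..., x). Finite sets of trees are not stable under
    grafting at a new root, so F_p at [x] is compared with F_p at a finite tree sum, with an error
    summable in p. This is why the majorant M_p z^p is summed at radius [rho + 1], one unit above
    the bound [rho] valid for every finite tree sum. The source of b carries lambda^(|b|-1), since
    the factor lambda of the equation supplies the missing power. Functions are plain maps on R: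
    identities involving F_p hold only almost everywhere, and the trajectory norm takes the
    derivative as an explicit argument, so every trajectory travels with one. *)

Lemma discriminant_le (R : realType) (a b c : R) :
  (forall s, 0 <= a + 2 * s * b + s ^+ 2 * c) -> 0 <= c -> b ^+ 2 <= a * c.
Proof.
move=> H c0; have [c00|cn0] := eqVneq c 0.
  have [b0|bn0] := eqVneq b 0; first by rewrite c00 b0 mulr0 expr0n.
  (* With [c = 0] and [b] nonzero, the affine expression takes the value -1 at this point. *)
  have := H (- (a + 1) / (2 * b)); rewrite c00 mulr0 addr0.
  have -> : 2 * (- (a + 1) / (2 * b)) * b = - (a + 1) by field.
  lra.
have cp : 0 < c by rewrite lt_neqAle eq_sym cn0.
(* The vertex of the parabola. *)
have := H (- b / c).
have -> : a + 2 * (- b / c) * b + (- b / c) ^+ 2 * c = (a * c - b ^+ 2) / c by field.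
by rewrite pmulr_lge0 ?invr_gt0// subr_ge0.
Qed.

(** * Square-integrable real functions *)

Section SquareIntegrable.
Context d (X : measurableType d) (R : realType) (mu : {measure set X -> \bar R}).
Variables (D : set X) (mD : measurable D).

Definition sqint (f : X -> R) :=
  measurable_fun D f /\ (\int[mu]_(t in D) ((f t) ^+ 2)%:E < +oo)%E.

Lemma sqint_sqr_integrable f : sqint f -> mu.-integrable D (fun t => (f t ^+ 2)%:E).
Proof.
move=> [mf fy]; apply/integrableP; split.
  by apply/measurable_EFinP; exact: measurable_funX.
rewrite (eq_integral (fun t => ((f t) ^+ 2)%:E)) // => t _.
by rewrite gee0_abs// lee_fin sqr_ge0.
Qed.

(** The product is dominated by [f ^+ 2 + g ^+ 2]. *)
Lemma sqint_mul_integrable f g : sqint f -> sqint g ->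
  mu.-integrable D (fun t => (f t * g t)%:E).
Proof.
move=> hf hg; have := integrableD mD (sqint_sqr_integrable hf) (sqint_sqr_integrable hg).
apply: le_integrable => //.
  by apply/measurable_EFinP; apply: measurable_funM; [case: hf|case: hg].
move=> t _ /=; rewrite lee_fin [leRHS]ger0_norm; last by rewrite addr_ge0// sqr_ge0.
rewrite ler_norml; apply/andP; split; nra.
Qed.

(** The square of the combination is dominated by [2 a^2 f^2 + 2 b^2 g^2]. *)
Lemma sqint_lin a b f g : sqint f -> sqint g -> sqint (fun t => a * f t + b * g t).
Proof.
move=> hf hg; split.
  by apply: measurable_funD; apply: measurable_funM => //; [case: hf|case: hg].
have : mu.-integrable D (fun t => (2 * a ^+ 2)%:E * ((f t) ^+ 2)%:E +
  (2 * b ^+ 2)%:E * ((g t) ^+ 2)%:E)%E.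
  by apply: integrableD => //; apply: integrableZl => //; exact: sqint_sqr_integrable.
move=> /integrableP[m]; apply: le_lt_trans; apply: ge0_le_integral => //.
- by move=> t _; rewrite lee_fin sqr_ge0.
- apply/measurable_EFinP; apply: measurable_funX.
  by apply: measurable_funD; apply: measurable_funM => //; [case: hf|case: hg].
- exact: measurableT_comp.
- move=> t _; rewrite -!EFinM -EFinD /= lee_fin ler_normr; apply/orP; left.
  have := sqr_ge0 (a * f t - b * g t); nra.
Qed.

Lemma sqint0 : sqint (fun=> 0).
Proof.
split => //; under eq_integral do rewrite expr0n.
by rewrite integral0.
Qed.

Lemma sqintZ a f : sqint f -> sqint (fun t => a * f t).
Proof.
move=> /(sqint_lin a 0)/(_ sqint0); congr sqint.
by apply/funext => t; rewrite mulr0 addr0.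
Qed.

Lemma sqintD f g : sqint f -> sqint g -> sqint (fun t => f t + g t).
Proof.
move=> hf /(sqint_lin 1 1 hf); congr sqint.
by apply/funext => t; rewrite !mul1r.
Qed.

Lemma sqint_sum (I : Type) (r : seq I) (f : I -> X -> R) :
  (forall i, sqint (f i)) -> sqint (fun t => \sum_(i <- r) f i t).
Proof.
move=> h; elim: r => [|i r IH].
  by under eq_fun do rewrite big_nil; exact: sqint0.
by under eq_fun do rewrite big_cons; exact: sqintD.
Qed.

Lemma sqint_norm f : sqint f -> sqint (fun t => `|f t|).
Proof.
move=> [mf fy]; split; first exact: measurableT_comp.
by under eq_integral do rewrite -normrX ger0_norm ?sqr_ge0//.
Qed.

End SquareIntegrable.

Lemma measurable_Icc (R : realType) (a b : R) : @measurable _ (measurableTypeR R) (Icc a b).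
Proof. by rewrite /Icc -set_itvcc; exact: measurable_itv. Qed.
#[global] Hint Extern 0 (measurable (Icc _ _)) => exact: measurable_Icc : core.

Lemma mu_Icc (R : realType) (a b : R) : a <= b ->
  lebesgue_measure (Icc a b) = (b - a)%:E.
Proof.
move=> ab; rewrite /Icc -set_itvcc lebesgue_measure_itv /= lte_fin.
case: ltP => // ba; have -> : a = b by apply/le_anti/andP.
by rewrite subrr.
Qed.

Lemma mu_Icc_lty (R : realType) (a b : R) : (lebesgue_measure (Icc a b) < +oo)%E.
Proof.
have [ab|ba] := leP a b; first by rewrite mu_Icc// ltry.
rewrite /Icc -set_itvcc lebesgue_measure_itv /=.
by case: ifP => _; rewrite ?ltry.
Qed.

(** * Entrywise and Euclidean norms *)

Section L1norm.
Context {R : realType}.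

(** Used beside the Euclidean [vnorm] because it is submultiplicative and passes under the integral
    sign one coordinate at a time. *)
Definition l1 p q (M : 'M[R]_(p, q)) : R := \sum_i \sum_j `|M i j|.

Lemma l1_ge0 p q (M : 'M[R]_(p, q)) : 0 <= l1 M.
Proof. by apply: sumr_ge0 => i _; apply: sumr_ge0. Qed.

Lemma le_l1 p q (M : 'M[R]_(p, q)) i j : `|M i j| <= l1 M.
Proof.
rewrite /l1 (bigD1 i) //= (bigD1 j) //= -addrA lerDl addr_ge0 ?sumr_ge0// => i' _.
exact: sumr_ge0.
Qed.

Lemma l1M p q r (M : 'M[R]_(p, q)) (N : 'M[R]_(q, r)) : l1 (M *m N) <= l1 M * l1 N.
Proof.
apply: (@le_trans _ _ (\sum_i \sum_j \sum_k `|M i k| * `|N k j|)).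
  apply: ler_sum => i _; apply: ler_sum => j _; rewrite mxE.
  by apply: (le_trans (ler_norm_sum _ _ _)); apply: ler_sum => k _; rewrite normrM.
rewrite /l1 mulr_suml; apply: ler_sum => i _.
rewrite exchange_big /= mulr_suml; apply: ler_sum => k _.
rewrite -mulr_sumr ler_wpM2l// [leRHS](bigD1 k)//= lerDl.
by apply: sumr_ge0 => k' _; apply: sumr_ge0.
Qed.

Lemma l1D p q (M N : 'M[R]_(p, q)) : l1 (M + N) <= l1 M + l1 N.
Proof.
rewrite /l1 -big_split; apply: ler_sum => i _; rewrite -big_split.
by apply: ler_sum => j _; rewrite mxE ler_normD.
Qed.

Lemma l1_eq0 p q (M : 'M[R]_(p, q)) : l1 M <= 0 -> M = 0.
Proof.
move=> M0; apply/matrixP => i j; rewrite mxE; apply/eqP.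
by rewrite -normr_le0 (le_trans (le_l1 M i j)).
Qed.

Lemma l1_cV k (x : 'cV[R]_k) : l1 x = \sum_i `|x i 0|.
Proof. by apply: eq_bigr => i _; rewrite big_ord1. Qed.

Lemma vnorm_ge0 k (x : 'cV[R]_k) : 0 <= vnorm x.
Proof. exact: sqrtr_ge0. Qed.

Lemma inner_ge0 k (x : 'cV[R]_k) : 0 <= inner x x.
Proof. by apply: sumr_ge0 => i _; rewrite -expr2 sqr_ge0. Qed.

Lemma vnorm_sqr k (x : 'cV[R]_k) : vnorm x ^+ 2 = inner x x.
Proof. by rewrite sqr_sqrtr// inner_ge0. Qed.

Lemma vnorm0 k : vnorm (0 : 'cV[R]_k) = 0.
Proof. by rewrite /vnorm /inner big1 ?sqrtr0// => i _; rewrite mxE mul0r. Qed.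

Lemma coord_le_vnorm k (x : 'cV[R]_k) i : `|x i 0| <= vnorm x.
Proof.
rewrite -(@ler_pXn2r _ 2)// ?nnegrE ?vnorm_ge0// vnorm_sqr real_normK ?num_real//.
by rewrite /inner (bigD1 i)//= -expr2 lerDl sumr_ge0// => j _; rewrite -expr2 sqr_ge0.
Qed.

Lemma l1_le_vnorm k (x : 'cV[R]_k) : l1 x <= k%:R * vnorm x.
Proof.
rewrite l1_cV; apply: (@le_trans _ _ (\sum_(i < k) vnorm x)).
  by apply: ler_sum => i _; exact: coord_le_vnorm.
by rewrite sumr_const card_ord mulr_natl.
Qed.

End L1norm.

(** * The inner product and norm of vector-valued square-integrable functions *)

Section L2space.
Context {R : realType}.
Variable T : R.
Local Notation mu := (@lebesgue_measure R).
Local Notation D := (Icc 0 T).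

Lemma L2_coord k (f : R -> 'cV[R]_k) i : L2 T f -> sqint mu D (fun t => f t i 0).
Proof. by move=> /(_ i). Qed.

Lemma L2D k (f g : R -> 'cV[R]_k) : L2 T f -> L2 T g -> L2 T (fun t => f t + g t).
Proof.
move=> hf hg i; have := sqintD (measurable_Icc 0 T) (L2_coord i hf) (L2_coord i hg).
by congr sqint; apply/funext => t; rewrite mxE.
Qed.

Lemma L2_0 k : L2 T (fun=> 0 : 'cV[R]_k).
Proof.
move=> i; have := sqint0 mu D.
by congr sqint; apply/funext => t; rewrite mxE.
Qed.

Lemma L2_sum k (I : Type) (r : seq I) (P : pred I) (f : I -> R -> 'cV[R]_k) :
  (forall i, P i -> L2 T (f i)) -> L2 T (fun t => \sum_(i <- r | P i) f i t).
Proof.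
move=> h; elim: r => [|i r IH].
  by under eq_fun do rewrite big_nil; exact: L2_0.
have [Pi|nPi] := boolP (P i).
  by under eq_fun do rewrite big_cons Pi; apply: L2D => //; exact: h.
by under eq_fun do rewrite big_cons (negbTE nPi).
Qed.

Lemma L2M p q (M : 'M[R]_(p, q)) (f : R -> 'cV[R]_q) :
  L2 T f -> L2 T (fun t => M *m f t).
Proof.
move=> hf i; have h j := sqintZ (measurable_Icc 0 T) (M i j) (L2_coord j hf).
have := sqint_sum (measurable_Icc 0 T) (index_enum 'I_q) h.
by congr sqint; apply/funext => t; rewrite mxE.
Qed.

Lemma L2Z k a (f : R -> 'cV[R]_k) : L2 T f -> L2 T (fun t => a *: f t).
Proof.
move=> hf i; have := sqintZ (measurable_Icc 0 T) a (L2_coord i hf).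
by congr sqint; apply/funext => t; rewrite mxE.
Qed.

Lemma L2B k (f g : R -> 'cV[R]_k) : L2 T f -> L2 T g -> L2 T (fun t => f t - g t).
Proof.
move=> hf hg; under eq_fun do rewrite -scaleN1r; apply: L2D => //; exact: L2Z.
Qed.

(** A sum of integrals rather than the integral of [inner], so that [L2norm] is by conversion the
    square root of [vip f f]. *)
Definition vip k (f g : R -> 'cV[R]_k) : R := \sum_i \int[mu]_(t in D) (f t i 0 * g t i 0).

Lemma vip_coord_int k (f g : R -> 'cV[R]_k) i : L2 T f -> L2 T g ->
  mu.-integrable D (EFin \o (fun t => f t i 0 * g t i 0)).
Proof. by move=> hf hg; exact: (sqint_mul_integrable _ (L2_coord i hf) (L2_coord i hg)). Qed.

Lemma vip_inner k (f g : R -> 'cV[R]_k) : L2 T f -> L2 T g ->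
  vip f g = \int[mu]_(t in D) inner (f t) (g t).
Proof.
move=> hf hg; rewrite /Rintegral /inner.
under eq_integral do rewrite -sumEFin.
rewrite integral_sum//; last by move=> i; exact: vip_coord_int.
by rewrite -sum_fine// => i _; apply: integrable_fin_num => //; exact: vip_coord_int.
Qed.

Lemma vipC k (f g : R -> 'cV[R]_k) : vip f g = vip g f.
Proof. by apply: eq_bigr => i _; apply: eq_Rintegral => t _; rewrite mulrC. Qed.

Lemma vipD k (f g h : R -> 'cV[R]_k) : L2 T f -> L2 T g -> L2 T h ->
  vip f (fun t => g t + h t) = vip f g + vip f h.
Proof.
move=> hf hg hh; rewrite /vip -big_split; apply: eq_bigr => i _ /=.
rewrite -RintegralD//; [|exact: vip_coord_int..].
by apply: eq_Rintegral => t _; rewrite mxE mulrDr.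
Qed.

Lemma vipZ k a (f g : R -> 'cV[R]_k) : L2 T f -> L2 T g ->
  vip f (fun t => a *: g t) = a * vip f g.
Proof.
move=> hf hg; rewrite /vip mulr_sumr; apply: eq_bigr => i _ /=.
rewrite -RintegralZl//; last exact: vip_coord_int.
by apply: eq_Rintegral => t _; rewrite mxE mulrCA.
Qed.

Lemma vip_sum k (I : Type) (r : seq I) (f : R -> 'cV[R]_k) (g : I -> R -> 'cV[R]_k) :
  L2 T f -> (forall i, L2 T (g i)) ->
  vip f (fun t => \sum_(i <- r) g i t) = \sum_(i <- r) vip f (g i).
Proof.
move=> hf hg; elim: r => [|i r IH].
  rewrite big_nil; have -> : (fun t => \sum_(i <- [::]) g i t) = (fun t => 0 *: f t).
    by apply/funext => t; rewrite big_nil scale0r.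
  by rewrite vipZ// mul0r.
rewrite big_cons -IH -vipD//; last exact: L2_sum.
by congr vip; apply/funext => t; rewrite big_cons.
Qed.

Lemma vip_ge0 k (f : R -> 'cV[R]_k) : 0 <= vip f f.
Proof.
apply: sumr_ge0 => i _; apply: Rintegral_ge0 => t _.
by rewrite -expr2 sqr_ge0.
Qed.

Lemma L2normE k (f : R -> 'cV[R]_k) : L2norm T f = Num.sqrt (vip f f).
Proof. by []. Qed.

Lemma L2norm_sqr k (f : R -> 'cV[R]_k) : L2norm T f ^+ 2 = vip f f.
Proof. by rewrite L2normE sqr_sqrtr// vip_ge0. Qed.

Lemma L2norm_ge0 k (f : R -> 'cV[R]_k) : 0 <= L2norm T f.
Proof. exact: sqrtr_ge0. Qed.

(** The squared norm of [f + s g] is a nonnegative quadratic polynomial in [s]. *)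
Lemma L2_cauchy_schwarz k (f g : R -> 'cV[R]_k) : L2 T f -> L2 T g ->
  `|vip f g| <= L2norm T f * L2norm T g.
Proof.
move=> hf hg; rewrite -(@ler_pXn2r _ 2)// ?nnegrE// ?mulr_ge0 ?L2norm_ge0//.
rewrite real_normK ?num_real// exprMn !L2norm_sqr.
apply: discriminant_le; last exact: vip_ge0.
move=> s; have := vip_ge0 (fun t => f t + s *: g t).
have h : L2 T (fun t => s *: g t) by exact: L2Z.
have hfg := L2D hf h.
rewrite vipD// vipZ// ![vip (fun t => _ + _) _]vipC !vipD// !vipZ// (vipC g f).
move=> /le_trans; apply; rewrite le_eqVlt; apply/orP; left; apply/eqP; ring.
Qed.

Lemma L2norm_triangle k (f g : R -> 'cV[R]_k) : L2 T f -> L2 T g ->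
  L2norm T (fun t => f t + g t) <= L2norm T f + L2norm T g.
Proof.
move=> hf hg; rewrite -(@ler_pXn2r _ 2)// ?nnegrE// ?addr_ge0 ?L2norm_ge0//.
have hfg := L2D hf hg.
rewrite sqrrD !L2norm_sqr vipD// ![vip (fun t => _ + _) _]vipC !vipD// (vipC g f).
have := ler_norm (vip f g); have := L2_cauchy_schwarz hf hg; lra.
Qed.

Lemma L2normZ k a (f : R -> 'cV[R]_k) : L2 T f ->
  L2norm T (fun t => a *: f t) = `|a| * L2norm T f.
Proof.
move=> hf; rewrite L2normE vipZ//; last exact: L2Z.
rewrite vipC vipZ// mulrA -expr2 sqrtrM ?sqr_ge0// sqrtr_sqr//.
Qed.

Lemma L2norm0 k : L2norm T (fun=> 0 : 'cV[R]_k) = 0.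
Proof.
have := @L2normZ k 0 _ (@L2_0 k); rewrite normr0 mul0r.
by under [X in L2norm T X]eq_fun do rewrite scaler0.
Qed.

Lemma L2normC k (f g : R -> 'cV[R]_k) : L2 T f -> L2 T g ->
  L2norm T (fun t => f t - g t) = L2norm T (fun t => g t - f t).
Proof.
move=> hf hg; rewrite -[RHS]mul1r -[X in X * _]normrN1 -L2normZ; last exact: L2B.
by congr L2norm; apply/funext => t; rewrite scaleN1r opprB.
Qed.

Lemma L2norm_sum_le k (I : Type) (r : seq I) (f : I -> R -> 'cV[R]_k) :
  (forall i, L2 T (f i)) ->
  L2norm T (fun t => \sum_(i <- r) f i t) <= \sum_(i <- r) L2norm T (f i).
Proof.
move=> hf; elim: r => [|i r IH].
  by under [X in L2norm T X]eq_fun do rewrite big_nil; rewrite L2norm0 big_nil.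
under [X in L2norm T X]eq_fun do rewrite big_cons.
rewrite big_cons (le_trans (L2norm_triangle _ _))//; first exact: L2_sum.
by rewrite lerD2l.
Qed.

Lemma eq_L2norm k (f g : R -> 'cV[R]_k) : (forall t, D t -> f t = g t) ->
  L2norm T f = L2norm T g.
Proof.
move=> fg; congr Num.sqrt; apply: eq_bigr => i _; apply: eq_Rintegral => t /set_mem Dt.
by rewrite fg.
Qed.

Lemma eq_L2 k (f g : R -> 'cV[R]_k) : (forall t, D t -> f t = g t) -> L2 T f -> L2 T g.
Proof.
move=> fg hf i; have [mf fy] := hf i; split.
  by apply: eq_measurable_fun mf => t /set_mem Dt; rewrite fg.
by under eq_integral do [rewrite -fg; last exact/set_mem].
Qed.

Lemma coord_L2norm k (f : R -> 'cV[R]_k) i :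
  \int[mu]_(t in D) (f t i 0) ^+ 2 <= L2norm T f ^+ 2.
Proof.
rewrite L2norm_sqr /vip (bigD1 i)//= lerDl sumr_ge0// => j _.
by apply: Rintegral_ge0 => t _; rewrite -expr2 sqr_ge0.
Qed.

(** [M *m f] is split into the pieces [M i j] times the [j]-th coordinate of [f] along the [i]-th
    basis vector; each has norm at most [|M i j|] times that of [f]. *)
Lemma L2normM p q (M : 'M[R]_(p, q)) (f : R -> 'cV[R]_q) : L2 T f ->
  L2norm T (fun t => M *m f t) <= l1 M * L2norm T f.
Proof.
move=> hf; pose g i j t : 'cV[R]_p := M i j *: (f t j 0 *: delta_mx i 0).
have hd i j : L2 T (fun t => f t j 0 *: delta_mx i 0 : 'cV[R]_p).
  move=> i'; have := sqintZ (measurable_Icc 0 T) ((i' == i)%:R) (L2_coord j hf).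
  by congr sqint; apply/funext => t; rewrite !mxE eqxx andbT mulrC.
have hg i j : L2 T (g i j) by exact: L2Z.
have -> : (fun t => M *m f t) = (fun t => \sum_i \sum_j g i j t).
  apply/funext => t; apply/matrixP => i z; rewrite (ord1 z) mxE summxE (bigD1 i)//=.
  rewrite summxE [X in _ + X]big1 ?addr0 => [|i' ne].
    by apply: eq_bigr => j _; rewrite !mxE !eqxx mulr1.
  by rewrite summxE big1// => j _; rewrite !mxE eq_sym (negbTE ne) !mulr0.
apply: le_trans (L2norm_sum_le _ _) _; first by move=> i; exact: L2_sum.
rewrite /l1 mulr_suml; apply: ler_sum => i _.
apply: le_trans (L2norm_sum_le _ _) _; first by [].
rewrite mulr_suml; apply: ler_sum => j _.
rewrite L2normZ// ler_wpM2l//.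
rewrite -(@ler_pXn2r _ 2)// ?nnegrE ?L2norm_ge0// (le_trans _ (coord_L2norm f j))//.
rewrite L2norm_sqr /vip (bigD1 i)//= big1 ?addr0 => [|i' ne].
  rewrite le_eqVlt; apply/orP; left; apply/eqP; apply: eq_Rintegral => t _.
  by rewrite !mxE !eqxx mulr1 expr2.
rewrite /Rintegral integral0_eq// => t _.
by rewrite !mxE (negbTE ne) !mulr0.
Qed.

End L2space.

(** * Primitives, H1 functions and integration by parts *)

Section PrimitiveIntegrals.
Context {R : realType}.
Variable T : R.
Local Notation mu := (@lebesgue_measure R).
Local Notation D := (Icc 0 T).

Lemma sqint_cst c : sqint mu D (fun=> c).
Proof.
split; first exact: measurable_cst.
by rewrite integral_cst// lte_mul_pinfty ?lee_fin ?sqr_ge0// mu_Icc_lty.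
Qed.

Lemma L2_integrable k (f : R -> 'cV[R]_k) i : L2 T f ->
  mu.-integrable D (EFin \o (fun t => f t i 0)).
Proof.
move=> hf; have := sqint_mul_integrable (measurable_Icc 0 T) (L2_coord i hf) (sqint_cst 1).
by apply: eq_integrable => // t _; rewrite mulr1.
Qed.

Lemma Rintegral_cst_Icc (c t : R) : 0 <= t -> \int[mu]_(s in Icc 0 t) c = c * t.
Proof.
move=> t0; rewrite Rintegral_cst//; congr (_ * _).
by rewrite (_ : _ (Icc 0 t) = t%:E)//; apply: (etrans (mu_Icc t0)); rewrite subr0.
Qed.

Lemma Icc_subset (t : R) : t <= T -> Icc 0 t `<=` D.
Proof. by move=> tT s /= /andP[s0 st]; apply/andP; split => //; exact: le_trans tT. Qed.

Lemma integrable_Icc (f : R -> R) t : t <= T ->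
  mu.-integrable D (EFin \o f) -> mu.-integrable (Icc 0 t) (EFin \o f).
Proof. by move=> tT; apply: integrableS => //; exact: Icc_subset. Qed.

Lemma L2_integrable_Icc k (f : R -> 'cV[R]_k) i t : t <= T -> L2 T f ->
  mu.-integrable (Icc 0 t) (EFin \o (fun t => f t i 0)).
Proof. by move=> tT hf; apply: integrable_Icc => //; exact: L2_integrable. Qed.

Lemma eq_vint k (f g : R -> 'cV[R]_k) t : (forall s, 0 <= s <= t -> f s = g s) ->
  vint f 0 t = vint g 0 t.
Proof.
move=> fg; apply/matrixP => i j; rewrite !mxE; apply: eq_Rintegral => s /set_mem Ds.
by rewrite fg.
Qed.

Lemma vintD k (f g : R -> 'cV[R]_k) t : t <= T -> L2 T f -> L2 T g ->
  vint (fun s => f s + g s) 0 t = vint f 0 t + vint g 0 t.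
Proof.
move=> tT hf hg; apply/matrixP => i j; rewrite !mxE -RintegralD//.
- by apply: eq_Rintegral => s _; rewrite mxE.
- exact: L2_integrable_Icc.
- exact: L2_integrable_Icc.
Qed.

Lemma vint0 k t : vint (fun=> 0 : 'cV[R]_k) 0 t = 0.
Proof.
apply/matrixP => i j; rewrite !mxE /Rintegral integral0_eq// => s _.
Qed.

Lemma vintM p q (M : 'M[R]_(p, q)) (f : R -> 'cV[R]_q) t : t <= T -> L2 T f ->
  vint (fun s => M *m f s) 0 t = M *m vint f 0 t.
Proof.
move=> tT hf; apply/matrixP => i j; rewrite !mxE (ord1 j).
under [RHS]eq_bigr => l _.
  rewrite mxE -RintegralZl//; last exact: L2_integrable_Icc.
  over.
rewrite /Rintegral.
under eq_integral do rewrite mxE -sumEFin.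
have hi l : mu.-integrable (Icc 0 t) (EFin \o (fun s => M i l * f s l 0)).
  have := integrableZl (measurable_Icc 0 t) (M i l) (L2_integrable_Icc l tT hf).
  by apply: eq_integrable.
rewrite integral_sum// -sum_fine//= => l _.
by apply: (integrable_fin_num _ (hi l)).
Qed.

Lemma vintZ k a (f : R -> 'cV[R]_k) t : t <= T -> L2 T f ->
  vint (fun s => a *: f s) 0 t = a *: vint f 0 t.
Proof.
move=> tT hf; rewrite -mul_scalar_mx -vintM//.
by apply: eq_vint => s _; rewrite mul_scalar_mx.
Qed.

Lemma vint_at0 k (f : R -> 'cV[R]_k) : vint f 0 0 = 0.
Proof.
apply/matrixP => i j; rewrite !mxE.
have -> : Icc 0 0 = [set (0 : R)].
  by rewrite /Icc; apply/seteqP; split => x /=; [move=> /le_anti -> //|move=> ->; rewrite lexx].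
exact: Rintegral_set1.
Qed.

Lemma ae_eq_coord k (f g : R -> 'cV[R]_k) i : ae_eq mu D f g ->
  ae_eq mu D (fun t => f t i 0) (fun t => g t i 0).
Proof. by apply: filterS => t /= h /h ->. Qed.

Lemma ae_eq_sub (f g : R -> R) t : t <= T -> ae_eq mu D f g -> ae_eq mu (Icc 0 t) f g.
Proof. by move=> tT; apply: filterS => s /= h ts; apply: h; exact: Icc_subset ts. Qed.

Lemma ae_eq_Rintegral (f g : R -> R) t :
  mu.-integrable (Icc 0 t) (EFin \o f) -> mu.-integrable (Icc 0 t) (EFin \o g) ->
  ae_eq mu (Icc 0 t) f g -> \int[mu]_(s in Icc 0 t) f s = \int[mu]_(s in Icc 0 t) g s.
Proof.
move=> hf hg fg; congr fine; apply: ae_eq_integral => //.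
- exact: measurable_int hf.
- exact: measurable_int hg.
- by apply: filterS fg => s /= h /h ->.
Qed.

Lemma ae_eq_vint k (f g : R -> 'cV[R]_k) t : t <= T -> L2 T f -> L2 T g ->
  ae_eq mu D f g -> vint f 0 t = vint g 0 t.
Proof.
move=> tT hf hg fg; apply/matrixP => i j; rewrite !mxE.
apply: ae_eq_Rintegral; [exact: L2_integrable_Icc..|].
by apply: ae_eq_sub => //; exact: ae_eq_coord.
Qed.

Lemma ae_eq_vip k (f g h : R -> 'cV[R]_k) : L2 T f -> L2 T g -> L2 T h ->
  ae_eq mu D f g -> vip T h f = vip T h g.
Proof.
move=> hf hg hh fg; apply: eq_bigr => i _; apply: ae_eq_Rintegral; [exact: vip_coord_int..|].
by apply: filterS fg => s /= H /H ->.
Qed.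

Lemma ae_eq_L2norm k (f g : R -> 'cV[R]_k) : L2 T f -> L2 T g ->
  ae_eq mu D f g -> L2norm T f = L2norm T g.
Proof.
move=> hf hg fg; rewrite !L2normE (ae_eq_vip hf hg hf fg) vipC (ae_eq_vip hf hg hg fg)//.
Qed.

Lemma l1_integrable k (f : R -> 'cV[R]_k) t : t <= T -> L2 T f ->
  mu.-integrable (Icc 0 t) (EFin \o (fun s => l1 (f s))).
Proof.
move=> tT hf.
have := integrable_sum (measurable_Icc 0 t) (index_enum 'I_k) (P := xpredT)
  (h := fun i s => `|f s i 0|%:E) (fun i _ => integrable_norm (L2_integrable_Icc i tT hf)).
by apply: eq_integrable => // s _; rewrite /= l1_cV sumEFin.
Qed.

Lemma l1_vint k (f : R -> 'cV[R]_k) t : t <= T -> L2 T f ->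
  l1 (vint f 0 t) <= \int[mu]_(s in Icc 0 t) l1 (f s).
Proof.
move=> tT hf; rewrite l1_cV.
have -> : \int[mu]_(s in Icc 0 t) l1 (f s) =
    \sum_i \int[mu]_(s in Icc 0 t) `|f s i 0|.
  rewrite /Rintegral; under eq_integral do rewrite l1_cV -sumEFin.
  have h i : mu.-integrable (Icc 0 t) (EFin \o (fun s => `|f s i 0|)).
    exact: (integrable_norm (L2_integrable_Icc i tT hf)).
  by rewrite integral_sum// -sum_fine// => i _; apply: (integrable_fin_num _ (h i)).
apply: ler_sum => i _; rewrite mxE; apply: le_normr_Rintegral => //.
exact: L2_integrable_Icc.
Qed.

Lemma Rintegral_Icc_le (f : R -> R) t : t <= T -> (forall s, 0 <= f s) ->
  mu.-integrable D (EFin \o f) ->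
  \int[mu]_(s in Icc 0 t) f s <= \int[mu]_(s in D) f s.
Proof.
move=> tT f0 hf; apply: fine_le.
- by apply: integrable_fin_num => //; exact: integrable_Icc.
- exact: integrable_fin_num.
- apply: ge0_subset_integral => //; last exact: Icc_subset.
  + exact: measurable_int hf.
  + by move=> s _; rewrite lee_fin.
Qed.

(** Cauchy-Schwarz against the constant vector with entries 1, whose norm [sqrt (k T)] is relaxed to
    [k sqrt T]. *)
Lemma Rintegral_l1_le k (f : R -> 'cV[R]_k) : 0 <= T -> L2 T f ->
  \int[mu]_(s in D) l1 (f s) <= (k%:R * Num.sqrt T) * L2norm T f.
Proof.
move=> T0 hf.
pose u : R -> 'cV[R]_k := fun s => \col_i `|f s i 0|.
pose w : R -> 'cV[R]_k := fun=> const_mx 1.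
have hu : L2 T u.
  by move=> i; have := sqint_norm (L2_coord i hf); congr sqint; apply/funext => s; rewrite mxE.
have hw : L2 T w.
  by move=> i; have := sqint_cst 1; congr sqint; apply/funext => s; rewrite mxE.
have -> : \int[mu]_(s in D) l1 (f s) = vip T u w.
  rewrite vip_inner//; apply: eq_Rintegral => s _; rewrite l1_cV.
  by apply: eq_bigr => i _; rewrite !mxE mulr1.
apply: le_trans (ler_norm _) _; apply: le_trans (L2_cauchy_schwarz hu hw) _.
have -> : L2norm T u = L2norm T f.
  congr Num.sqrt; apply: eq_bigr => i _; apply: eq_Rintegral => s _.
  by rewrite mxE real_normK ?num_real.
rewrite mulrC ler_wpM2r ?L2norm_ge0//.
have -> : L2norm T w = Num.sqrt (k%:R * T).
  congr Num.sqrt; under eq_bigr => i _.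
    under eq_Rintegral do rewrite mxE expr1n.
    rewrite Rintegral_cst_Icc// mul1r; over.
  by rewrite sumr_const card_ord mulr_natl.
rewrite sqrtrM ?ler0n// ler_wpM2r ?sqrtr_ge0//.
case: k {u w hu hw f hf} => [|k]; first by rewrite sqrtr0.
rewrite -[leRHS]ger0_norm ?ler0n// -sqrtr_sqr ler_sqrt ?sqr_ge0// expr2.
by rewrite -[leLHS]mulr1 ler_wpM2l// ler1n.
Qed.

Lemma continuous_Icc_bounded (f : R -> R) : {within D, continuous f} ->
  exists2 M : R, 0 <= M & forall t, D t -> `|f t| <= M.
Proof.
rewrite {1}/Icc -set_itvcc => cf.
have := @compact_bounded _ _ (f @` `[0, T]).
have /[swap] /[apply] : compact (f @` `[0, T]).
  by apply: continuous_compact => //; exact: segment_compact.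
move=> [M [_ /(_ (`|M| + 1))]]; rewrite (le_lt_trans (ler_norm M)) ?ltrDl// => /(_ erefl) h.
exists (`|M| + 1); first by rewrite addr_ge0.
by move=> t Dt; apply: h; exists t => //; rewrite /= in_itv.
Qed.

Lemma bounded_sqint (f : R -> R) M : measurable_fun D f -> (forall t, D t -> `|f t| <= M) ->
  sqint mu D f.
Proof.
move=> mf fM; split => //; have [_] := sqint_cst M; apply: le_lt_trans.
apply: ge0_le_integral => //.
- by move=> t _; rewrite lee_fin sqr_ge0.
- by apply/measurable_EFinP; exact: measurable_funX.
- move=> t Dt; rewrite lee_fin -[leLHS]real_normK ?num_real//.
  have := fM t Dt => h; rewrite ler_pXn2r// nnegrE//.
  exact: le_trans h.
Qed.

Lemma continuous_Icc_measurable (f : R -> R) : {within D, continuous f} -> measurable_fun D f.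
Proof. by move=> cf; apply: subspace_continuous_measurable_fun. Qed.

Lemma primitive_continuous (g : R -> R) a : 0 <= T -> mu.-integrable D (EFin \o g) ->
  {within D, continuous (fun t => a + \int[mu]_(s in Icc 0 t) g s)}.
Proof.
move=> T0 hg.
have := @parameterized_integral_continuous R 0 T g T0.
rewrite /parameterized_integral !set_itvcc => /(_ hg) h.
have -> : (fun t => a + \int[mu]_(s in Icc 0 t) g s) =
   (cst a \+ (fun t => \int[mu]_(s in `[0, t]) g s)).
  by apply/funext => t /=; rewrite set_itvcc.
move=> t; apply: cvgD; first exact: cvg_cst.
exact: h.
Qed.

Lemma eq_within_continuous (V : topologicalType) (f g : R -> V) :
  (forall t, D t -> f t = g t) -> {within D, continuous f} -> {within D, continuous g}.
Proof. by move=> fg; apply: subspace_eq_continuous => t /set_mem; exact: fg. Qed.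

Lemma within_continuous_coordP k (x : R -> 'cV[R]_k) :
  {within D, continuous x} <-> forall i, {within D, continuous (fun t => x t i 0)}.
Proof.
split=> [cx i t|cx t].
  apply: (@cvg_comp _ _ _ x (fun M : 'cV[R]_k => M i 0) _ _ _ (cx t)).
  exact: coord_continuous.
move=> A [P nP sPA].
apply: filterS sPA _.
have h i : nbhs (t : subspace D) [set s | P i 0 (x s i 0)].
  by apply: (cx i t); exact: nP.
have F : Filter (nbhs (t : subspace D)) by exact: nbhs_filter.
have := filter_forall F h.
by apply: filterS => s /= H i j; rewrite (ord1 j); exact: H.
Qed.

Lemma H1deriv_continuous k (x g : R -> 'cV[R]_k) : 0 <= T -> H1deriv T x g ->
  {within D, continuous x}.
Proof.
move=> T0 [hg hx]; apply/within_continuous_coordP => i.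
have := primitive_continuous (a := x 0 i 0) T0 (L2_integrable i hg).
by apply: eq_within_continuous => t Dt; rewrite [in RHS]hx// !mxE.
Qed.

Lemma H1deriv_Sfun k (x g : R -> 'cV[R]_k) : 0 <= T -> H1deriv T x g -> Sfun T x.
Proof. by move=> T0 hx; split; [exact: H1deriv_continuous hx|exists g]. Qed.

Lemma continuous_L2 k (x : R -> 'cV[R]_k) : {within D, continuous x} -> L2 T x.
Proof.
move=> /within_continuous_coordP cx i.
have [M _ hM] := continuous_Icc_bounded (cx i).
by apply: (bounded_sqint _ hM); exact: continuous_Icc_measurable.
Qed.

Lemma H1deriv_L2 k (x g : R -> 'cV[R]_k) : 0 <= T -> H1deriv T x g -> L2 T x.
Proof. by move=> T0 /(H1deriv_continuous T0); exact: continuous_L2. Qed.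

Lemma H1derivD k (x y g h : R -> 'cV[R]_k) : H1deriv T x g -> H1deriv T y h ->
  H1deriv T (fun t => x t + y t) (fun t => g t + h t).
Proof.
move=> [hg hx] [hh hy]; split; first exact: L2D.
move=> t /[dup] /andP[_ tT] Dt; rewrite vintD// hx// hy//.
by rewrite addrACA.
Qed.

Lemma H1derivM p q (M : 'M[R]_(p, q)) (x g : R -> 'cV[R]_q) : H1deriv T x g ->
  H1deriv T (fun t => M *m x t) (fun t => M *m g t).
Proof.
move=> [hg hx]; split; first exact: L2M.
by move=> t /[dup] /andP[_ tT] Dt; rewrite vintM// hx// mulmxDr.
Qed.

Lemma H1derivZ k a (x g : R -> 'cV[R]_k) : H1deriv T x g ->
  H1deriv T (fun t => a *: x t) (fun t => a *: g t).
Proof.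
move=> [hg hx]; split; first exact: L2Z.
by move=> t /[dup] /andP[_ tT] Dt; rewrite vintZ// hx// scalerDr.
Qed.

Lemma H1deriv0 k : H1deriv T (fun=> 0 : 'cV[R]_k) (fun=> 0).
Proof. by split; [exact: L2_0|move=> t _; rewrite vint0 addr0]. Qed.

Lemma H1deriv_sum k (I : Type) (r : seq I) (P : pred I) (x g : I -> R -> 'cV[R]_k) :
  (forall i, P i -> H1deriv T (x i) (g i)) ->
  H1deriv T (fun t => \sum_(i <- r | P i) x i t) (fun t => \sum_(i <- r | P i) g i t).
Proof.
move=> h; elim: r => [|i r IH].
  by under eq_fun do rewrite big_nil; under [X in H1deriv _ _ X]eq_fun do rewrite big_nil;
     exact: H1deriv0.
under eq_fun do rewrite big_cons; under [X in H1deriv _ _ X]eq_fun do rewrite big_cons.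
have [Pi|nPi] := boolP (P i); [by apply: H1derivD => //; exact: h|by []].
Qed.

Lemma eq_H1deriv k (x y g h : R -> 'cV[R]_k) : 0 <= T -> (forall t, D t -> x t = y t) ->
  (forall t, D t -> g t = h t) -> H1deriv T x g -> H1deriv T y h.
Proof.
move=> T0 xy gh [hg hx]; split; first exact: eq_L2 hg.
move=> t /[dup] /andP[_ tT] Dt; rewrite -(xy t)// -(xy 0) ?/Icc/= ?lexx// hx//; congr (_ + _).
by apply: eq_vint => s /andP[s0 st]; apply: gh; rewrite /Icc/= s0 (le_trans st).
Qed.

Lemma Snorm_ge0 k (x g : R -> 'cV[R]_k) : 0 <= Snorm T x g.
Proof. by rewrite addr_ge0 ?vnorm_ge0// L2norm_ge0. Qed.

(** The unspecified derivative inside [Sfun] is replaced by the one that the equation dictates, so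
    that solutions can be handled by the calculus of [H1deriv]. *)
Lemma is_solP k (M : 'M[R]_k) x0 f (x : R -> 'cV[R]_k) : 0 <= T -> L2 T f ->
  is_sol T M x0 f x <-> x 0 = x0 /\ H1deriv T x (fun t => M *m x t + f t).
Proof.
move=> T0 hf; split=> [[[cx _] hx]|[x00 hx]].
  have xx0 : x 0 = x0 by rewrite hx ?lexx// vint_at0 addr0.
  split=> //; split; last by rewrite xx0.
  by apply: L2D => //; apply: L2M; exact: continuous_L2.
by split; [exact: H1deriv_Sfun hx|rewrite -x00; case: hx].
Qed.

Lemma Rintegral_Icc_split (g : R -> R) y : 0 <= y <= T -> mu.-integrable D (EFin \o g) ->
  \int[mu]_(s in Icc y T) g s =
  \int[mu]_(s in Icc 0 T) g s - \int[mu]_(s in Icc 0 y) g s.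
Proof.
move=> /andP[y0 yT] hg; rewrite /Icc -!set_itvcc in hg *.
rewrite Rintegral_itvB ?bnd_simp// Rintegral_itv_obnd_cbnd//.
by apply: integrableS hg => //; apply: subset_itvScc; rewrite ?bnd_simp.
Qed.

Lemma in_Icc (a b t : R) : (t \in Icc a b) = (a <= t <= b).
Proof. by apply/idP/idP; rewrite inE. Qed.

(** This lemma and the next two evaluate, slice by slice, an integrand on the whole plane that is
    supported in the triangle [0 <= y <= x <= T]; Fubini can then be applied on the plane. *)
Lemma restrict_triangle_l (g h : R -> R) x y : 0 <= x <= T ->
  (g \_ D) x * (h \_ D) y * (y <= x)%R%:R = g x * (h \_ (Icc 0 x)) y.
Proof.
move=> x0T; have /andP[x0 xT] := x0T; rewrite !patchE !in_Icc x0T.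
have [y0|] := leP 0 y; last by rewrite /= !(mulr0, mul0r).
have [yx|] := leP y x; first by rewrite (le_trans yx xT) mulr1.
by rewrite /= !mulr0.
Qed.

Lemma restrict_triangle_r (g h : R -> R) x y : 0 <= y <= T ->
  (g \_ D) x * (h \_ D) y * (y <= x)%R%:R = h y * (g \_ (Icc y T)) x.
Proof.
move=> y0T; have /andP[y0 yT] := y0T; rewrite !patchE !in_Icc y0T.
have [yx|] := leP y x; last by rewrite /= !mulr0.
by rewrite (le_trans y0 yx)/= mulr1 mulrC.
Qed.

Lemma restrict_triangle0 (g h : R -> R) x y : ~~ (0 <= x <= T) || ~~ (0 <= y <= T) ->
  (g \_ D) x * (h \_ D) y * (y <= x)%R%:R = 0.
Proof.
by rewrite !patchE !in_Icc => /orP[] /negbTE ->; rewrite !(mulr0, mul0r).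
Qed.

Lemma restrict_Icc_integrable (g : R -> R) a b : mu.-integrable (Icc a b) (EFin \o g) ->
  mu.-integrable setT (EFin \o (g \_ (Icc a b))).
Proof.
move=> hg; rewrite -restrict_EFin.
exact: (@integrable_mkcond _ (measurableTypeR R) R mu _ _ (measurable_Icc a b)).1.
Qed.

Lemma integral_scale_restrict (c : R) (g : R -> R) a b :
  mu.-integrable (Icc a b) (EFin \o g) ->
  (\int[mu]_x (c * (g \_ (Icc a b)) x)%:E = (c * \int[mu]_(s in Icc a b) g s)%:E)%E.
Proof.
move=> hg; have hg' := restrict_Icc_integrable hg.
under eq_integral do rewrite EFinM.
rewrite (integralZl measurableT hg') EFinM Rintegral_mkcond /Rintegral fineK//.
exact: (integrable_fin_num measurableT hg').
Qed.

(** The integrand is bounded by [|g x| |h y|], whose iterated integral is finite, hence it is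
    integrable for the product measure. *)
Lemma fubini_swap (g h : R -> R) :
  mu.-integrable D (EFin \o g) -> mu.-integrable D (EFin \o h) ->
  (\int[mu]_x \int[mu]_y ((g \_ D) x * (h \_ D) y * (y <= x)%R%:R)%:E =
   \int[mu]_y \int[mu]_x ((g \_ D) x * (h \_ D) y * (y <= x)%R%:R)%:E)%E.
Proof.
move=> hg hh.
pose ge := g \_ D; pose he := h \_ D.
have ige : mu.-integrable setT (EFin \o ge).
  exact: restrict_Icc_integrable.
have ihe : mu.-integrable setT (EFin \o he).
  exact: restrict_Icc_integrable.
have mge : measurable_fun setT ge by apply/measurable_EFinP; exact: measurable_int ige.
have mhe : measurable_fun setT he by apply/measurable_EFinP; exact: measurable_int ihe.
pose E := [set z : measurableTypeR R * measurableTypeR R | z.2 <= z.1].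
have mE : measurable E.
  by rewrite -[E]setTI; apply: measurable_fun_le => //; exact: measurable_snd.
pose f (z : measurableTypeR R * measurableTypeR R) : R := ge z.1 * he z.2 * \1_E z.
have mf : measurable_fun setT (EFin \o f).
  apply/measurable_EFinP; apply: measurable_funM; last exact: measurable_indic.
  apply: measurable_funM.
  - by apply: measurableT_comp mge _; exact: measurable_fst.
  - by apply: measurableT_comp mhe _; exact: measurable_snd.
pose c := \int[mu]_y `|he y|.
have c_fin : (\int[mu]_y `|he y|%:E)%E = c%:E.
  by rewrite /c /Rintegral fineK//; apply: integrable_fin_num => //; exact: integrable_norm ihe.
have fE x y : f (x, y) = (g \_ D) x * (h \_ D) y * (y <= x)%R%:R.
  by rewrite /f /= indicE; congr (_ * (nat_of_bool _)%:R); apply/idP/idP; rewrite inE.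
have iF : (mu \x mu)%E.-integrable setT (EFin \o f).
  apply/integrable12ltyP => //.
  have : mu.-integrable setT (fun x => c%:E * (`|ge x|)%:E)%E.
    by apply: integrableZl => //; exact: integrable_norm ige.
  move=> /integrableP[mc]; apply: le_lt_trans; apply: ge0_le_integral => //.
  - by move=> x _; apply: integral_ge0.
  - by apply: (measurable_fun_fubini_tonelli_F (abse \o (EFin \o f))) => //=; exact: measurableT_comp.
  - exact: measurableT_comp.
  - move=> x _; rewrite gee0_abs ?mule_ge0 ?lee_fin//; last exact: Rintegral_ge0.
    rewrite -c_fin muleC -ge0_integralZl//; last by apply/measurable_EFinP; exact: measurableT_comp.
    apply: ge0_le_integral => //.
    + apply: measurableT_comp => //.
      by apply: measurableT_comp mf _; exact: measurable_pair1.
    + by apply: measurable_funeM; apply/measurable_EFinP; exact: measurableT_comp.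
    + move=> y _; rewrite -EFinM lee_fin /f normrM normrM ler_piMr ?mulr_ge0//.
      by rewrite indicE; case: (_ \in _); rewrite ?normr0 ?normr1.
have := Fubini iF.
under eq_integral => x _ do under eq_integral do rewrite /= fE.
by move=> ->; apply: eq_integral => y _; apply: eq_integral => x _; rewrite /= fE.
Qed.

Lemma fubini_inner_l (g h : R -> R) : mu.-integrable D (EFin \o h) ->
  (\int[mu]_x \int[mu]_y ((g \_ D) x * (h \_ D) y * (y <= x)%R%:R)%:E =
    (\int[mu]_(t in D) (g t * \int[mu]_(s in Icc 0 t) h s)%:E))%E.
Proof.
move=> hh.
rewrite [RHS]integral_mkcond; apply: eq_integral => x _; rewrite [RHS]patchE in_Icc.
  case: ifPn => Dx.
    under eq_integral do rewrite restrict_triangle_l//.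
    by apply: integral_scale_restrict; apply: integrable_Icc => //; case/andP: Dx.
  by rewrite integral0_eq// => y _; rewrite restrict_triangle0// Dx.
Qed.

Lemma fubini_inner_r (g h : R -> R) : mu.-integrable D (EFin \o g) ->
  (\int[mu]_y \int[mu]_x ((g \_ D) x * (h \_ D) y * (y <= x)%R%:R)%:E =
    (\int[mu]_(t in D) (h t * \int[mu]_(s in Icc t T) g s)%:E))%E.
Proof.
move=> hg.
rewrite [RHS]integral_mkcond; apply: eq_integral => y _; rewrite [RHS]patchE in_Icc.
  case: ifPn => Dy.
    under eq_integral do rewrite restrict_triangle_r//.
    apply: integral_scale_restrict; apply: integrableS hg => // s /andP[ys sT].
    by apply/andP; split => //; apply: le_trans ys; case/andP: Dy.
  by rewrite integral0_eq// => x _; rewrite restrict_triangle0// Dy orbT.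
Qed.

(** Integration by parts for two primitives. Fubini turns the first term into the integral of [h t]
    times the integral of [g] over [[t, T]]; added to the second term, the inner integrals complete
    to the integral of [g] over [[0, T]]. Square integrability of [h] serves its product with the
    bounded primitive of [g]. *)
Lemma fubini_triangle (g h : R -> R) : 0 <= T ->
  mu.-integrable D (EFin \o g) -> sqint mu D h ->
  (\int[mu]_(t in D) g t) * (\int[mu]_(t in D) h t) =
  \int[mu]_(t in D) (g t * \int[mu]_(s in Icc 0 t) h s) +
  \int[mu]_(t in D) (h t * \int[mu]_(s in Icc 0 t) g s).
Proof.
move=> T0 hg h2.
have hh : mu.-integrable D (EFin \o h).
  have := sqint_mul_integrable (measurable_Icc 0 T) h2 (sqint_cst 1).
  by apply: eq_integrable => // t _; rewrite mulr1.
have -> : \int[mu]_(t in D) (g t * \int[mu]_(s in Icc 0 t) h s) =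
    \int[mu]_(t in D) (h t * \int[mu]_(s in Icc t T) g s).
  congr fine; transitivity (\int[mu]_x \int[mu]_y ((g \_ D) x * (h \_ D) y * (y <= x)%R%:R)%:E)%E.
    by symmetry; exact: fubini_inner_l.
  by rewrite (fubini_swap hg hh); exact: fubini_inner_r.
set G := \int[mu]_(t in D) g t.
have cG := primitive_continuous (a := 0) T0 hg.
have G2 : sqint mu D (fun t => \int[mu]_(s in Icc 0 t) g s).
  have cG' : {within D, continuous (fun t => \int[mu]_(s in Icc 0 t) g s)}.
    by apply: eq_within_continuous cG => t _; rewrite add0r.
  have [K _ hK] := continuous_Icc_bounded cG'.
  by apply: (bounded_sqint _ hK); exact: continuous_Icc_measurable.
have -> : \int[mu]_(t in D) (h t * \int[mu]_(s in Icc t T) g s) =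
   \int[mu]_(t in D) (G * h t - h t * \int[mu]_(s in Icc 0 t) g s).
  by apply: eq_Rintegral => t /set_mem Dt; rewrite Rintegral_Icc_split// mulrBr mulrC.
rewrite RintegralB//; last exact: sqint_mul_integrable.
  by rewrite RintegralZl// subrK.
exact: integrableZl hh.
Qed.

(** In each coordinate, both functions are an initial value plus a primitive; all terms cancel
    except the product of the two primitives at [T], which is [fubini_triangle]. *)
Lemma H1_duality k (x y g h : R -> 'cV[R]_k) : 0 <= T ->
  H1deriv T x g -> H1deriv T y h ->
  inner (x T) (y T) - inner (x 0) (y 0) = vip T g y + vip T x h.
Proof.
move=> T0 Hx Hy; have [hg hx] := Hx; have [hh hy] := Hy.
have hx2 := H1deriv_L2 T0 Hx; have hy2 := H1deriv_L2 T0 Hy.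
rewrite /inner /vip -sumrB -big_split; apply: eq_bigr => i _ /=.
have TT : 0 <= T <= T by rewrite T0 lexx.
have gi := L2_integrable i hg; have hi := L2_integrable i hh.
have eg t : D t -> g t i 0 * y t i 0 =
    y 0 i 0 * g t i 0 + g t i 0 * \int[mu]_(s in Icc 0 t) h s i 0.
  by move=> Dt; rewrite hy// !mxE mulrDr mulrC.
have eh t : D t -> x t i 0 * h t i 0 =
    x 0 i 0 * h t i 0 + h t i 0 * \int[mu]_(s in Icc 0 t) g s i 0.
  by move=> Dt; rewrite hx// !mxE mulrDl [in X in _ + X]mulrC.
rewrite (@eq_Rintegral _ _ _ mu D (fun t => y 0 i 0 * g t i 0 + g t i 0 * \int[mu]_(s in Icc 0 t) h s i 0)); last first.
  by move=> t /set_mem; exact: eg.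
rewrite [in X in _ = _ + X](@eq_Rintegral _ _ _ mu D (fun t => x 0 i 0 * h t i 0 + h t i 0 * \int[mu]_(s in Icc 0 t) g s i 0)); last first.
  by move=> t /set_mem; exact: eh.
have i1 : mu.-integrable D (EFin \o (fun t => y 0 i 0 * g t i 0)) by exact: integrableZl gi.
have i2 : mu.-integrable D (EFin \o (fun t => x 0 i 0 * h t i 0)) by exact: integrableZl hi.
have i3 : mu.-integrable D (EFin \o (fun t => g t i 0 * \int[mu]_(s in Icc 0 t) h s i 0)).
  have := integrableB (measurable_Icc 0 T) (vip_coord_int i hg hy2) i1.
  by apply: eq_integrable => // t /set_mem Dt; rewrite /= eg// EFinD addeC addeK.
have i4 : mu.-integrable D (EFin \o (fun t => h t i 0 * \int[mu]_(s in Icc 0 t) g s i 0)).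
  have := integrableB (measurable_Icc 0 T) (vip_coord_int i hx2 hh) i2.
  by apply: eq_integrable => // t /set_mem Dt; rewrite /= eh// EFinD addeC addeK.
rewrite RintegralD// RintegralD// RintegralZl// RintegralZl//.
rewrite [x T]hx// [y T]hy// !mxE.
have := fubini_triangle T0 gi (L2_coord i hh).
set I1 := \int[mu]_(t in D) (g t i 0 * _); set I2 := \int[mu]_(t in D) (h t i 0 * _).
move=> e; rewrite mulrDl !mulrDr e; ring.
Qed.

End PrimitiveIntegrals.

(** * Completeness: absolutely convergent series of square-integrable functions *)

Section Completeness.
Context {R : realType}.
Variable T : R.
Local Notation mu := (@lebesgue_measure R).
Local Notation D := (Icc 0 T).

Lemma measurable_fun_limn_einf (f : nat -> R -> \bar R) :
  (forall n, measurable_fun D (f n)) -> measurable_fun D (fun x => limn_einf (f ^~ x)).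
Proof.
move=> mf.
have -> : (fun x => limn_einf (f ^~ x)) = (fun x => - limn_esup (-%E \o (f ^~ x)))%E.
  by apply/funext => x; rewrite limn_esupN oppeK.
apply: measurableT_comp => //.
apply: (@measurable_fun_limn_esup _ _ _ D (fun n x => - f n x)%E) => n.
exact: measurableT_comp.
Qed.

Lemma limn_einf_le (u : nat -> \bar R) c N :
  (forall n, (N <= n)%N -> (u n <= c)%E) -> (limn_einf u <= c)%E.
Proof.
move=> uc; rewrite limn_einf_lim; apply: lime_le; first exact: is_cvg_einfs.
near=> m; apply: (@le_trans _ _ (u (maxn m N))); last by apply: uc; rewrite leq_maxr.
by apply: ereal_inf_lbound; exists (maxn m N) => //=; rewrite leq_maxl.
Unshelve. all: by end_near. Qed.

(** Fatou for the squares. A lower limit ignores finitely many terms, so the bound is asked only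
    from [N] on, as tail estimates require. *)
Lemma fatou_sqint (u : nat -> R -> R) (v : R -> R) (c : R) N :
  (forall n, sqint mu D (u n)) -> measurable_fun D v ->
  {ae mu, forall t : R, D t -> u n t @[n --> \oo] --> v t} ->
  (forall n, (N <= n)%N -> \int[mu]_(t in D) (u n t) ^+ 2 <= c) ->
  sqint mu D v /\ \int[mu]_(t in D) (v t) ^+ 2 <= c.
Proof.
move=> hu mv uv uc.
have mu2 n : measurable_fun D (fun t => ((u n t) ^+ 2)%:E).
  by apply/measurable_EFinP; apply: measurable_funX; case: (hu n).
suff vc : (\int[mu]_(t in D) ((v t) ^+ 2)%:E <= c%:E)%E.
  split; first by split => //; rewrite (le_lt_trans vc)// ltry.
  rewrite -lee_fin /Rintegral fineK// ge0_fin_numE ?(le_lt_trans vc) ?ltry//.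
  by apply: integral_ge0 => t _; rewrite lee_fin sqr_ge0.
have -> : (\int[mu]_(t in D) ((v t) ^+ 2)%:E =
    \int[mu]_(t in D) limn_einf (fun n => ((u n t) ^+ 2)%:E))%E.
  apply: ge0_ae_eq_integral => //.
  - by apply/measurable_EFinP; exact: measurable_funX.
  - exact: measurable_fun_limn_einf.
  - by move=> t _; rewrite lee_fin sqr_ge0.
  - move=> t _; rewrite limn_einf_lim; apply: lime_ge; first exact: is_cvg_einfs.
    near=> m; apply: le_ereal_inf_tmp => _ [n _ <-].
    by rewrite lee_fin sqr_ge0.
  - apply: filterS uv; first exact: (ae_filter_ringOfSetsType mu).
    move=> t /= h /h ut; apply/esym.
    apply: (cvg_limn_einf_sup _).1; apply: cvg_EFin; first by near=> n.
    by rewrite /comp /=; apply: cvgM.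
apply: le_trans (fatou mu _ mu2 _) _ => //.
  by move=> n t _; rewrite lee_fin sqr_ge0.
apply: (@limn_einf_le _ _ N) => n Nn; have := uc n Nn; rewrite -lee_fin /Rintegral fineK//.
rewrite ge0_fin_numE; first by case: (hu n).
by apply: integral_ge0 => t _; rewrite lee_fin sqr_ge0.
Unshelve. all: by end_near. Qed.

(** The sum of the absolute values has integral at most [rho], hence is finite almost everywhere,
    and absolute convergence gives convergence. *)
Lemma abs_series_ae_cvg (h : nat -> R -> R) rho :
  (forall n, mu.-integrable D (EFin \o h n)) ->
  (forall N, \sum_(0 <= n < N) \int[mu]_(t in D) `|h n t| <= rho) ->
  {ae mu, forall t : R, D t -> cvgn (fun N => \sum_(0 <= n < N) h n t)}.
Proof.
move=> hh hrho.
have mabs n : measurable_fun D (fun t => `|h n t|%:E).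
  by have := measurable_int _ (integrable_norm (hh n)).
have lexx_abs n t : (0 <= `|h n t|%:E)%E by rewrite lee_fin.
have intE n : (\int[mu]_(t in D) `|h n t|%:E = (\int[mu]_(t in D) `|h n t|)%:E)%E.
  by rewrite /Rintegral fineK//; apply: integrable_fin_num => //; exact: integrable_norm (hh n).
have iG : mu.-integrable D (fun t => \sum_(0 <= n <oo) `|h n t|%:E)%E.
  apply/integrableP; split.
    have mG := @ge0_emeasurable_sum _ (measurableTypeR R) R D (fun n t => `|h n t|%:E) predT
      (fun n t _ _ => lexx_abs n t) (fun n _ => mabs n).
    by apply: eq_measurable_fun mG => t _; exact: eq_eseriesl.
  under eq_integral => t _.
    rewrite gee0_abs; last by apply: nneseries_ge0 => n _ _; rewrite lee_fin.
    over.
  rewrite integral_nneseries//.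
  apply: (@le_lt_trans _ _ rho%:E); last exact: ltry.
  apply: lime_le; first by apply: is_cvg_nneseries => n _ _; apply: integral_ge0.
  near=> N; under eq_bigr do rewrite intE.
  by rewrite sumEFin lee_fin.
have := integrable_ae (measurable_Icc 0 T) iG.
apply: filterS => t /= H /H; rewrite ge0_fin_numE; last first.
  by apply: nneseries_ge0 => n _ _; rewrite lee_fin.
move=> fin; apply: normed_cvg.
have -> : [normed series (h^~ t)] = series (fun n => `|h n t|) by [].
apply: nondecreasing_is_cvgn.
  by move=> N M NM; rewrite /series/= (big_cat_nat _ NM)//= lerDl sumr_ge0.
exists (fine (\sum_(0 <= n <oo) `|h n t|%:E)%E) => _ [N _ <-].
rewrite -lee_fin fineK; last first.
  rewrite ge0_fin_numE//.
  by apply: nneseries_ge0 => n _ _; rewrite lee_fin.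
rewrite /series/= -sumEFin; apply: nneseries_lim_ge => n _ _; exact: lexx_abs.
Unshelve. all: by end_near. Qed.

(** The lower limit is measurable on the whole interval and equals the limit wherever the latter
    exists. *)
Lemma ae_cvg_measurable_limit (S : nat -> R -> R) :
  (forall N, measurable_fun D (S N)) ->
  {ae mu, forall t : R, D t -> cvgn (fun N => S N t)} ->
  exists2 H : R -> R, measurable_fun D H &
    {ae mu, forall t : R, D t -> S N t @[N --> \oo] --> H t}.
Proof.
move=> mS cS; exists (fun t => fine (limn_einf (fun N => (S N t)%:E))).
  apply: measurableT_comp => //; apply: measurable_fun_limn_einf => N.
  exact/measurable_EFinP.
apply: filterS cS; first exact: (ae_filter_ringOfSetsType mu).
move=> t /= h /h /cvg_ex[l Sl].
have lE : (S N t)%:E @[N --> \oo] --> l%:E by apply: cvg_EFin => //; near=> n.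
by rewrite (cvg_limn_einf_sup lE).1.
Unshelve. all: by end_near. Qed.

Lemma L2norm_coord_le k (f : R -> 'cV[R]_k) c : 0 <= c ->
  (forall i, \int[mu]_(t in D) (f t i 0) ^+ 2 <= c ^+ 2) -> L2norm T f <= k%:R * c.
Proof.
move=> c0 fc.
rewrite -(@ler_pXn2r _ 2)// ?nnegrE ?L2norm_ge0 ?mulr_ge0//.
rewrite L2norm_sqr (@le_trans _ _ (\sum_(i < k) c ^+ 2))//.
  by apply: ler_sum => i _; rewrite (le_trans _ (fc i)).
rewrite sumr_const card_ord -(mulr_natl (c ^+ 2)) exprMn ler_wpM2r ?sqr_ge0//.
by case: k {f fc} => [|k]; rewrite ?expr0n// expr2 -[leLHS]mulr1 ler_wpM2l// ler1n.
Qed.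

(** Riesz-Fischer with an explicit remainder. The L2 bounds give L1 bounds, hence an almost
    everywhere limit of each coordinate, and Fatou carries tail bounds to the limit; the factor [k]
    comes from bounding the coordinates separately. *)
Lemma L2_series_complete k (h : nat -> R -> 'cV[R]_k) rho : 0 <= T ->
  (forall n, L2 T (h n)) -> (forall N, \sum_(0 <= n < N) L2norm T (h n) <= rho) ->
  exists H, L2 T H /\ forall N c,
    (forall M, (N <= M)%N -> L2norm T (fun t => \sum_(N <= n < M) h n t) <= c) ->
    L2norm T (fun t => H t - \sum_(0 <= n < N) h n t) <= k%:R * c.
Proof.
move=> T0 hh hrho.
have hint n i := L2_integrable i (hh n).
have coordE (m n : nat) t i :
    (\sum_(m <= j < n) h j t) i 0 = \sum_(m <= j < n) (h j t i 0) by rewrite summxE.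
have l1rho i N : \sum_(0 <= n < N) \int[mu]_(t in D) `|h n t i 0| <= k%:R * Num.sqrt T * rho.
  apply: (@le_trans _ _ (\sum_(0 <= n < N) (k%:R * Num.sqrt T * L2norm T (h n)))).
    apply: ler_sum => n _; apply: le_trans (Rintegral_l1_le T0 (hh n)).
    apply: le_Rintegral => //.
    - exact: integrable_norm (hint n i).
    - exact: l1_integrable.
    - by move=> t _; exact: le_l1.
  by rewrite -mulr_sumr ler_wpM2l// mulr_ge0 ?sqrtr_ge0.
have sqS N M i : sqint mu D (fun t => \sum_(N <= n < M) h n t i 0).
  by apply: sqint_sum => // n; exact: L2_coord.
have /choice[H0 H0P] : forall i, exists H : R -> R, measurable_fun D H /\
    {ae mu, forall t : R, D t -> \sum_(0 <= n < N) h n t i 0 @[N --> \oo] --> H t}.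
  move=> i.
  have [|H mH cH] := ae_cvg_measurable_limit _ (abs_series_ae_cvg (fun n => hint n i) (l1rho i)).
    by move=> N; case: (sqS 0%N N i).
  by exists H.
have main i N c : (forall M, (N <= M)%N -> L2norm T (fun t => \sum_(N <= n < M) h n t) <= c) ->
    sqint mu D (fun t => H0 i t - \sum_(0 <= n < N) h n t i 0) /\
    \int[mu]_(t in D) (H0 i t - \sum_(0 <= n < N) h n t i 0) ^+ 2 <= c ^+ 2.
  move=> hc; have [mH cH] := H0P i.
  apply: (@fatou_sqint (fun M t => \sum_(0 <= n < M) h n t i 0 - \sum_(0 <= n < N) h n t i 0) _ _ N).
  - move=> M; have := sqint_lin (measurable_Icc 0 T) 1 (-1) (sqS 0%N M i) (sqS 0%N N i).
    by congr sqint; apply/funext => t; rewrite mul1r mulN1r.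
  - by apply: measurable_funB => //; case: (sqS 0%N N i).
  - apply: filterS cH; first exact: (ae_filter_ringOfSetsType mu).
    by move=> t /= H /H Ht; apply: cvgB => //; exact: cvg_cst.
  - move=> M NM.
    have := coord_L2norm T (fun t => \sum_(N <= n < M) h n t) i.
    under eq_Rintegral do rewrite coordE.
    move=> le1; apply: (@le_trans _ _ (L2norm T (fun t => \sum_(N <= n < M) h n t) ^+ 2)).
      apply: le_trans le1; rewrite le_eqVlt; apply/orP; left; apply/eqP.
      apply: eq_Rintegral => t _; congr (_ ^+ 2).
      by rewrite (big_cat_nat _ NM)//= addrAC subrr add0r.
    have := hc M NM; rewrite -(@ler_pXn2r _ 2)// ?nnegrE ?L2norm_ge0//.
    exact: le_trans (L2norm_ge0 _ _) (hc M NM).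
exists (fun t => \col_i H0 i t); split.
  (* Membership in L2 is the remainder estimate for the empty partial sum. *)
  move=> i; have [] := main i 0%N rho.
    move=> M _; apply: le_trans (L2norm_sum_le _ hh) _; exact: hrho.
  move=> sq _; move: sq; congr sqint; apply/funext => t.
  by rewrite mxE big_geq// subr0.
move=> N c hc; apply: L2norm_coord_le.
  exact: le_trans (L2norm_ge0 _ _) (hc N (leqnn N)).
move=> i; have [_] := main i N c hc; apply: le_trans.
rewrite le_eqVlt; apply/orP; left; apply/eqP; apply: eq_Rintegral => t _.
by rewrite !mxE summxE.
Qed.

End Completeness.

(** * Unordered sums over trees *)

Section TreeSums.
Context {R : realType}.

Lemma ler_sum_subseq (I : eqType) (s1 s2 : seq I) (f : I -> R) :
  uniq s1 -> uniq s2 -> {subset s1 <= s2} -> (forall i, 0 <= f i) ->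
  \sum_(i <- s1) f i <= \sum_(i <- s2) f i.
Proof.
move=> u1 u2 s12 f0.
rewrite [leRHS](bigID (mem s1))/= -[\sum_(i <- s2 | i \in s1) _]big_filter.
have perm : perm_eq [seq i <- s2 | i \in s1] s1.
  apply: uniq_perm => //; first exact: filter_uniq.
  by move=> i; rewrite mem_filter; case: (boolP (i \in s1)) => //= /s12 ->.
by rewrite (perm_big _ perm) lerDl sumr_ge0.
Qed.

(** An exhaustion of the trees by finite lists, ordered by their code, which reduces unordered sums
    to sequential series. *)
Definition tree_prefix (N : nat) : seq tree := pmap (@pickle_inv tree) (iota 0 N).

Lemma mem_tree_prefix N b : (b \in tree_prefix N) = (pickle b < N)%N.
Proof.
rewrite mem_pmap; apply/mapP/idP => [[n]|bN].
  rewrite mem_iota add0n => /= nN; have := @pickle_invK tree n.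
  by move=> + e; rewrite -e /= => ->.
by exists (pickle b); rewrite ?mem_iota// pickleK_inv.
Qed.

Lemma uniq_tree_prefix N : uniq (tree_prefix N).
Proof.
elim: N => // N IH; rewrite /tree_prefix -addn1 iotaD pmap_cat cat_uniq IH add0n /=.
case e : (pickle_inv N) => [b|]//=; rewrite andbT orbF.
have := @pickle_invK tree N; rewrite e /= => bN.
by rewrite -/(tree_prefix N) mem_tree_prefix bN ltnn.
Qed.

Lemma big_tree_prefix (V : zmodType) (a : tree -> V) N :
  \sum_(b <- tree_prefix N) a b = \sum_(0 <= n < N) oapp a 0 (@pickle_inv tree n).
Proof.
elim: N => [|N IH]; first by rewrite big_nil big_geq.
rewrite big_nat_recr//= -IH /tree_prefix -[in iota _ _]addn1 iotaD pmap_cat big_cat add0n /=.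
by case: (pickle_inv N) => [b|]; rewrite /= ?big_seq1 ?big_nil.
Qed.

(** Once a prefix sum is within [eps] of the supremum of all prefix sums, trees outside that prefix
    cannot add more than [eps]. *)
Lemma tree_sum_tail (w : tree -> R) rho eps : (forall b, 0 <= w b) ->
  (forall s, uniq s -> \sum_(b <- s) w b <= rho) -> 0 < eps ->
  exists N, forall s, uniq s -> (forall b, b \in s -> (N <= pickle b)%N) ->
    \sum_(b <- s) w b <= eps.
Proof.
move=> w0 wrho e0.
pose E := range (fun N => \sum_(b <- tree_prefix N) w b).
have hE : has_sup E.
  split; first by exists (\sum_(b <- tree_prefix 0) w b), 0%N.
  by exists rho => _ [N _ <-]; apply: wrho; exact: uniq_tree_prefix.
have [_ [N _ <-] hN] := sup_adherent e0 hE.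
exists N => s us sN.
(* A bound above every code in [s], so that one prefix contains both [s] and the prefix of length
   [N]. *)
pose M := (N + \sum_(b <- s) (pickle b).+1)%N.
have sM b : b \in s -> (pickle b < M)%N.
  move=> bs; rewrite /M (big_rem b)//= addnCA addSn ltnS -{1}[pickle b]addn0.
  by rewrite leq_add2l.
have h1 : \sum_(b <- tree_prefix N ++ s) w b <= \sum_(b <- tree_prefix M) w b.
  apply: ler_sum_subseq => //; [|exact: uniq_tree_prefix|].
    rewrite cat_uniq uniq_tree_prefix us andbT /=; apply/hasPn => b /sN Nb /=.
    by rewrite mem_tree_prefix -leqNgt.
  move=> b; rewrite mem_cat !mem_tree_prefix => /orP[bN|/sM//].
  by rewrite (leq_trans bN)// leq_addr.
have h2 : \sum_(b <- tree_prefix M) w b <= sup E by apply: ub_le_sup; [case: hE|exists M].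
move: h1; rewrite big_cat/=; lra.
Qed.

Variable T : R.

(** Finite sets are traded for duplicate-free lists, over which all later sums run. *)
Lemma tree_sum_L2P k (a : tree -> R -> 'cV[R]_k) V :
  tree_sum_L2 T a V <-> forall eps, 0 < eps -> exists s0, uniq s0 /\
    forall s, uniq s -> {subset s0 <= s} ->
      L2norm T (fun t => \sum_(b <- s) a b t - V t) < eps.
Proof.
split=> H eps e0.
  have [S0 [finS0 hS0]] := H eps e0.
  exists (finmap.enum_fset (fset_set S0)); split; first exact: finmap.fset_uniq.
  move=> s us s0s.
  have := hS0 [set` s] (finite_seq s); under [X in L2norm _ X]eq_fun do rewrite -fsbig_seq//.
  apply => b Sb; apply: s0s; rewrite in_fset_set//; exact/mem_set.
have [s0 [us0 hs0]] := H eps e0.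
exists [set` s0]; split; first exact: finite_seq.
move=> S finS s0S.
under [X in L2norm _ X]eq_fun do rewrite fsbig_finite//.
apply: hs0 => [|b]; first exact: finmap.fset_uniq.
by move=> /s0S Sb; rewrite in_fset_set//; exact/mem_set.
Qed.

Lemma tree_sum_exists k (a : tree -> R -> 'cV[R]_k) rho : 0 <= T ->
  (forall b, L2 T (a b)) -> (forall s, uniq s -> \sum_(b <- s) L2norm T (a b) <= rho) ->
  exists V, L2 T V /\ tree_sum_L2 T a V.
Proof.
move=> T0 ha hrho.
(* Integers that code no tree contribute the zero function. *)
pose h n : R -> 'cV[R]_k := oapp a (fun=> 0) (@pickle_inv tree n).
have hh n : L2 T (h n) by rewrite /h; case: pickle_inv => [b|]; [exact: ha|exact: L2_0].
have hE t n : h n t = oapp (a^~ t) 0 (@pickle_inv tree n) by rewrite /h; case: pickle_inv.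
have nE n : L2norm T (h n) = oapp (fun b => L2norm T (a b)) 0 (@pickle_inv tree n).
  by rewrite /h; case: pickle_inv => [b|]//=; rewrite L2norm0.
have [|V [hV Vlim]] := L2_series_complete (rho := rho) T0 hh.
  move=> N; under eq_bigr do rewrite nE.
  by rewrite -big_tree_prefix; apply: hrho; exact: uniq_tree_prefix.
exists V; split=> //; apply/tree_sum_L2P => eps e0.
have w0 b : 0 <= L2norm T (a b) by exact: L2norm_ge0.
(* The trees of [s] outside the prefix cost [e1] and the remainder of the series costs [k * e1]; the
   total [(k + 1) * e1] is strictly below [eps]. *)
pose e1 := eps / (k%:R + 2).
have k2 : 0 < k%:R + 2 :> R by rewrite ltr_wpDl.
have e10 : 0 < e1 by rewrite divr_gt0.
have [N tailN] := tree_sum_tail w0 hrho e10.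
exists (tree_prefix N); split; first exact: uniq_tree_prefix.
move=> s us s0s.
pose s1 := [seq b <- s | b \notin tree_prefix N].
have perm : perm_eq s (tree_prefix N ++ s1).
  apply: uniq_perm => //.
    rewrite cat_uniq uniq_tree_prefix filter_uniq// andbT /=.
    by apply/hasPn => b; rewrite mem_filter => /andP[].
  move=> b; rewrite mem_cat mem_filter; case: (boolP (b \in tree_prefix N)) => //= /s0s ->//.
have tail1 : \sum_(b <- s1) L2norm T (a b) <= e1.
  apply: tailN; first exact: filter_uniq.
  by move=> b; rewrite mem_filter mem_tree_prefix -leqNgt => /andP[].
have hS0 : L2 T (fun t => \sum_(0 <= n < N) h n t) by apply: L2_sum.
have hs1 : L2 T (fun t => \sum_(b <- s1) a b t) by apply: L2_sum.
have bound : L2norm T (fun t => V t - \sum_(0 <= n < N) h n t) <= k%:R * e1.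
  apply: Vlim => M NM; apply: le_trans (L2norm_sum_le _ hh) _.
  pose s2 := [seq b <- tree_prefix M | b \notin tree_prefix N].
  have : \sum_(b <- s2) L2norm T (a b) <= e1.
    apply: tailN; first by rewrite filter_uniq// uniq_tree_prefix.
    by move=> b; rewrite mem_filter mem_tree_prefix -leqNgt => /andP[].
  apply: le_trans; rewrite le_eqVlt; apply/orP; left; apply/eqP.
  have perm2 : perm_eq (tree_prefix M) (tree_prefix N ++ s2).
    apply: uniq_perm; first exact: uniq_tree_prefix.
      rewrite cat_uniq uniq_tree_prefix filter_uniq ?uniq_tree_prefix// andbT /=.
      by apply/hasPn => b; rewrite mem_filter => /andP[].
    move=> b; rewrite mem_cat mem_filter !mem_tree_prefix.
    by have [bN|bN] := ltnP (pickle b) N => //=; exact: leq_trans bN NM.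
  have : \sum_(b <- tree_prefix M) L2norm T (a b) =
      \sum_(b <- tree_prefix N) L2norm T (a b) + \sum_(b <- s2) L2norm T (a b).
    by rewrite (perm_big _ perm2) big_cat.
  rewrite !big_tree_prefix (big_cat_nat _ NM)//= => /addrI <-.
  by apply: eq_bigr => n _; rewrite nE.
have -> : (fun t => \sum_(b <- s) a b t - V t) =
    (fun t => \sum_(b <- s1) a b t + (\sum_(0 <= n < N) h n t - V t)).
  apply/funext => t; rewrite (perm_big _ perm)/= big_cat/= addrAC addrC; congr (_ + _).
  by rewrite big_tree_prefix; congr (_ - _); apply: eq_bigr => n _; rewrite hE.
apply: (@le_lt_trans _ _ (e1 + k%:R * e1)).
  apply: le_trans (L2norm_triangle hs1 _) _; first exact: L2B.
  apply: lerD; last by rewrite L2normC.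
  exact: le_trans (L2norm_sum_le _ ha) _.
have -> : eps = (k%:R + 2) * e1 by rewrite /e1 mulrC divfK// gt_eqF.
by rewrite -[X in X + _]mul1r -mulrDl ltr_pM2r// addrC ltrD2l ltr1n.
Qed.

End TreeSums.

(** * Linear differential equations: estimates, uniqueness, existence *)

Section LinearODE.
Context {R : realType}.
Variable T : R.
Hypothesis T0 : 0 <= T.
Local Notation mu := (@lebesgue_measure R).
Local Notation D := (Icc 0 T).

Lemma is_derive_expR_scale (c x : R) : c != 0 ->
  is_derive x 1 (fun s => c^-1 * expR (c * s)) (expR (c * x)).
Proof.
move=> c0; apply: is_derive_eq.
by rewrite /GRing.scale /= mulr1 mulrCA mulVf// mulr1.
Qed.

Lemma continuous_expR_scale (c : R) : continuous (fun s : R => expR (c * s)).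
Proof.
move=> x; apply: continuous_comp; last exact: continuous_expR.
by apply: continuousM; [exact: cst_continuous|exact: cvg_id].
Qed.

Lemma expR_scale_integrable (c t : R) :
  mu.-integrable (Icc 0 t) (EFin \o (fun s => expR (c * s))).
Proof.
rewrite /Icc -set_itvcc; apply: continuous_compact_integrable; first exact: segment_compact.
exact/continuous_subspaceT/continuous_expR_scale.
Qed.

Lemma Rintegral_expR_le (c t : R) : 0 < c -> 0 <= t ->
  \int[mu]_(s in Icc 0 t) expR (c * s) <= c^-1 * expR (c * t).
Proof.
move=> c0; rewrite le_eqVlt => /predU1P[<-|t0].
  have -> : Icc 0 0 = [set (0 : R)].
    by rewrite /Icc; apply/seteqP; split => x /=; [move=> /le_anti -> //|move=> ->; rewrite lexx].
  by rewrite Rintegral_set1 mulr_ge0 ?expR_ge0// invr_ge0 ltW.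
have cn0 : c != 0 by rewrite gt_eqF.
have dF x := is_derive_expR_scale x cn0.
have cF : continuous (fun s => c^-1 * expR (c * s)).
  by move=> x; apply/differentiable_continuous/derivable1_diffP; have [] := dF x.
rewrite /Rintegral /Icc -set_itvcc (continuous_FTC2 (F := fun s => c^-1 * expR (c * s)) t0).
- rewrite -EFinB /= lerBlDr lerDl mulr_ge0 ?expR_ge0// invr_ge0 ltW//.
- exact/continuous_subspaceT/continuous_expR_scale.
- split.
  + by move=> x _; have [] := dF x.
  + by apply: cvg_at_right_filter; exact: cF.
  + by apply: cvg_at_left_filter; exact: cF.
- by move=> x _; rewrite derive1E; have [_ ->] := dF x.
Qed.

(** Integrating the weight [expR (c * s)] gains a factor [1 / c], and [c = 2 |M| + 1] makes
    [|M| / c] at most one half while staying positive for [M = 0]. *)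
Lemma l1_vint_expR k (M : 'M[R]_k) (x : R -> 'cV[R]_k) C t :
  L2 T x -> 0 <= t <= T -> 0 <= C ->
  (forall s, D s -> l1 (x s) <= C * expR ((2 * l1 M + 1) * s)) ->
  l1 (vint (fun s => M *m x s) 0 t) <= C / 2 * expR ((2 * l1 M + 1) * t).
Proof.
move=> hx /andP[t0 tT] C0 xC; set c := 2 * l1 M + 1.
have M0 := l1_ge0 M.
have c0 : 0 < c by rewrite /c; lra.
apply: le_trans (l1_vint tT (L2M M hx)) _.
apply: (@le_trans _ _ (\int[mu]_(s in Icc 0 t) (l1 M * C * expR (c * s)))).
  apply: le_Rintegral => //.
  - exact: l1_integrable tT (L2M M hx).
  - have := integrableZl (measurable_Icc 0 t) (l1 M * C) (expR_scale_integrable c t).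
    by apply: eq_integrable.
  - move=> s /andP[s0 st]; apply: le_trans (l1M _ _) _.
    rewrite -mulrA ler_wpM2l// xC// /Icc/= s0 (le_trans st)//.
rewrite RintegralZl//; last exact: expR_scale_integrable.
apply: (@le_trans _ _ (l1 M * C * (c^-1 * expR (c * t)))).
  by rewrite ler_wpM2l ?mulr_ge0// Rintegral_expR_le.
rewrite mulrA ler_wpM2r ?expR_ge0// mulrAC mulrC ler_wpM2l//.
by rewrite ler_pdivrMr// /c; lra.
Qed.

Lemma L2norm_bounded k (x : R -> 'cV[R]_k) C : L2 T x -> 0 <= C ->
  (forall t, D t -> l1 (x t) <= C) -> L2norm T x <= k%:R * (Num.sqrt T * C).
Proof.
move=> hx C0 xC; apply: L2norm_coord_le; first by rewrite mulr_ge0 ?sqrtr_ge0.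
move=> i; rewrite exprMn sqr_sqrtr//.
apply: (@le_trans _ _ (\int[mu]_(t in D) (C ^+ 2))); last by rewrite Rintegral_cst_Icc// mulrC.
apply: le_Rintegral => //.
- exact: (sqint_sqr_integrable (L2_coord i hx)).
- exact: (sqint_sqr_integrable (sqint_cst T C)).
- move=> t Dt; rewrite -[leLHS]real_normK ?num_real// ler_pXn2r ?nnegrE//.
  exact: le_trans (le_l1 _ _ _) (xC t Dt).
Qed.

Lemma H1deriv_l1_bounded k (x g : R -> 'cV[R]_k) : H1deriv T x g ->
  exists2 C, 0 <= C & forall t, D t -> l1 (x t) <= C.
Proof.
move=> [hg hx]; exists (l1 (x 0) + \int[mu]_(s in D) l1 (g s)).
  by rewrite addr_ge0 ?l1_ge0// Rintegral_ge0// => t _; exact: l1_ge0.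
move=> t /[dup] Dt /andP[t0 tT]; rewrite hx//; apply: le_trans (l1D _ _) _.
rewrite lerD2l; apply: le_trans (l1_vint tT hg) _.
by apply: Rintegral_Icc_le => //; [move=> s; exact: l1_ge0|exact: (l1_integrable (lexx T))].
Qed.

(* Weighting by [exp(-(2|M|+1)t)] makes the integral operator a contraction of ratio 1/2, so the
   weighted supremum [m] satisfies [m <= b + m/2]. *)
Lemma gronwall k (M : 'M[R]_k) (x f : R -> 'cV[R]_k) : L2 T f ->
  H1deriv T x (fun t => M *m x t + f t) -> forall t, D t ->
  l1 (x t) <= 2 * (l1 (x 0) + \int[mu]_(s in D) l1 (f s)) * expR ((2 * l1 M + 1) * t).
Proof.
move=> hf Hx; set b := l1 (x 0) + _; set c := 2 * l1 M + 1.
have hx2 := H1deriv_L2 T0 Hx.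
have c0 : 0 <= c by rewrite /c addr_ge0// mulr_ge0// l1_ge0.
have [C C0 xC] := H1deriv_l1_bounded Hx.
pose E := [set l1 (x t) * expR (- (c * t)) | t in D].
have ubE : ubound E C.
  move=> _ [t Dt <-]; apply: (@le_trans _ _ (l1 (x t))); last exact: xC.
  rewrite -[leRHS]mulr1 ler_wpM2l ?l1_ge0// -expR0 ler_expR oppr_le0 mulr_ge0//.
  by case/andP: Dt.
have hE : has_sup E.
  split; last by exists C.
  by exists (l1 (x 0) * expR (- (c * 0))), 0 => //; rewrite /Icc/= lexx.
have b0 : 0 <= b.
  by rewrite addr_ge0 ?l1_ge0// Rintegral_ge0// => t _; exact: l1_ge0.
set m := sup E.
have xm t : D t -> l1 (x t) <= m * expR (c * t).
  move=> Dt; rewrite -ler_pdivrMr ?expR_gt0// -expRN.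
  by apply: ub_le_sup; [case: hE|exists t].
have m0 : 0 <= m.
  have := xm 0; rewrite /Icc/= lexx T0 mulr0 expR0 mulr1 => /(_ isT).
  exact: le_trans (l1_ge0 _).
have key t : D t -> l1 (x t) <= b + m / 2 * expR (c * t).
  move=> /[dup] Dt /andP[t0 tT]; case: (Hx) => _ hx; rewrite hx//.
  rewrite (vintD tT (L2M M hx2) hf) addrA -addrA.
  apply: le_trans (l1D _ _) _; rewrite /b -addrA lerD2l addrC.
  apply: le_trans (l1D _ _) _; rewrite lerD//; last exact: l1_vint_expR.
  apply: le_trans (l1_vint tT hf) _.
  apply: Rintegral_Icc_le => //; [move=> s; exact: l1_ge0|exact: (l1_integrable (lexx T))].
have m2b : m <= 2 * b.
  suff : m <= b + m / 2 by lra.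
  apply: ge_sup; first by case: hE.
  move=> _ [t Dt <-]; rewrite expRN ler_pdivrMr ?expR_gt0//.
  apply: le_trans (key t Dt) _; rewrite [leRHS]mulrDl lerD2r -[leLHS]mulr1 ler_wpM2l//.
  by rewrite -expR0 ler_expR mulr_ge0//; case/andP: Dt.
by move=> t Dt; apply: le_trans (xm t Dt) _; rewrite ler_wpM2r ?expR_ge0.
Qed.

(** Continuity of the linear solution map, in two forms: the pointwise one passes the condition at
    time [T] to the limit, the [Snorm] one feeds the bounds on the multilinear maps. *)
Lemma sol_bound k (M : 'M[R]_k) : exists2 K : R, 0 <= K &
  forall x0 f x, L2 T f -> is_sol T M x0 f x ->
    (forall t, D t -> l1 (x t) <= K * (vnorm x0 + L2norm T f)) /\
    Snorm T x (fun t => M *m x t + f t) <= K * (vnorm x0 + L2norm T f).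
Proof.
set c := 2 * l1 M + 1.
have c0 : 0 <= c by rewrite /c addr_ge0// mulr_ge0// l1_ge0.
pose B := 2 * (k%:R * (1 + Num.sqrt T)) * expR (c * T).
have B0 : 0 <= B by rewrite /B !mulr_ge0 ?expR_ge0 ?addr_ge0 ?sqrtr_ge0.
(* [B] is the pointwise constant given by [gronwall]; in [Snorm], the summand 1 accounts for [x0]
   and [f], and the last one for the term [M x] of the derivative. *)
pose K := B + 1 + l1 M * (k%:R * (Num.sqrt T * B)).
exists K; first by rewrite /K !addr_ge0// !mulr_ge0 ?l1_ge0 ?sqrtr_ge0.
move=> x0 f x hf /(is_solP _ _ _ T0 hf)[x00 Hx].
set N := vnorm x0 + L2norm T f.
have N0 : 0 <= N by rewrite addr_ge0 ?vnorm_ge0 ?L2norm_ge0.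
have xB t : D t -> l1 (x t) <= B * N.
  move=> Dt; apply: le_trans (gronwall hf Hx Dt) _.
  have e1 : expR ((2 * l1 M + 1) * t) <= expR (c * T).
    by rewrite ler_expR ler_wpM2l//; case/andP: Dt.
  apply: (@le_trans _ _ (2 * (l1 (x 0) + \int[mu]_(s in D) l1 (f s)) * expR (c * T))).
    rewrite ler_wpM2l// mulr_ge0// addr_ge0 ?l1_ge0// Rintegral_ge0// => s _.
    exact: l1_ge0.
  rewrite /B [leRHS]mulrAC ler_wpM2r ?expR_ge0// -mulrA ler_wpM2l//.
  rewrite /N x00 -mulrA; have := l1_le_vnorm x0; have := Rintegral_l1_le T0 hf.
  have := L2norm_ge0 T f; have := vnorm_ge0 x0; have := sqrtr_ge0 T.
  have : 0 <= k%:R :> R by [].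
  move=> k0 s0 v0 f0 h1 h2.
  have := mulr_ge0 k0 (mulr_ge0 s0 v0); have := mulr_ge0 k0 f0; nra.
have BN0 : 0 <= B * N by rewrite mulr_ge0.
have x2 := H1deriv_L2 T0 Hx.
have Mx : 0 <= l1 M * (k%:R * (Num.sqrt T * B)) by rewrite !mulr_ge0 ?l1_ge0 ?sqrtr_ge0.
split.
  move=> t /xB /le_trans; apply; rewrite ler_wpM2r// /K; lra.
rewrite /Snorm x00; apply: (@le_trans _ _ (vnorm x0 + (l1 M * L2norm T x + L2norm T f))).
  rewrite lerD2l; apply: le_trans (L2norm_triangle (L2M M x2) hf) _.
  by rewrite lerD2r; exact: L2normM.
have := L2norm_bounded x2 BN0 xB => /(ler_wpM2l (l1_ge0 M)) h.
have -> : K * N = B * N + N + l1 M * (k%:R * (Num.sqrt T * (B * N))) by rewrite /K; ring.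
have NE : vnorm x0 + L2norm T f = N by [].
lra.
Qed.

Lemma is_sol_unique k (M : 'M[R]_k) x0 f x y : L2 T f -> is_sol T M x0 f x ->
  is_sol T M x0 f y -> forall t, D t -> x t = y t.
Proof.
move=> hf /(is_solP _ _ _ T0 hf)[x00 Hx] /(is_solP _ _ _ T0 hf)[y00 Hy] t Dt.
have h0 : L2 T (fun=> 0 : 'cV[R]_k) by exact: L2_0.
have := H1derivD Hx (H1derivZ (-1) Hy).
set z := fun t => _ + _; set g := fun t => _ => Hz.
have {}Hz : H1deriv T z (fun t => M *m z t + 0).
  apply: eq_H1deriv Hz => // s _; rewrite /g /z addr0 mulmxDr -scalemxAr !scaleN1r opprD.
  by rewrite addrACA subrr addr0.
have := gronwall h0 Hz Dt.
have -> : z 0 = 0 by rewrite /z x00 y00 scaleN1r subrr.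
have l10 : l1 (0 : 'cV[R]_k) = 0.
  by rewrite /l1 big1// => i _; rewrite big1// => j _; rewrite mxE normr0.
rewrite l10 /Rintegral integral0_eq//.
rewrite /= addr0 mulr0 mul0r => /l1_eq0 /eqP.
by rewrite /z scaleN1r subr_eq0 => /eqP.
Qed.

(* [y n] is the n-th term of the Picard series. Its sum [H] is an [L2] limit only, so the solution
   is the continuous representative [x] read off the integral equation. *)
Lemma is_sol_exists k (M : 'M[R]_k) x0 f : L2 T f -> exists x, is_sol T M x0 f x.
Proof.
move=> hf; pose c := 2 * l1 M + 1.
have c0 : 0 <= c by rewrite /c addr_ge0// mulr_ge0// l1_ge0.
pose y := fix y n : R -> 'cV[R]_k :=
  if n is n'.+1 then fun t => vint (fun s => M *m y n' s) 0 t else fun t => x0 + vint f 0 t.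
pose dy n : R -> 'cV[R]_k := if n is n'.+1 then fun t => M *m y n' t else f.
have Hy n : H1deriv T (y n) (dy n).
  elim: n => [|n IH] /=.
    by split => // t _; rewrite vint_at0 addr0.
  split; first by apply: L2M; exact: H1deriv_L2 IH.
  by move=> t _; rewrite vint_at0 add0r.
have hy n := H1deriv_L2 T0 (Hy n).
have [C C0 yC] := H1deriv_l1_bounded (Hy 0%N).
have ey t : D t -> 1 <= expR (c * t).
  by case/andP => t0 _; rewrite -expR0 ler_expR mulr_ge0.
have ybound n t : D t -> l1 (y n t) <= C * 2^-1 ^+ n * expR (c * t).
  elim: n t => [|n IH] t Dt.
    apply: le_trans (yC t Dt) _; rewrite expr0 mulr1 -[leLHS]mulr1 ler_wpM2l//.
    exact: ey.
  apply: le_trans (l1_vint_expR (hy n) Dt _ IH) _; first by rewrite mulr_ge0// exprn_ge0.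
  by rewrite exprSr mulrA.
pose B := k%:R * (Num.sqrt T * (C * expR (c * T))).
have B0 : 0 <= B by rewrite /B !mulr_ge0 ?sqrtr_ge0 ?expR_ge0.
have yL2 n : L2norm T (y n) <= B * 2^-1 ^+ n.
  have h0 : 0 <= C * 2^-1 ^+ n * expR (c * T) by rewrite !mulr_ge0 ?exprn_ge0 ?expR_ge0.
  apply: le_trans (L2norm_bounded (hy n) h0 _) _.
    move=> t Dt; apply: le_trans (ybound n t Dt) _.
    rewrite ler_wpM2l ?mulr_ge0 ?exprn_ge0// ler_expR ler_wpM2l//.
    by case/andP: Dt.
  by rewrite /B le_eqVlt; apply/orP; left; apply/eqP; ring.
have geo N n : \sum_(N <= i < N + n) 2^-1 ^+ i <= 2 * 2^-1 ^+ N :> R.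
  suff -> : \sum_(N <= i < N + n) 2^-1 ^+ i = 2 * 2^-1 ^+ N - 2 * 2^-1 ^+ (N + n) :> R.
    by rewrite lerBlDr lerDl mulr_ge0// exprn_ge0.
  elim: n => [|n IH]; first by rewrite addn0 big_geq// subrr.
  by rewrite addnS big_nat_recr ?leq_addr//= IH exprS; field.
have sumB N M' : (N <= M')%N -> \sum_(N <= n < M') L2norm T (y n) <= 2 * B * 2^-1 ^+ N.
  move=> NM; apply: (@le_trans _ _ (\sum_(N <= n < M') (B * 2^-1 ^+ n))).
    by apply: ler_sum => n _; exact: yL2.
  rewrite -mulr_sumr -(subnKC NM) (le_trans (ler_wpM2l B0 (geo _ _)))//.
  by rewrite mulrCA mulrA.
have [|H [hH Hlim]] := L2_series_complete (rho := 2 * B) T0 hy.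
  by move=> N; apply: le_trans (sumB _ _ _) _ => //; rewrite expr0 mulr1.
pose S N t := \sum_(0 <= n < N) y n t.
have hS N : L2 T (S N) by apply: L2_sum.
have HS N : L2norm T (fun t => H t - S N t) <= k%:R * (2 * B) * 2^-1 ^+ N.
  rewrite -mulrA; apply: Hlim => M' NM.
  by apply: le_trans (L2norm_sum_le _ hy) _; exact: sumB.
pose x t := x0 + vint f 0 t + vint (fun s => M *m H s) 0 t.
have Hx : H1deriv T x (fun t => f t + M *m H t).
  split; first by apply: L2D => //; exact: L2M.
  move=> t /andP[_ tT]; rewrite /x !vint_at0 !addr0 (vintD tT hf (L2M M hH)).
  by rewrite addrA.
have hx := H1deriv_L2 T0 Hx.
(* The partial sums are the Picard iterates, so [x - S N.+1] is the integral operator applied to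
   [H - S N]. *)
have SS N t : D t -> S N.+1 t = x0 + vint f 0 t + vint (fun s => M *m S N s) 0 t.
  move=> /andP[_ tT]; rewrite {1}/S big_nat_recl//= (vintM M tT (hS N)).
  congr (_ + _); elim: N => [|N IH].
    by rewrite big_geq// (_ : S 0%N = fun=> 0) ?vint0 ?mulmx0//; apply/funext => s; rewrite /S big_geq.
  rewrite big_nat_recr//= IH (vintM M tT (hy N)) -mulmxDr -(vintD tT (hS N) (hy N)).
  by congr (_ *m _); apply: eq_vint => s _; rewrite /S big_nat_recr.
pose Cx := l1 M * (k%:R * Num.sqrt T) * (k%:R * (2 * B)).
have xS N t : D t -> l1 (x t - S N.+1 t) <= Cx * 2^-1 ^+ N.
  move=> /[dup] Dt /andP[_ tT]; rewrite SS// /x opprD addrACA subrr add0r.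
  have hHS : L2 T (fun s => H s - S N s) by exact: L2B.
  have -> : vint (fun s => M *m H s) 0 t - vint (fun s => M *m S N s) 0 t =
      M *m vint (fun s => H s - S N s) 0 t.
    rewrite -(vintM M tT hHS) -scaleN1r -(vintZ (-1) tT (L2M M (hS N))).
    rewrite -(vintD tT (L2M M hH) (L2Z _ (L2M M (hS N)))).
    by apply: eq_vint => s _; rewrite mulmxBr scaleN1r.
  apply: le_trans (l1M _ _) _; rewrite /Cx -!mulrA ler_wpM2l ?l1_ge0//.
  apply: le_trans (l1_vint tT hHS) _.
  apply: (@le_trans _ _ (\int[mu]_(s in D) l1 (H s - S N s))).
    apply: Rintegral_Icc_le => //; [move=> s; exact: l1_ge0|exact: (l1_integrable (lexx T) hHS)].
  apply: le_trans (Rintegral_l1_le T0 hHS) _.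
  rewrite mulrA ler_wpM2l ?mulr_ge0 ?sqrtr_ge0//.
  by apply: le_trans (HS N) _; rewrite !mulrA.
pose E := k%:R * (Num.sqrt T * Cx) + k%:R * (2 * B).
have Cx0 : 0 <= Cx by rewrite /Cx !mulr_ge0 ?l1_ge0 ?sqrtr_ge0.
have xH N : L2norm T (fun t => x t - H t) <= E * 2^-1 ^+ N.
  have h1 : L2 T (fun t => x t - S N.+1 t) by exact: L2B.
  have h2 : L2 T (fun t => S N.+1 t - H t) by exact: L2B.
  have -> : (fun t => x t - H t) = (fun t => (x t - S N.+1 t) + (S N.+1 t - H t)).
    by apply/funext => t; rewrite addrA subrK.
  apply: le_trans (L2norm_triangle h1 h2) _; rewrite /E mulrDl lerD//.
    have h3 : 0 <= Cx * 2^-1 ^+ N by rewrite mulr_ge0// exprn_ge0.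
    by apply: le_trans (L2norm_bounded h1 h3 (xS N)) _; rewrite !mulrA.
  rewrite (L2normC (hS _) hH); apply: le_trans (HS _) _.
  by rewrite ler_wpM2l ?mulr_ge0// exprS ler_piMl ?exprn_ge0// invf_le1// ler1n.
have xH0 : L2norm T (fun t => x t - H t) <= 0.
  apply/ler_addgt0Pl => e e0; rewrite addr0.
  have /cvgrPdist_le/(_ _ e0)[N _ /(_ N (leqnn N))] : E * (2^-1 : R) ^+ n @[n --> \oo] --> 0.
    rewrite -[X in _ --> X](mulr0 E); apply: cvgM; first exact: cvg_cst.
    by apply: cvg_expr; rewrite ger0_norm// invf_lt1// ltr1n.
  by rewrite sub0r normrN => /(le_trans (ler_norm _)); exact: le_trans.
exists x; apply/(is_solP _ _ _ T0 hf); split; first by rewrite /x !vint_at0 !addr0.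
split; first by apply: L2D => //; exact: L2M.
move=> t /[dup] Dt /andP[_ tT]; rewrite {1 2}/x !vint_at0 !addr0 -addrA; congr (_ + _).
rewrite (vintD tT (L2M M hx) hf) [RHS]addrC; congr (_ + _).
have hxH : L2 T (fun s => x s - H s) by exact: L2B.
apply/eqP; rewrite -subr_eq0; apply/eqP/l1_eq0.
have -> : vint (fun s => M *m H s) 0 t - vint (fun s => M *m x s) 0 t =
    (- 1) *: (M *m vint (fun s => x s - H s) 0 t).
  rewrite -(vintM M tT hxH) -(vintZ (-1) tT (L2M M hxH)) -scaleN1r -(vintZ (-1) tT (L2M M hx)).
  rewrite -(vintD tT (L2M M hH) (L2Z _ (L2M M hx))).
  by apply: eq_vint => s _; rewrite mulmxBr !scaleN1r opprB.
rewrite scalemxAl; apply: le_trans (l1M _ _) _.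
apply: (@le_trans _ _ (l1 (-1 *: M) * ((k%:R * Num.sqrt T) * L2norm T (fun s => x s - H s)))).
  rewrite ler_wpM2l ?l1_ge0//; apply: le_trans (l1_vint tT hxH) _.
  apply: le_trans (Rintegral_l1_le T0 hxH).
  by apply: Rintegral_Icc_le => //; [move=> s; exact: l1_ge0|exact: (l1_integrable (lexx T) hxH)].
rewrite mulrA -[leRHS](mulr0 (l1 (-1 *: M) * (k%:R * Num.sqrt T))).
by rewrite ler_wpM2l// !mulr_ge0 ?l1_ge0 ?sqrtr_ge0.
Qed.

Lemma odesol_is_sol k (M : 'M[R]_k) x0 f : L2 T f -> is_sol T M x0 f (odesol T M x0 f).
Proof.
move=> hf; have [x /(is_solP _ _ _ T0 hf)[x00 Hx]] := is_sol_exists M x0 hf.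
(* [odesol] selects among solutions that vanish outside [[0, T]], so the witness is extended by
   zero. *)
pose xt t := if t \in D then x t else 0.
have xtE t : D t -> x t = xt t by move=> Dt; rewrite /xt mem_set.
have /(@ClassicalEpsilon.epsilon_spec _ (inhabits (fun _ => 0)))[] : exists z,
    is_sol T M x0 f z /\ forall t, ~ D t -> z t = 0; last by [].
exists xt; split; last by move=> t nDt; rewrite /xt ifF//; apply/negP => /set_mem.
apply/(is_solP _ _ _ T0 hf); split; first by rewrite -xtE// /Icc/= lexx.
by apply: eq_H1deriv Hx => // t Dt; rewrite -xtE.
Qed.

End LinearODE.

(** * Superposition of solutions and the fundamental matrix *)

Section SolutionAlgebra.
Context {R : realType}.
Variable T : R.
Hypothesis T0 : 0 <= T.
Local Notation mu := (@lebesgue_measure R).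
Local Notation D := (Icc 0 T).

Lemma is_solD k (M : 'M[R]_k) x0 f x y0 g y : L2 T f -> L2 T g ->
  is_sol T M x0 f x -> is_sol T M y0 g y ->
  is_sol T M (x0 + y0) (fun t => f t + g t) (fun t => x t + y t).
Proof.
move=> hf hg /(is_solP _ _ _ T0 hf)[<- Hx] /(is_solP _ _ _ T0 hg)[<- Hy].
apply/(is_solP _ _ _ T0 (L2D hf hg)); split=> //.
by apply: eq_H1deriv (H1derivD Hx Hy) => // t _; rewrite mulmxDr addrACA.
Qed.

Lemma is_solZ k (M : 'M[R]_k) a x0 f x : L2 T f -> is_sol T M x0 f x ->
  is_sol T M (a *: x0) (fun t => a *: f t) (fun t => a *: x t).
Proof.
move=> hf /(is_solP _ _ _ T0 hf)[<- Hx].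
apply/(is_solP _ _ _ T0 (L2Z a hf)); split=> //.
by apply: eq_H1deriv (H1derivZ a Hx) => // t _; rewrite scalerDr scalemxAr.
Qed.

Lemma is_sol0 k (M : 'M[R]_k) : is_sol T M 0 (fun=> 0) (fun=> 0).
Proof.
have h0 : L2 T (fun=> 0 : 'cV[R]_k) by exact: L2_0.
apply/(is_solP _ _ _ T0 h0); split=> //.
by apply: eq_H1deriv (H1deriv0 T k) => // t _; rewrite mulmx0 addr0.
Qed.

Lemma is_sol_sum k (M : 'M[R]_k) (I : Type) (r : seq I) x0 f x :
  (forall i, L2 T (f i)) -> (forall i, is_sol T M (x0 i) (f i) (x i)) ->
  is_sol T M (\sum_(i <- r) x0 i) (fun t => \sum_(i <- r) f i t) (fun t => \sum_(i <- r) x i t).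
Proof.
move=> hf hx; elim: r => [|i r IH].
  have := is_sol0 M; rewrite big_nil.
  by congr is_sol; apply/funext => t; rewrite big_nil.
have := is_solD (hf i) (L2_sum r (P := xpredT) (fun i _ => hf i)) (hx i) IH.
by rewrite big_cons; congr is_sol; apply/funext => t; rewrite big_cons.
Qed.

(** Needed because the multilinearity of the [F p] holds only almost everywhere, so forcing terms
    are known up to null sets. *)
Lemma eq_is_sol k (M : 'M[R]_k) x0 f g x y : L2 T f -> L2 T g ->
  (forall t, D t -> x t = y t) -> ae_eq mu D f g ->
  is_sol T M x0 f x -> is_sol T M x0 g y.
Proof.
move=> hf hg xy fg /(is_solP _ _ _ T0 hf)[x00 Hx].
have h0 : D 0 by rewrite /Icc/= lexx.
apply/(is_solP _ _ _ T0 hg); split; first by rewrite -xy.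
have x2 := H1deriv_L2 T0 Hx.
have y2 : L2 T y by exact: eq_L2 xy x2.
split; first by apply: L2D => //; exact: L2M.
move=> t /[dup] Dt /andP[_ tT]; rewrite -xy// -(xy 0)//; case: Hx => _ ->//.
rewrite (vintD tT (L2M M x2) hf) (vintD tT (L2M M y2) hg).
rewrite (ae_eq_vint tT hf hg fg); congr (_ + (_ + _)).
by apply: eq_vint => s /andP[s0 st]; rewrite xy// /Icc/= s0 (le_trans st).
Qed.

(** The fundamental matrix normalised to the identity at time 0; it makes the dependence on the
    initial value a matrix product. *)
Definition resolvent k (M : 'M[R]_k) (t : R) : 'M[R]_k :=
  \matrix_(i, j) odesol T M (delta_mx j 0) (fun=> 0) t i 0.

Lemma odesol_hom k (M : 'M[R]_k) z t : D t ->
  odesol T M z (fun=> 0) t = resolvent M t *m z.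
Proof.
move=> Dt; have h0 : L2 T (fun=> 0 : 'cV[R]_k) by exact: L2_0.
have hs j := is_solZ (z j 0) h0 (odesol_is_sol T0 M (delta_mx j 0) h0).
have := is_sol_sum (index_enum 'I_k) (fun j => L2Z (z j 0) h0) hs.
have -> : \sum_(j <- index_enum 'I_k) z j 0 *: delta_mx j 0 = z.
  by rewrite [RHS]matrix_sum_delta; apply: eq_bigr => j _; rewrite big_ord1.
have -> : (fun t : R => \sum_(i <- index_enum 'I_k) z i 0 *: (0 : 'cV[R]_k)) = fun=> 0.
  by apply/funext => s; rewrite big1// => j _; rewrite scaler0.
move=> /(is_sol_unique T0 h0 (odesol_is_sol T0 M z h0))/(_ t Dt) ->.
apply/matrixP => i j; rewrite (ord1 j) summxE mxE.
by apply: eq_bigr => l _; rewrite !mxE mulrC.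
Qed.

End SolutionAlgebra.

(** * Kalman condition, Gramian and minimizing controls *)

Section Controllability.
Context {R : realType}.
Variable T : R.
Hypothesis T_gt0 : 0 < T.
Local Notation mu := (@lebesgue_measure R).
Local Notation D := (Icc 0 T).
Let T0 : 0 <= T := ltW T_gt0.

(** Inside the interval [g] is the derivative of its zero primitive; the value at 0 follows by right
    continuity, and this is the point where observability is finally read. *)
Lemma primitive_eq0 (g : R -> R) : {within D, continuous g} ->
  (forall t, 0 <= t < T -> \int[mu]_(s in Icc 0 t) g s = 0) ->
  forall t, 0 <= t < T -> g t = 0.
Proof.
move=> cg g0.
have ig : mu.-integrable `[0, T] (EFin \o g).
  rewrite set_itvcc; have [M _ gM] := continuous_Icc_bounded cg.
  have := bounded_sqint (continuous_Icc_measurable cg) gM => g2.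
  have := sqint_mul_integrable (measurable_Icc 0 T) g2 (sqint_cst T 1).
  by apply: eq_integrable => // t _; rewrite mulr1.
have cg' := cg; rewrite /Icc -set_itvcc in cg'.
have /(continuous_within_itvP _ T_gt0)[cin c0 _] := cg'.
have gin t : 0 < t -> t < T -> g t = 0.
  move=> t0 tT; have tin : t \in `]0, T[ by rewrite in_itv/= t0.
  have [_ <-] := continuous_FTC1_closed tT ig t0 (cin t tin).
  rewrite derive1E (@near_eq_derive _ _ _ _ (cst 0)) ?derive_cst//.
  near=> s; rewrite set_itvcc; apply: g0.
  have : s \in `]0, T[ by near: s; exact: near_in_itvoo.
  by rewrite in_itv/= => /andP[/ltW -> ->].
move=> t /andP[]; rewrite le_eqVlt => /predU1P[<- _|]; last exact: gin.
have g00 : g @ 0^'+ --> (0 : R).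
  apply: cvg_near_cst; near=> s; apply: gin.
    by near: s; exact: nbhs_right_gt.
  by near: s; exact: nbhs_right_lt.
exact: (cvg_unique _ c0 g00).
Unshelve. all: by end_near. Qed.

Lemma H1deriv_vint_eq0 k (x g : R -> 'cV[R]_k) : H1deriv T x g ->
  (forall t, 0 <= t < T -> vint x 0 t = 0) -> forall t, 0 <= t < T -> x t = 0.
Proof.
move=> Hx x0 t tT; apply/matrixP => i j; rewrite (ord1 j) mxE.
have /within_continuous_coordP cx := H1deriv_continuous T0 Hx.
apply: (primitive_eq0 (cx i)) => // s sT.
by have /matrixP/(_ i 0) := x0 s sT; rewrite !mxE.
Qed.

Variables (n m : nat) (A : 'M[R]_n) (B : 'M[R]_(n, m)).
Local Notation adj := (adj T A).

Let h0 : L2 T (fun=> 0 : 'cV[R]_n). Proof. exact: L2_0. Qed.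

Lemma adj_is_sol z : is_sol T (- A^T) z (fun=> 0) (adj z).
Proof. exact: odesol_is_sol. Qed.

Lemma adj0 z : adj z 0 = z.
Proof. by have /(is_solP _ _ _ T0 h0)[] := adj_is_sol z. Qed.

Lemma adj_H1 z : H1deriv T (adj z) (fun t => - A^T *m adj z t).
Proof.
have /(is_solP _ _ _ T0 h0)[_] := adj_is_sol z.
by apply: eq_H1deriv => // t _; rewrite addr0.
Qed.

Lemma adj_L2 z : L2 T (adj z).
Proof. exact: H1deriv_L2 (adj_H1 z). Qed.

Lemma adjE z t : D t -> adj z t = resolvent T (- A^T) t *m z.
Proof. exact: odesol_hom. Qed.

Lemma adj_lin a z w t : D t -> adj (z + a *: w) t = adj z t + a *: adj w t.
Proof. by move=> Dt; rewrite !adjE// mulmxDr scalemxAr. Qed.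

Lemma inner_mulmxl p q (M : 'M[R]_(p, q)) x y : inner (M *m x) y = inner x (M^T *m y).
Proof.
rewrite /inner; under eq_bigr do rewrite mxE mulr_suml.
rewrite exchange_big; apply: eq_bigr => j _ /=; rewrite mxE mulr_sumr.
by apply: eq_bigr => i _; rewrite mxE [RHS]mulrCA mulrA.
Qed.

Lemma vip_mulmxl p q (M : 'M[R]_(p, q)) x y : L2 T x -> L2 T y ->
  vip T (fun t => M *m x t) y = vip T x (fun t => M^T *m y t).
Proof.
move=> hx hy; rewrite (vip_inner (L2M M hx) hy) (vip_inner hx (L2M M^T hy)).
by apply: eq_Rintegral => t _; rewrite inner_mulmxl.
Qed.

(** Integration by parts, in which the [A] of the state equation cancels the [- A^T] of the adjoint
    one. *)
Lemma adjoint_duality x0 f x z : L2 T f -> is_sol T A x0 f x ->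
  inner (x T) (adj z T) = inner x0 z + vip T f (adj z).
Proof.
move=> hf /(is_solP _ _ _ T0 hf)[x00 Hx].
have x2 := H1deriv_L2 T0 Hx; have y2 := adj_L2 z.
have := H1_duality T0 Hx (adj_H1 z); rewrite adj0 x00.
rewrite ![vip _ (fun t => _ + _) _]vipC (vipD y2 (L2M A x2) hf) vipC (vip_mulmxl A x2 y2).
have -> : vip T x (fun t => - A^T *m adj z t) = - vip T x (fun t => A^T *m adj z t).
  transitivity (vip T x (fun t => -1 *: (A^T *m adj z t))).
    by congr vip; apply/funext => t; rewrite mulNmx scaleN1r.
  by rewrite (vipZ _ x2 (L2M A^T y2)) mulN1r.
by rewrite (vipC T f) addrAC subrr add0r => <-; rewrite addrC subrK.
Qed.

Lemma innerDl k (x y z : 'cV[R]_k) : inner (x + y) z = inner x z + inner y z.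
Proof. by rewrite /inner -big_split; apply: eq_bigr => i _; rewrite mxE mulrDl. Qed.

Lemma innerC k (x y : 'cV[R]_k) : inner x y = inner y x.
Proof. by apply: eq_bigr => i _; rewrite mulrC. Qed.

Lemma innerZr k a (x y : 'cV[R]_k) : inner x (a *: y) = a * inner x y.
Proof. by rewrite /inner mulr_sumr; apply: eq_bigr => i _; rewrite mxE mulrCA. Qed.

Lemma inner_eq0 k (x : 'cV[R]_k) : inner x x = 0 -> x = 0.
Proof.
move=> xx; apply/matrixP => i j; rewrite (ord1 j) mxE; apply/eqP.
by rewrite -normr_le0 (le_trans (coord_le_vnorm x i))// /vnorm xx sqrtr0.
Qed.

Lemma inner_delta k (x : 'cV[R]_k) i : inner x (delta_mx i 0) = x i 0.
Proof.
rewrite /inner (bigD1 i)//= big1 => [|j ji]; first by rewrite !mxE !eqxx mulr1 addr0.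
by rewrite mxE (negbTE ji) mulr0.
Qed.

(** By duality with [f = 0], the pairing of a free trajectory with an adjoint one is the same at 0
    and at [T]. Hence the transposed fundamental matrix of [A] is a left inverse of the adjoint one,
    and a two-sided one as both are square. *)
Lemma adj_final_surj w : exists z, adj z T = w.
Proof.
have DT : D T by rewrite /Icc/= lexx T0.
pose P := resolvent T (- A^T) T; pose Q := resolvent T A T.
have PQ : Q^T *m P = 1%:M.
  apply/matrixP => i j.
  have := adjoint_duality (delta_mx j 0) h0 (odesol_is_sol T0 A (delta_mx i 0) h0).
  rewrite /vip big1 => [|l _]; last first.
    by rewrite /Rintegral integral0_eq// => t _; rewrite mxE mul0r.
  rewrite addr0 adjE// odesol_hom// inner_mulmxl mulmxA innerC inner_delta.
  have -> : (Q^T *m P *m (delta_mx j 0 : 'cV[R]_n)) i 0 = (Q^T *m P) i j.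
    by rewrite -colE mxE.
  by move=> ->; rewrite inner_delta !mxE eqxx andbT eq_sym.
exists (Q^T *m w); rewrite adjE// mulmxA.
by rewrite (mulmx1C PQ) mul1mx.
Qed.

(** [vfam b] is by conversion [obs (y0 b)]. *)
Definition obs z : R -> 'cV[R]_m := fun t => B^T *m adj z t.

Lemma obs_L2 z : L2 T (obs z).
Proof. exact/L2M/adj_L2. Qed.

Lemma vip_adj_lin f a z w : L2 T f ->
  vip T f (adj (z + a *: w)) = vip T f (adj z) + a * vip T f (adj w).
Proof.
move=> hf; rewrite -(vipZ _ hf (adj_L2 w)) -(vipD hf (adj_L2 z) (L2Z a (adj_L2 w))).
apply: eq_bigr => i _; apply: eq_Rintegral => t /set_mem Dt.
by rewrite adj_lin.
Qed.

Lemma vip_obs_adj f z : L2 T f -> vip T f (obs z) = vip T (fun t => B *m f t) (adj z).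
Proof. by move=> hf; rewrite (vip_mulmxl B hf (adj_L2 z)). Qed.

(** At [s = - b / (|c| + 1)] the expression has the sign of [c - |c| - 1], which is negative, unless
    [b = 0]. *)
Lemma linear_plus_quadratic_eq0 (b c : R) : (forall s, 0 <= s * b + s ^+ 2 * c) -> b = 0.
Proof.
move=> H; apply/eqP; apply: contraT => b0.
have c1 : 0 < `|c| + 1 by rewrite ltr_wpDl.
have b2 : 0 < b ^+ 2 by rewrite exprn_even_gt0.
have := H (- b / (`|c| + 1)).
have -> : - b / (`|c| + 1) * b + (- b / (`|c| + 1)) ^+ 2 * c =
    b ^+ 2 * (c - (`|c| + 1)) / (`|c| + 1) ^+ 2 by field; rewrite gt_eqF.
rewrite pmulr_lge0 ?invr_gt0 ?exprn_gt0// pmulr_rge0// subr_ge0 => h.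
by have := le_trans h (ler_norm c); rewrite gerDl ler10.
Qed.

(** Comparing [y] with [y + s *: w] leaves [s] times the first variation plus a multiple of
    [s ^+ 2]. Keeping both [x0] and [f] covers the two shapes of [J] at once. *)
Lemma minimizer_euler_lagrange y (f : R -> 'cV[R]_n) x0 : L2 T f ->
  (forall z, 2^-1 * vip T (obs y) (obs y) + (inner x0 y + vip T f (adj y)) <=
             2^-1 * vip T (obs z) (obs z) + (inner x0 z + vip T f (adj z))) ->
  forall w, vip T (obs y) (obs w) + (inner x0 w + vip T f (adj w)) = 0.
Proof.
move=> hf hmin w; apply: (@linear_plus_quadratic_eq0 _ (2^-1 * vip T (obs w) (obs w))) => s.
have := hmin (y + s *: w); rewrite vip_adj_lin// (innerC x0 (y + _)) innerDl.
rewrite !(innerC _ x0) innerZr.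
have lin u : L2 T u -> vip T u (obs (y + s *: w)) = vip T u (obs y) + s * vip T u (obs w).
  by move=> hu; rewrite !vip_obs_adj// vip_adj_lin//; exact: L2M.
rewrite (lin _ (obs_L2 _)) (vipC T (obs (y + _)) (obs y)).
rewrite (vipC T (obs (y + _)) (obs w)) !lin; [|exact: obs_L2..].
rewrite (vipC T (obs w) (obs y)).
set a := vip T (obs y) (obs y); set b := vip T (obs y) (obs w); set c := vip T (obs w) (obs w).
set i1 := inner x0 y; set i2 := inner x0 w; set v1 := vip T f (adj y); set v2 := vip T f (adj w).
by rewrite -subr_ge0; congr (0 <= _); field.
Qed.

(** Choosing the adjoint trajectory whose final value is [x T], duality turns [inner (x T) (x T)]
    into the Euler-Lagrange expression, which is zero. *)
Lemma optimal_control_steers y f x0 x : L2 T f ->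
  (forall w, vip T (obs y) (obs w) + (inner x0 w + vip T f (adj w)) = 0) ->
  is_sol T A x0 (fun t => B *m obs y t + f t) x -> x T = 0.
Proof.
move=> hf EL hx; have hB := L2M B (obs_L2 y).
have hBf := L2D hB hf.
have [z zT] := adj_final_surj (x T).
have := adjoint_duality z hBf hx; rewrite zT vipC (vipD (adj_L2 z) hB hf).
rewrite (vipC T (adj z) (fun t => B *m obs y t)) -(vip_obs_adj z (obs_L2 y)).
rewrite (vipC T (adj z) f) addrCA EL.
exact: inner_eq0.
Qed.

Lemma L2norm_eq0_vint k (f : R -> 'cV[R]_k) t : L2 T f -> L2norm T f = 0 -> t <= T ->
  vint f 0 t = 0.
Proof.
move=> hf f0 tT; apply: l1_eq0; apply: le_trans (l1_vint tT hf) _.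
have := Rintegral_l1_le T0 hf; rewrite f0 mulr0; apply: le_trans.
by apply: Rintegral_Icc_le => //; [move=> s; exact: l1_ge0|exact: (l1_integrable (lexx T) hf)].
Qed.

(** Successive differentiation of [B^T y = 0], in integral form: if [(A^k B)^T y] vanishes, so does
    the primitive of its derivative, hence the derivative itself, which is [- (A^(k+1) B)^T y]. *)
Lemma unobservable_derivatives z : L2norm T (obs z) = 0 ->
  forall k t, 0 <= t < T -> (A ^+ k *m B)^T *m adj z t = 0.
Proof.
move=> oz; have obs0 : forall t, 0 <= t < T -> obs z t = 0.
  apply: (H1deriv_vint_eq0 (H1derivM B^T (adj_H1 z))) => t /andP[_ tT].
  by apply: L2norm_eq0_vint; [exact: obs_L2|by []|exact: ltW].
elim=> [|k IH] t tT; first by rewrite expr0 mul1mx; exact: obs0.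
have tr : (A ^+ k.+1 *m B)^T = (A ^+ k *m B)^T *m A^T.
  by rewrite exprS -[A * _]/(A *m _) -mulmxA trmx_mul.
have Hk := H1derivM (A ^+ k *m B)^T (adj_H1 z).
suff : forall t, 0 <= t < T -> (A ^+ k *m B)^T *m (- A^T *m adj z t) = 0.
  by move=> /(_ t tT) /eqP; rewrite mulNmx mulmxN oppr_eq0 mulmxA -tr => /eqP.
have Hk' : H1deriv T (fun t => (A ^+ k *m B)^T *m (- A^T *m adj z t))
    (fun t => (A ^+ k *m B)^T *m (- A^T *m (- A^T *m adj z t))).
  by apply: H1derivM; apply: H1derivM; exact: adj_H1.
apply: (H1deriv_vint_eq0 Hk') => s sT; case: Hk => _ /(_ s).
rewrite IH// IH ?lexx//.
  by rewrite add0r => ->//; case/andP: sT => -> /ltW.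
Qed.

Hypothesis kalman_rank : \rank (kalman A B) = n.

(** At time 0 the relations above say that [z^T] annihilates every block of the Kalman matrix, whose
    rows are independent. *)
Lemma kalman_observable z : L2norm T (obs z) = 0 -> z = 0.
Proof.
move=> oz; have hk := unobservable_derivatives oz.
have zk : z^T *m kalman A B = 0.
  rewrite /kalman mul_mxrow -(mxrow0 (V := R)); apply: eq_mxrow => k.
  have := hk k 0; rewrite lexx T_gt0 adj0 => /(_ isT) /(congr1 trmx).
  by rewrite trmx_mul trmxK trmx0.
have rf : row_free (kalman A B) by rewrite /row_free kalman_rank.
have := mulmx_free_eq0 z^T rf; rewrite zk eqxx => /esym/eqP/(congr1 trmx).
by rewrite trmxK trmx0.
Qed.

Definition gramian : 'M[R]_n :=
  \matrix_(i, j) vip T (obs (delta_mx i 0)) (obs (delta_mx j 0)).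

Lemma vip_obs_sum f z : L2 T f -> vip T f (obs z) = \sum_j z j 0 * vip T f (obs (delta_mx j 0)).
Proof.
move=> hf; under eq_bigr => j _ do rewrite -(vipZ _ hf (obs_L2 _)).
rewrite -(vip_sum _ hf); last by move=> j; apply: L2Z; exact: obs_L2.
apply: eq_bigr => i _; apply: eq_Rintegral => t /set_mem Dt; congr (_ * _).
have -> : obs z t = \sum_j z j 0 *: obs (delta_mx j 0) t; last by [].
rewrite /obs adjE// {1}[z]matrix_sum_delta mulmxA mulmx_sumr; apply: eq_bigr => j _.
by rewrite big_ord1 -scalemxAr -mulmxA adjE.
Qed.

Lemma gramianE z i : (gramian *m z) i 0 = vip T (obs (delta_mx i 0)) (obs z).
Proof.
rewrite mxE vip_obs_sum; last exact: obs_L2.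
by apply: eq_bigr => j _; rewrite mxE mulrC.
Qed.

Lemma gramian_unit : gramian \in unitmx.
Proof.
rewrite -unitmx_tr -row_free_unit -kermx_eq0; apply/rowV0P => v /sub_kermxP vk.
have gz : gramian *m v^T = 0 by rewrite -[gramian]trmxK -trmx_mul vk trmx0.
have z0 : vip T (obs v^T) (obs v^T) = 0.
  rewrite vip_obs_sum; last exact: obs_L2.
  by rewrite big1// => j _; rewrite vipC -gramianE gz [X in _ * X]mxE mulr0.
have : v^T = 0 by apply: kalman_observable; rewrite L2normE z0 sqrtr0.
by move=> /(congr1 trmx); rewrite trmxK trmx0.
Qed.

(** Tested on the basis vectors, the Euler-Lagrange equation without initial term is the linear
    system [gramian *m y = - h], where [h] collects the products of [f] with the adjoint basis;
    inverting it bounds [y] by the norm of [f]. *)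
Lemma control_bound : exists2 K : R, 0 <= K & forall y f, L2 T f ->
  (forall w, vip T (obs y) (obs w) + vip T f (adj w) = 0) ->
  L2norm T (obs y) <= K * L2norm T f.
Proof.
pose a j := L2norm T (adj (delta_mx j 0)); pose o j := L2norm T (obs (delta_mx j 0)).
pose K1 := l1 (invmx gramian) * \sum_j a j.
exists (K1 * \sum_j o j).
  by rewrite /K1 !mulr_ge0 ?l1_ge0// sumr_ge0// => j _; exact: L2norm_ge0.
move=> y f hf EL.
pose h : 'cV[R]_n := \col_j vip T f (adj (delta_mx j 0)).
have yh : y = - (invmx gramian *m h).
  rewrite -mulmxN; have -> : - h = gramian *m y.
    apply/matrixP => i j; rewrite (ord1 j) gramianE !mxE (vipC T (obs (delta_mx i 0))); apply/eqP.
    by rewrite eq_sym -addr_eq0 EL.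
  by rewrite mulKmx// gramian_unit.
have y1 : l1 y <= K1 * L2norm T f.
  have -> : l1 y = l1 (invmx gramian *m h).
    by rewrite yh /l1; apply: eq_bigr => i _; apply: eq_bigr => j _; rewrite mxE normrN.
  apply: le_trans (l1M _ _) _; rewrite /K1 -mulrA ler_wpM2l ?l1_ge0// l1_cV mulr_suml.
  apply: ler_sum => j _; rewrite mxE mulrC.
  exact: L2_cauchy_schwarz hf (adj_L2 _).
have yo : L2norm T (obs y) <= \sum_j `|y j 0| * o j.
  have -> : L2norm T (obs y) = L2norm T (fun t => \sum_j y j 0 *: obs (delta_mx j 0) t).
    apply: eq_L2norm => t Dt; rewrite /obs adjE// {1}[y]matrix_sum_delta mulmxA mulmx_sumr.
    by apply: eq_bigr => j _; rewrite big_ord1 -scalemxAr -mulmxA adjE.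
  apply: le_trans (L2norm_sum_le _ _) _; first by move=> j; apply: L2Z; exact: obs_L2.
  by apply: ler_sum => j _; rewrite L2normZ//; exact: obs_L2.
apply: le_trans yo _; rewrite mulrAC mulr_sumr; apply: ler_sum => j _.
by rewrite ler_wpM2r ?L2norm_ge0// (le_trans (le_l1 y j 0)).
Qed.

End Controllability.

(** * Expansion of products of sums *)

Section ListProducts.

(** The index set for expanding a product of sums, or a multilinear map whose arguments are sums. *)
Fixpoint prodseq (Q : Type) (LL : seq (seq Q)) : seq (seq Q) :=
  if LL is L :: LL' then [seq q :: ps | q <- L, ps <- prodseq LL'] else [:: [::]].

Lemma mem_prodseq (Q : eqType) (LL : seq (seq Q)) ps :
  (ps \in prodseq LL) = all2 (fun q (L : seq Q) => q \in L) ps LL.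
Proof.
elim: LL ps => [|L LL IH] [|q ps] //=.
  by apply/negbTE/negP => /allpairsP[[a b] [_ _]].
rewrite -IH; apply/allpairsP/andP => [[[a b] /= [aL bLL [-> ->]]]|[qL psLL]]; first by [].
by exists (q, ps).
Qed.

Lemma uniq_prodseq (Q : eqType) (LL : seq (seq Q)) : all uniq LL -> uniq (prodseq LL).
Proof.
elim: LL => //= L LL IH /andP[uL uLL]; apply: allpairs_uniq => //; first exact: IH.
by move=> [a b] [c d] _ _ /= [-> ->].
Qed.

Lemma big_prodseq_cons (V : nmodType) (Q : Type) (L : seq Q) LL (f : seq Q -> V) :
  \sum_(ps <- prodseq (L :: LL)) f ps = \sum_(q <- L) \sum_(ps <- prodseq LL) f (q :: ps).
Proof. by rewrite /= big_allpairs_dep. Qed.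

Lemma prod_sum_prodseq (V : comPzRingType) (Q : Type) (LL : seq (seq Q)) (w : Q -> V) :
  \prod_(L <- LL) \sum_(q <- L) w q = \sum_(ps <- prodseq LL) \prod_(q <- ps) w q.
Proof.
elim: LL => [|L LL IH]; first by rewrite big_nil big_seq1 big_nil.
rewrite big_prodseq_cons big_cons IH mulr_suml; apply: eq_bigr => q _.
by rewrite mulr_sumr; apply: eq_bigr => ps _; rewrite big_cons.
Qed.

End ListProducts.

(** * Combinatorics of grafting *)

Section Trees.

(** Structural, so that the inner fixpoint of [tree_nested_ind] can build it while walking through
    the children. *)
Fixpoint all_prop (Q : Type) (P : Q -> Prop) (s : seq Q) : Prop :=
  if s is x :: s' then P x /\ all_prop P s' else True.

Lemma all_prop_mem (Q : eqType) (P : Q -> Prop) s x : all_prop P s -> x \in s -> P x.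
Proof. by elim: s => //= y s IH [Py /IH h]; rewrite inE => /orP[/eqP ->|]. Qed.

(** The generated induction principle gives no hypothesis on the children stored in the list. *)
Lemma tree_nested_ind (P : tree -> Prop) : P Leaf ->
  (forall a b l, (forall c, c \in [:: a, b & l] -> P c) -> P (Node a b l)) -> forall t, P t.
Proof.
move=> PL PN; fix IH 1; case=> [//|a b l]; apply: PN => c; apply: all_prop_mem.
split; first exact: IH.
split; first exact: IH.
exact: (fix go (l0 : seq tree) : all_prop P l0 :=
  match l0 return all_prop P l0 with
  | [::] => I
  | c :: l1 => conj (IH c) (go l1) end).
Qed.

(** B_+ on a list of subtrees; lists with fewer than two elements get a default value, excluded
    wherever [1 < size s] is assumed. *)
Definition node_of (s : seq tree) : tree :=
  if s is [:: a, b & l] then Node a b l else Leaf.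

Lemma children_node_of s : (1 < size s)%N -> children (node_of s) = s.
Proof. by case: s => [|a [|b l]]. Qed.

Lemma node_of_children a b l : node_of (children (Node a b l)) = Node a b l.
Proof. by []. Qed.

Lemma leaves_node_of s : (1 < size s)%N -> leaves (node_of s) = sumn (map leaves s).
Proof. by case: s => [|a [|b l]] //= _; rewrite addnA. Qed.

Lemma internal_node_of s : (1 < size s)%N -> internal (node_of s) = (sumn (map internal s)).+1.
Proof. by case: s => [|a [|b l]] //= _; rewrite -!addnA add1n. Qed.

(** The nested recursion consumes [E] in blocks of lengths the leaf counts; these are the rows of a
    [reshape], for which list lemmas exist. *)
Lemma graft_node_of s E : (1 < size s)%N ->
  graft (node_of s) E =
  node_of [seq graft p.1 p.2 | p <- zip s (reshape (map leaves s) E)].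
Proof.
case: s => [|a [|b l]] //= _; congr Node.
by move: (drop (leaves b) _) => {}E; elim: l E => //= c l IH E; rewrite IH.
Qed.

(** Enumerates [decomps t]: either nothing is cut off and [t] itself is grafted on a leaf, or [c]
    shares its root with [t] and the children are decomposed independently. *)
Fixpoint decs (t : tree) : seq (tree * seq tree) :=
  (Leaf, [:: t]) ::
  match t with
  | Leaf => [::]
  | Node a b l => [seq (node_of (unzip1 ps), flatten (unzip2 ps)) |
                   ps <- prodseq (decs a :: decs b :: map decs l)]
  end.

Lemma decs_node a b l : decs (Node a b l) = (Leaf, [:: Node a b l]) ::
  [seq (node_of (unzip1 ps), flatten (unzip2 ps)) | ps <- prodseq (map decs [:: a, b & l])].
Proof. by []. Qed.

Lemma all2_size (S U : Type) (r : S -> U -> bool) s u : all2 r s u -> size s = size u.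
Proof. by elim: s u => [|x s IH] [|y u] //= /andP[_ /IH ->]. Qed.

Definition is_dec (t : tree) (p : tree * seq tree) :=
  (size p.2 == leaves p.1) && (graft p.1 p.2 == t).

Lemma prodseq_decs (cs : seq tree) (ps : seq (tree * seq tree)) :
  (forall c, c \in cs -> forall p, (p \in decs c) = is_dec c p) ->
  (ps \in prodseq (map decs cs)) = all2 (fun p c => is_dec c p) ps cs.
Proof.
rewrite mem_prodseq; elim: cs ps => [|c cs IH] [|p ps] //= H.
rewrite H ?mem_head// IH// => d dcs; apply: H.
by rewrite inE dcs orbT.
Qed.

Lemma all2_is_dec_shape ps cs : all2 (fun p c => is_dec c p) ps cs ->
  shape (unzip2 ps) = map leaves (unzip1 ps) /\ [seq graft p.1 p.2 | p <- ps] = cs.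
Proof.
elim: ps cs => [|p ps IH] [|c cs] //= /andP[/andP[/eqP -> /eqP ->]] /IH[].
by rewrite /shape /= => -> ->.
Qed.

(** When [c] is not a leaf, its children are as many as those of [t], and the blocks of [E] that
    they receive decompose the children of [t] one by one. *)
Lemma mem_decs t p : (p \in decs t) = is_dec t p.
Proof.
elim/tree_nested_ind: t p => [|a b l IH] [c E].
  rewrite /= inE; case: c => [|a b l]; rewrite /is_dec /=.
    apply/eqP/andP => [[->] //|].
    by case: E => [|e [|? ?]] [] //= _ /eqP ->.
  by rewrite andbF; apply/negbTE; apply/negP => /eqP.
rewrite decs_node inE.
apply/orP/idP => [[/eqP[-> ->]|/mapP[ps]]|].
- by rewrite /is_dec /= !eqxx.
- rewrite (prodseq_decs _ IH) => h; have := all2_size h => sz [-> ->].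
  have [sh gr] := all2_is_dec_shape h.
  have s1 : (1 < size (unzip1 ps))%N by rewrite size_map sz.
  rewrite /is_dec /= leaves_node_of// -sh -size_flatten eqxx /=.
  by rewrite graft_node_of// -sh flattenK zip_unzip gr.
- rewrite /is_dec /=; case: c => [|a' b' l'].
    case: E => [|e [|e' E]] //= /eqP ->; left; by [].
  rewrite -[Node a' b' l']/(node_of [:: a', b' & l']); set ts := [:: a', b' & l'].
  rewrite leaves_node_of// graft_node_of// => /andP[/eqP szE /eqP gE]; right.
  (* Each child of [c] is paired with its block of [E]. *)
  set ps := zip ts (reshape (map leaves ts) E) in gE.
  have szr : size (reshape (map leaves ts) E) = size ts by rewrite size_reshape size_map.
  have u1 : unzip1 ps = ts by rewrite unzip1_zip// szr.
  have u2 : unzip2 ps = reshape (map leaves ts) E by rewrite unzip2_zip// szr.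
  have szps : size ps = size ts by rewrite size_zip szr minnn.
  have gcs : [seq graft p.1 p.2 | p <- ps] = [:: a, b & l].
    by rewrite -[LHS]children_node_of ?gE// size_map szps.
  apply/mapP; exists ps; last by rewrite u1 u2 reshapeKr// szE.
  rewrite (prodseq_decs _ IH) -gcs.
  have : shape (unzip2 ps) = map leaves (unzip1 ps) by rewrite u1 u2 reshapeKl// szE.
  elim: (ps) => //= p qs IHq [sp sq]; rewrite {1}/is_dec sp !eqxx /=.
  exact: IHq.
Qed.

(** The choice at each child can be recovered from the assembled pair: the children give the trees,
    and their leaf counts give the cuts of the flattened list. *)
Lemma uniq_decs t : uniq (decs t).
Proof.
elim/tree_nested_ind: t => [//|a b l IH].
rewrite decs_node cons_uniq.
have szps ps : ps \in prodseq (map decs [:: a, b & l]) -> (1 < size (unzip1 ps))%N.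
  by rewrite mem_prodseq size_map => /all2_size ->; rewrite size_map.
have shps ps : ps \in prodseq (map decs [:: a, b & l]) ->
    shape (unzip2 ps) = map leaves (unzip1 ps).
  by rewrite (prodseq_decs _ (fun c _ => mem_decs c)) => /all2_is_dec_shape[].
apply/andP; split.
  apply/mapP => -[ps /szps s1 [e _]]; move: s1.
  by case: (unzip1 ps) e => [|? [|? ?]].
rewrite map_inj_in_uniq.
  apply: uniq_prodseq; rewrite all_map; apply/allP => c cs /=; exact: IH.
move=> ps qs hps hqs [e1 e2].
have u1 : unzip1 ps = unzip1 qs.
  by rewrite -(children_node_of (szps _ hps)) e1 children_node_of// szps.
have u2 : unzip2 ps = unzip2 qs.
  by apply: eq_from_flatten_shape => //; rewrite !shps// u1.
by rewrite -(zip_unzip ps) u1 u2 zip_unzip.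
Qed.

End Trees.

Section AllT.
Variables (Q : Type) (P : Q -> Prop).

Lemma all_prop_cat s1 s2 : all_prop P (s1 ++ s2) <-> all_prop P s1 /\ all_prop P s2.
Proof. by elim: s1 => [|x s1 IH] /=; [split=> // -[]|rewrite IH; tauto]. Qed.

Lemma all_prop_nth d s : P d -> all_prop P s -> forall i, P (nth d s i).
Proof. by move=> Pd; elim: s => [|x s IH] /=; [move=> _ []|move=> [Px /IH h] []]. Qed.

Lemma all_prop_map_mem (U : eqType) (f : U -> Q) (s : seq U) :
  (forall u, u \in s -> P (f u)) -> all_prop P (map f s).
Proof.
elim: s => //= u s IH H; split; first by apply: H; exact: mem_head.
by apply: IH => v vs; apply: H; rewrite inE vs orbT.
Qed.

Lemma all_prop_map (U : Type) (f : U -> Q) (s : seq U) : (forall u, P (f u)) -> all_prop P (map f s).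
Proof. by move=> H; elim: s => //= u s IH; split. Qed.

End AllT.

(** * Almost everywhere equality of vector-valued functions *)

Section AeEq.
Context {R : realType}.
Variables (T : R) (k : nat).
Local Notation mu := (@lebesgue_measure R).
Local Notation D := (Icc 0 T).
Implicit Types f g : R -> 'cV[R]_k.

Lemma vae_refl f : ae_eq mu D f f. Proof. exact: ae_eq_refl. Qed.

Lemma vae_trans f g h : ae_eq mu D f g -> ae_eq mu D g h -> ae_eq mu D f h.
Proof. exact: ae_eq_trans. Qed.

Lemma vae_lin a f g f' g' : ae_eq mu D f f' -> ae_eq mu D g g' ->
  ae_eq mu D (fun t => a *: f t + g t) (fun t => a *: f' t + g' t).
Proof.
have F : Filter (almost_everywhere mu) := ae_filter_ringOfSetsType mu.
by apply: filterS2 => t h1 h2 Dt; rewrite h1// h2.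
Qed.

Lemma vae_sum (I : Type) (r : seq I) (f g : I -> R -> 'cV[R]_k) :
  (forall i, ae_eq mu D (f i) (g i)) ->
  ae_eq mu D (fun t => \sum_(i <- r) f i t) (fun t => \sum_(i <- r) g i t).
Proof.
move=> fg; elim: r => [|i r IH].
  have := vae_refl (fun=> 0).
  by congr ae_eq; apply/funext => t; rewrite big_nil.
have := vae_lin 1 (fg i) IH.
by congr ae_eq; apply/funext => t; rewrite big_cons scale1r.
Qed.

Lemma vae_scale a f g : ae_eq mu D f g -> ae_eq mu D (fun t => a *: f t) (fun t => a *: g t).
Proof.
move=> fg; have := vae_lin a fg (vae_refl (fun=> 0)).
by congr ae_eq; apply/funext => t; rewrite addr0.
Qed.

End AeEq.

(** * Multilinear expansion of the maps F_p *)

Section Nonlinearity.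
Context {R : realType}.
Variables (T : R) (n : nat).
Hypothesis T0 : 0 <= T.
Local Notation mu := (@lebesgue_measure R).
Local Notation D := (Icc 0 T).
Variable F : forall p, ('I_p -> R -> 'cV[R]_n) -> R -> 'cV[R]_n.
Hypothesis HF : H1hyp T F.
Local Notation SF := (@Sfun R T n).

Lemma SfunP (x : R -> 'cV[R]_n) : Sfun T x <-> exists g, H1deriv T x g.
Proof. by split=> [[]//|[g /(H1deriv_Sfun T0)]]. Qed.

Lemma Sfun0 : Sfun T (fun=> 0 : 'cV[R]_n).
Proof. by apply/SfunP; exists (fun=> 0); exact: H1deriv0. Qed.

Lemma Sfun_lin a (y z : R -> 'cV[R]_n) : Sfun T y -> Sfun T z ->
  Sfun T (fun t => a *: y t + z t).
Proof.
move=> /SfunP[g Hg] /SfunP[h Hh]; apply/SfunP; eexists.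
exact: H1derivD (H1derivZ a Hg) Hh.
Qed.

Lemma Sfun_sum (Q : Type) (L : seq Q) (c : Q -> R) (z : Q -> R -> 'cV[R]_n) :
  (forall q, Sfun T (z q)) -> Sfun T (fun t => \sum_(q <- L) c q *: z q t).
Proof.
move=> hz; elim: L => [|q L IH].
  by under eq_fun do rewrite big_nil; exact: Sfun0.
by under eq_fun do rewrite big_cons; exact: Sfun_lin.
Qed.

Lemma F_cast p q (e : p = q) f g : (forall i, f i = g (cast_ord e i)) ->
  @F p f = @F q g.
Proof.
case: _ / e g => g fg; congr F; apply/funext => i; rewrite fg.
by congr g; apply: val_inj.
Qed.

(** The arity is read off a list, which keeps dependent ordinals out of the inductions; the default
    of [nth] is never reached. *)
Definition Fseq (s : seq (R -> 'cV[R]_n)) : R -> 'cV[R]_n :=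
  @F (size s) (fun j => nth (fun=> 0) s j).

Lemma Fseq_L2 s : (1 < size s)%N -> all_prop SF s -> L2 T (Fseq s).
Proof.
by case: HF => + _ _ _ => HF1 s1 hs; apply: HF1 => // i; apply: all_prop_nth => //; exact: Sfun0.
Qed.

(** Isolates one argument of the list in the [upd] form in which [H1hyp] states linearity. *)
Lemma Fseq_slot s1 s2 : exists (xs : 'I_(size s1 + (size s2).+1) -> R -> 'cV[R]_n) i,
  (all_prop SF s1 -> all_prop SF s2 -> forall j, SF (xs j)) /\
  forall w, Fseq (s1 ++ w :: s2) = F (upd xs i w).
Proof.
have lt : (size s1 < size s1 + (size s2).+1)%N by rewrite addnS ltnS leq_addr.
exists (fun j => nth (fun=> 0) (s1 ++ (fun=> 0) :: s2) j), (Ordinal lt); split.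
  move=> h1 h2 j; apply: all_prop_nth; first exact: Sfun0.
  by apply/all_prop_cat; split=> //; split=> //; exact: Sfun0.
move=> w; have e : size (s1 ++ w :: s2) = (size s1 + (size s2).+1)%N by rewrite size_cat.
apply: (F_cast (e := e)) => j; rewrite /upd -val_eqE /= !nth_cat.
case: ltngtP => // [h|->]; last by rewrite subnn.
by case k : (j - size s1)%N => //; move: h; rewrite -subn_gt0 k.
Qed.

(** The size hypothesis makes the total arity at least two, the range covered by [H1hyp]. *)
Lemma Fseq_slot_lin s1 s2 a y z : (0 < size s1 + size s2)%N ->
  all_prop SF s1 -> all_prop SF s2 -> Sfun T y -> Sfun T z ->
  ae_eq mu D (Fseq (s1 ++ (fun t => a *: y t + z t) :: s2))
    (fun t => a *: Fseq (s1 ++ y :: s2) t + Fseq (s1 ++ z :: s2) t).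
Proof.
move=> sz h1 h2 hy hz; have [xs [i [hxs E]]] := Fseq_slot s1 s2.
rewrite !E.
case: HF => _ _ HF3 _; apply: HF3 => //; first by rewrite addnS ltnS.
exact: hxs.
Qed.

Lemma Fseq_slot_sum (Q : Type) (L : seq Q) (c : Q -> R) (z : Q -> R -> 'cV[R]_n) s1 s2 :
  (0 < size s1 + size s2)%N ->
  all_prop SF s1 -> all_prop SF s2 -> (forall q, Sfun T (z q)) ->
  ae_eq mu D (Fseq (s1 ++ (fun t => \sum_(q <- L) c q *: z q t) :: s2))
    (fun t => \sum_(q <- L) c q *: Fseq (s1 ++ z q :: s2) t).
Proof.
move=> sz h1 h2 hz; elim: L => [|q L IH].
  (* Empty sum: linearity with [a = -1] and both arguments zero gives [F(0) = - F(0) + F(0) = 0]. *)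
  have := Fseq_slot_lin (-1) sz h1 h2 Sfun0 Sfun0.
  have -> : (fun=> -1 *: 0 + 0) = (fun=> 0) :> (R -> 'cV[R]_n).
    by apply/funext => t; rewrite scaler0 addr0.
  have <- : (fun t => \sum_(q <- [::]) c q *: z q t) = (fun=> 0).
    by apply/funext => t; rewrite big_nil.
  move=> h; apply: vae_trans h _.
  have := vae_refl T (fun=> 0 : 'cV[R]_n).
  by congr ae_eq; apply/funext => t; rewrite ?big_nil// scaleN1r addNr.
under [X in X :: s2]eq_fun do rewrite big_cons.
apply: vae_trans (Fseq_slot_lin (c q) sz h1 h2 (hz q) (Sfun_sum L c hz)) _.
have := vae_lin (c q) (vae_refl T (Fseq (s1 ++ z q :: s2))) IH.
by congr ae_eq; apply/funext => t; rewrite big_cons.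
Qed.

(** [s1] holds the arguments already expanded; the induction on [LL] moves there the term chosen in
    the first list. *)
Lemma Fseq_expand (Q : Type) (LL : seq (seq Q)) (c : Q -> R) (z : Q -> R -> 'cV[R]_n) s1 :
  (1 < size s1 + size LL)%N -> all_prop SF s1 -> (forall q, Sfun T (z q)) ->
  ae_eq mu D (Fseq (s1 ++ [seq (fun t => \sum_(q <- L) c q *: z q t) | L <- LL]))
    (fun t => \sum_(ps <- prodseq LL) (\prod_(q <- ps) c q) *: Fseq (s1 ++ map z ps) t).
Proof.
elim: LL s1 => [|L LL IH] s1 sz h1 hz.
  have -> : (fun t => \sum_(ps <- prodseq [::]) (\prod_(q <- ps) c q) *: Fseq (s1 ++ map z ps) t) =
      Fseq (s1 ++ [::]).
    by apply/funext => t; rewrite /= big_seq1 big_nil scale1r.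
  exact: vae_refl.
rewrite [map _ _]/=; set rest := [seq _ | L <- LL].
have hrest : all_prop SF rest by apply: all_prop_map => L'; exact: Sfun_sum.
have sz' : (0 < size s1 + size rest)%N by rewrite size_map; move: sz; rewrite /= addnS ltnS.
apply: vae_trans (Fseq_slot_sum L c sz' h1 hrest hz) _.
have -> : (fun t => \sum_(ps <- prodseq (L :: LL)) (\prod_(q <- ps) c q) *: Fseq (s1 ++ map z ps) t) =
   (fun t => \sum_(q <- L) c q *: \sum_(ps <- prodseq LL)
      (\prod_(q <- ps) c q) *: Fseq (rcons s1 (z q) ++ map z ps) t).
  apply/funext => t; rewrite big_prodseq_cons; apply: eq_bigr => q _.
  rewrite scaler_sumr; apply: eq_bigr => ps _.
  by rewrite scalerA big_cons cat_rcons.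
apply: vae_sum => q; apply: vae_scale; rewrite -cat_rcons.
apply: IH => //; first by rewrite size_rcons addSnnS.
by rewrite -cats1; apply/all_prop_cat; split=> //; split.
Qed.

Variable M : nat -> R.
Hypothesis hM : forall p xs gs, (2 <= p)%N ->
  (forall i, Sfun T (xs i) /\ H1deriv T (xs i) (gs i)) ->
  L2norm T (@F p xs) <= M p * \prod_i Snorm T (xs i) (gs i).

(** The list pairs each function with a derivative, which [Snorm] takes as an argument. *)
Lemma Fseq_bound (s : seq ((R -> 'cV[R]_n) * (R -> 'cV[R]_n))) : (1 < size s)%N ->
  all_prop (fun p => H1deriv T p.1 p.2) s ->
  L2norm T (Fseq (unzip1 s)) <= M (size s) * \prod_(p <- s) Snorm T p.1 p.2.
Proof.
move=> s1 hs; pose d : (R -> 'cV[R]_n) * (R -> 'cV[R]_n) := (fun=> 0, fun=> 0).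
have hd : H1deriv T d.1 d.2 by exact: H1deriv0.
have hn i := all_prop_nth (P := fun p => H1deriv T p.1 p.2) hd hs i.
have -> : Fseq (unzip1 s) = @F (size s) (fun j => (nth d s j).1).
  apply: (F_cast (e := size_map fst s)) => j /=.
  by rewrite (nth_map d)//; have := ltn_ord j; rewrite {2}size_map.
rewrite (big_nth d) big_mkord; apply: hM => // i.
by split; [exact: H1deriv_Sfun (hn i)|exact: hn].
Qed.

End Nonlinearity.

(** * The equation solved by the convolution, and its estimates *)

Section StarRecursion.
Context {R : realType}.
Variables (T : R) (n m : nat).
Hypothesis T_gt0 : 0 < T.
Let T0 : 0 <= T := ltW T_gt0.
Local Notation mu := (@lebesgue_measure R).
Local Notation D := (Icc 0 T).
Variable F : forall p, ('I_p -> R -> 'cV[R]_n) -> R -> 'cV[R]_n.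
Hypothesis HF : H1hyp T F.
Variables (A : 'M[R]_n) (B : 'M[R]_(n, m)) (x0 : 'cV[R]_n) (y0 : tree -> 'cV[R]_n).
Local Notation Phi := (@Phi R T n A F).
Local Notation ufam := (@ufam R T n m A B x0 y0).
Local Notation vfam := (@vfam R T n m A B y0).
Local Notation star := (@star R T n m A B F x0 y0).
Local Notation J := (@J R T n m A B F x0 y0).

Lemma vfam_L2 b : L2 T (vfam b).
Proof. exact: obs_L2. Qed.

Lemma Phi_node_of ts w : (1 < size ts)%N -> Phi (node_of ts) w =
  odesol T A 0 (Fseq F [seq Phi p.1 p.2 | p <- zip ts (reshape (map leaves ts) w)]).
Proof.
case: ts => [|a [|c l]] //= _; congr odesol; congr (Fseq _ [:: _, _ & _]).
by move: (drop (leaves c) _) => {}w; elim: l w => //= d l IH w; rewrite IH.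
Qed.

Definition PhiU c (E : seq tree) := Phi c (map ufam E).

Lemma PhiU_node_of ts E : (1 < size ts)%N -> PhiU (node_of ts) E =
  odesol T A 0 (Fseq F [seq PhiU p.1 p.2 | p <- zip ts (reshape (map leaves ts) E)]).
Proof.
move=> s1; rewrite /PhiU Phi_node_of// -map_reshape.
congr odesol; congr Fseq; move: (reshape _ E) => r.
elim: r ts {s1} => [|e r IH] [|c ts] //=.
by rewrite IH.
Qed.

Lemma PhiU_Sfun c E : Sfun T (PhiU c E).
Proof.
elim/tree_nested_ind: c E => [|a c l IH] E.
  rewrite /PhiU /=; set p := head _ _.
  have hp : L2 T p.2.
    rewrite /p; case: E {p} => [|e E] /=; first exact: L2_0.
    by apply: L2M; exact: vfam_L2.
  by have [] := odesol_is_sol T0 A p.1 hp.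
rewrite -(node_of_children a c l) PhiU_node_of//.
set s := map _ _; suff hs : L2 T (Fseq F s) by have [] := odesol_is_sol T0 A 0 hs.
apply: (Fseq_L2 T0 HF).
  by rewrite size_map size_zip size_reshape size_map minnn.
apply: all_prop_map_mem => -[d E'] /= dE; apply: IH.
have -> : [:: a, c & l] = unzip1 (zip (children (Node a c l)) (reshape (map leaves (children (Node a c l))) E)).
  by rewrite unzip1_zip// size_reshape size_map.
by apply/mapP; exists (d, E').
Qed.

Lemma star_decs b t : star b t = \sum_(p <- decs b) PhiU p.1 p.2 t.
Proof.
rewrite /Defs.star (_ : decomps b = [set` decs b]).
  by rewrite -fsbig_seq// uniq_decs.
apply/seteqP; split=> p /=; rewrite mem_decs /is_dec.
  by move=> [-> ->]; rewrite !eqxx.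
by move=> /andP[/eqP ? /eqP].
Qed.

Lemma star_Sfun b : Sfun T (star b).
Proof.
have := Sfun_sum T0 (decs b) (fun=> 1) (fun p => PhiU_Sfun p.1 p.2).
congr Sfun; apply/funext => t; rewrite star_decs.
by apply: eq_bigr => p _; rewrite scale1r.
Qed.

(** The forcing term F[(Phi * u)(B_-(b))]; the value 0 at the leaf lets one equation and one
    functional serve all trees. *)
Definition source b : R -> 'cV[R]_n :=
  if b is Leaf then fun=> 0 else Fseq F (map star (children b)).

Lemma source_L2 b : L2 T (source b).
Proof.
case: b => [|a c l]; first exact: L2_0.
by apply: (Fseq_L2 T0 HF) => //; apply: all_prop_map; exact: star_Sfun.
Qed.

Lemma PhiU_leaf_is_sol b : is_sol T A (ufam b).1 (fun t => B *m vfam b t) (PhiU Leaf [:: b]).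
Proof. by apply: odesol_is_sol => //; apply: L2M; exact: vfam_L2. Qed.

(** The decomposition with [c = Leaf] contributes the linear response to u(b). Every other one
    contributes the response to F_r of one term [PhiU] per child; the choices for the children being
    independent, multilinearity resums them into the response to F_r of the [star] of the
    children. *)
Lemma star_is_sol b : is_sol T A (ufam b).1 (fun t => B *m vfam b t + source b t) (star b).
Proof.
have hB : L2 T (fun t => B *m vfam b t) by apply: L2M; exact: vfam_L2.
case: b hB => [|a c l] hB.
  apply: (eq_is_sol T0 hB _ _ _ (PhiU_leaf_is_sol Leaf)).
  - by apply: L2D => //; exact: source_L2.
  - by move=> t _; rewrite star_decs big_seq1.
  - by apply: aeW => t _; rewrite addr0.
set b := Node a c l in hB *; set cs := children b.
pose G ps := Fseq F [seq PhiU p.1 p.2 | p <- ps].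
pose LL := map decs cs.
have szps ps : ps \in prodseq LL -> size ps = size cs.
  by rewrite mem_prodseq => /all2_size ->; rewrite size_map.
have hG ps : ps \in prodseq LL -> L2 T (G ps).
  move=> /szps sz; apply: (Fseq_L2 T0 HF); first by rewrite size_map sz.
  by apply: all_prop_map => p; exact: PhiU_Sfun.
have nodeE ps : ps \in prodseq LL ->
    PhiU (node_of (unzip1 ps)) (flatten (unzip2 ps)) = odesol T A 0 (G ps).
  move=> hps; rewrite PhiU_node_of; last by rewrite size_map szps.
  have [<- _] : shape (unzip2 ps) = map leaves (unzip1 ps) /\ [seq graft p.1 p.2 | p <- ps] = cs.
    by apply: all2_is_dec_shape; rewrite -(prodseq_decs _ (fun c _ => mem_decs c)).
  by rewrite flattenK zip_unzip.
(* [is_sol_sum] wants every index to give a square-integrable force, which is known for [G] only on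
   [prodseq LL]. *)
pose G' ps := if ps \in prodseq LL then G ps else fun=> 0.
have hG' ps : L2 T (G' ps) by rewrite /G'; case: ifP => [/hG //|_]; exact: L2_0.
have solG ps : is_sol T A 0 (G' ps) (odesol T A 0 (G' ps)) by exact: odesol_is_sol.
have := is_sol_sum T0 (prodseq LL) hG' solG.
rewrite big1// => /(is_solD T0 hB (L2_sum _ (P := xpredT) (fun ps _ => hG' ps)) (PhiU_leaf_is_sol b)).
rewrite addr0; apply: eq_is_sol => //.
- by apply: L2D => //; exact: L2_sum.
- by apply: L2D => //; exact: source_L2.
- move=> t _; rewrite star_decs decs_node big_cons big_map; congr (_ + _).
  apply: eq_big_seq => ps hps; rewrite nodeE//.
  by rewrite /G' hps.
have := Fseq_expand T0 HF (LL := LL) (fun=> 1) (s1 := [::]) (isT : (1 < 0 + size LL)%N) I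
  (fun p => PhiU_Sfun p.1 p.2).
rewrite !cat0s => h.
have E1 : [seq (fun t => \sum_(q <- L) 1 *: PhiU q.1 q.2 t) | L <- LL] = map star cs.
  rewrite -map_comp; apply: eq_map => d; apply/funext => t /=; rewrite star_decs.
  by apply: eq_bigr => p _; rewrite scale1r.
rewrite E1 in h.
have F' : Filter (almost_everywhere mu) := ae_filter_ringOfSetsType mu.
apply: filterS h => t h Dt; congr (_ + _); rewrite [RHS]h//.
by apply: eq_big_seq => ps hps; rewrite big1// scale1r /G' hps.
Qed.

(** [(ufam b).1] vanishes off the leaf and [source] vanishes at it, so both clauses of [J] are one
    quadratic functional. *)
Lemma J_quadratic b z : J b z = 2^-1 * vip T (obs T A B z) (obs T A B z) +
  (inner (ufam b).1 z + vip T (source b) (adj T A z)).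
Proof.
rewrite /Defs.J; congr (_ * _ + _).
  rewrite (vip_inner (obs_L2 T_gt0 A B z) (obs_L2 T_gt0 A B z)).
  by apply: eq_Rintegral => t _; rewrite vnorm_sqr.
case: b => [|a c l].
  rewrite /vip big1 ?addr0// => i _.
  by rewrite /Rintegral integral0_eq// => t _; rewrite mxE mul0r.
rewrite [inner _ z](_ : _ = 0) ?add0r; last first.
  by rewrite /inner big1// => i _; rewrite /= mxE mul0r.
rewrite vipC (vip_inner (adj_L2 T_gt0 A z) (source_L2 _)).
apply: eq_Rintegral => t _; congr inner.
have e : size [:: a, c & l] = size (map star [:: a, c & l]) by rewrite size_map.
have -> // : F (fun j : 'I_(size [:: a, c & l]) => star (nth Leaf [:: a, c & l] j)) =
   Fseq F (map star [:: a, c & l]).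
apply: (F_cast F (e := e)) => j.
exact/esym/(nth_map Leaf (fun=> 0) star (ltn_ord j)).
Qed.

Hypothesis hy0 : constructed T A B F x0 y0.

Lemma euler_lagrange b w : vip T (vfam b) (obs T A B w) +
  (inner (ufam b).1 w + vip T (source b) (adj T A w)) = 0.
Proof.
apply: (minimizer_euler_lagrange T_gt0 (y := y0 b) (source_L2 b)) => z.
by rewrite -!J_quadratic; exact: hy0.
Qed.

Lemma star_final b : star b T = 0.
Proof.
exact: (optimal_control_steers T_gt0 (source_L2 b) (euler_lagrange b) (star_is_sol b)).
Qed.

(** The derivative read off the equation, used as the argument of [Snorm]. *)
Definition star_deriv b : R -> 'cV[R]_n :=
  fun t => A *m star b t + (B *m vfam b t + source b t).

Lemma star_force_L2 b : L2 T (fun t => B *m vfam b t + source b t).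
Proof. by apply: L2D; [apply: L2M; exact: vfam_L2|exact: source_L2]. Qed.

Lemma star_H1 b : H1deriv T (star b) (star_deriv b).
Proof. by have /(is_solP _ _ _ T0 (star_force_L2 b))[] := star_is_sol b. Qed.

Hypothesis kalman_rank : \rank (kalman A B) = n.

(** Off the leaf the initial value is zero, so the control and then the trajectory are bounded by
    the source alone; one constant serves all trees because the Gramian and the linear equation do
    not depend on [b]. *)
Lemma family_bounds : exists2 K : R, 0 <= K & forall a c l, let b := Node a c l in
  L2norm T (vfam b) <= K * L2norm T (source b) /\
  Snorm T (star b) (star_deriv b) <= K * L2norm T (source b).
Proof.
have [K1 K10 hK1] := control_bound T_gt0 kalman_rank.
have [K2 K20 hK2] := sol_bound T0 A.
have lB := l1_ge0 B.
exists (K1 + K2 * (l1 B * K1 + 1)); first by rewrite addr_ge0// mulr_ge0// addr_ge0// mulr_ge0.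
move=> a c l b.
have s0 := L2norm_ge0 T (source b).
have vb : L2norm T (vfam b) <= K1 * L2norm T (source b).
  apply: hK1 (source_L2 b) _ => w; have := euler_lagrange b w.
  by rewrite [inner _ w](_ : _ = 0) ?add0r// /inner big1// => i _; rewrite /= mxE mul0r.
split.
  apply: le_trans vb _; rewrite ler_wpM2r// lerDl mulr_ge0// addr_ge0// mulr_ge0//.
have [_] := hK2 _ _ _ (star_force_L2 b) (star_is_sol b).
rewrite vnorm0 add0r => /le_trans; apply.
apply: (@le_trans _ _ (K2 * ((l1 B * K1 + 1) * L2norm T (source b)))).
  rewrite ler_wpM2l//.
  apply: le_trans (L2norm_triangle (L2M B (vfam_L2 b)) (source_L2 b)) _.
  rewrite mulrDl mul1r lerD2r; apply: le_trans (L2normM B (vfam_L2 b)) _.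
  by rewrite -mulrA ler_wpM2l.
by rewrite mulrA ler_wpM2r// lerDr.
Qed.

End StarRecursion.

(** * Enumeration of trees by the children of the root *)

Section NodeEnumeration.

(** One generation of grafting, with arities [2 <= p < N]; a sum of multiplicative weights over it
    is a sum of powers of the sum over [Y]. *)
Definition nodes (Y : seq tree) (N : nat) : seq tree :=
  [seq node_of ps | p <- index_iota 2 N, ps <- prodseq (nseq p Y)].

Lemma prodseq_nseqP (Q : eqType) (Y : seq Q) p ps :
  ps \in prodseq (nseq p Y) -> size ps = p /\ {subset ps <= Y}.
Proof.
rewrite mem_prodseq; elim: p ps => [|p IH] [|q ps] //= /andP[qY /IH[-> sub]].
by split=> // r; rewrite inE => /orP[/eqP ->|/sub].
Qed.

Lemma mem_prodseq_nseq (Q : eqType) (Y : seq Q) ps :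
  {subset ps <= Y} -> ps \in prodseq (nseq (size ps) Y).
Proof.
rewrite mem_prodseq; elim: ps => //= q ps IH sub; rewrite sub ?mem_head// IH// => r rps.
by apply: sub; rewrite inE rps orbT.
Qed.

Lemma mem_nodes Y N b : b != Leaf -> {subset children b <= Y} ->
  (size (children b) < N)%N -> b \in nodes Y N.
Proof.
case: b => // a c l _ sub sz; apply/allpairsPdep.
exists (size (children (Node a c l))), (children (Node a c l)); split.
- by rewrite mem_index_iota.
- exact: mem_prodseq_nseq.
- by [].
Qed.

Lemma Leaf_notin_nodes Y N : Leaf \notin nodes Y N.
Proof.
apply/negP => /allpairsPdep[p [ps [pN /prodseq_nseqP[sz _] e]]].
move: pN; rewrite mem_index_iota -sz => /andP[s2 _].
by case: ps sz e s2 => [|? [|? ?]].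
Qed.

Lemma uniq_nodes Y N : uniq Y -> uniq (nodes Y N).
Proof.
move=> uY; apply: allpairs_uniq_dep.
- exact: iota_uniq.
- by move=> p _; apply: uniq_prodseq; apply/allP => L /nseqP[->].
- have ch (u : {_ : nat & seq tree}) :
      u \in [seq existT (fun=> seq tree) p ps | p <- index_iota 2 N, ps <- prodseq (nseq p Y)] ->
      children (node_of (tagged u)) = tagged u /\ size (tagged u) = tag u.
    move=> /allpairsPdep[p [ps [pN /prodseq_nseqP[sz _] ->]]] /=.
    by rewrite children_node_of// sz; move: pN; rewrite mem_index_iota => /andP[].
  move=> [p ps] [q qs] /ch /= [c1 s1] /ch /= [c2 s2] e.
  by have e' : ps = qs; [rewrite -c1 e c2|rewrite -s1 -s2 e'].
Qed.

Lemma sum_nodes (V : nmodType) (f : tree -> V) Y N :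
  \sum_(b <- nodes Y N) f b =
  \sum_(2 <= p < N) \sum_(ps <- prodseq (nseq p Y)) f (node_of ps).
Proof. by rewrite big_allpairs_dep. Qed.

Lemma internal_child a c l d : d \in [:: a, c & l] -> (internal d < internal (Node a c l))%N.
Proof.
rewrite /= -addnA add1n addSn ltnS; rewrite !inE => /orP[/eqP ->|/orP[/eqP ->|dl]].
- exact: leq_addr.
- by rewrite addnCA leq_addr.
- rewrite addnA (leq_trans _ (leq_addl _ _))//.
  elim: l dl => //= e l IH; rewrite inE => /orP[/eqP ->|/IH h]; first exact: leq_addr.
  by rewrite (leq_trans h)// leq_addl.
Qed.

End NodeEnumeration.

(** By convexity the increment lies below the chord over [[0, 1]], namely
    [delta * ((rho + 1) ^+ p - rho ^+ p)]; the induction runs on this sharper form. *)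
Lemma power_increment (R : realFieldType) (rho delta : R) p : 0 <= rho -> 0 <= delta <= 1 ->
  (rho + delta) ^+ p - rho ^+ p <= delta * (rho + 1) ^+ p.
Proof.
move=> r0 /andP[d0 d1].
suff : (rho + delta) ^+ p - rho ^+ p <= delta * ((rho + 1) ^+ p - rho ^+ p).
  move=> /le_trans; apply; rewrite ler_wpM2l// gerBl exprn_ge0//.
elim: p => [|p IH]; first by rewrite !expr0 !subrr mulr0.
have rp : 0 <= rho ^+ p by rewrite exprn_ge0.
have h : 0 <= (rho + 1) ^+ p - rho ^+ p.
  by rewrite subr_ge0 lerXn2r ?nnegrE ?addr_ge0 ?lerDl.
rewrite !exprS.
apply: (@le_trans _ _ ((rho + delta) * (delta * ((rho + 1) ^+ p - rho ^+ p)) + delta * rho ^+ p)).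
  have := ler_wpM2l (addr_ge0 r0 d0) IH.
  set u := (rho + delta) ^+ p; set v := rho ^+ p; set w := (rho + 1) ^+ p; lra.
set v := rho ^+ p in rp h *; set w := (rho + 1) ^+ p in h *.
have -> : delta * ((rho + 1) * w - rho * v) =
  (rho + delta) * (delta * (w - v)) + delta * v + delta * ((1 - delta) * (w - v)) by ring.
by rewrite lerDl mulr_ge0// mulr_ge0// subr_ge0.
Qed.

Lemma vnormZ (R : realType) k a (y : 'cV[R]_k) : vnorm (a *: y) = `|a| * vnorm y.
Proof.
rewrite -sqrtr_sqr -sqrtrM ?sqr_ge0//; congr Num.sqrt; rewrite /inner mulr_sumr.
by apply: eq_bigr => i _; rewrite !mxE; ring.
Qed.

(* [vnorm y] is the [L2] norm of the constant function [y] on [[0, 1]]. *)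
Lemma vnormD (R : realType) k (y z : 'cV[R]_k) : vnorm (y + z) <= vnorm y + vnorm z.
Proof.
have cst_L2 (u : 'cV[R]_k) : L2 1 (fun=> u) by move=> i; exact: sqint_cst.
have cst_norm (u : 'cV[R]_k) : L2norm 1 (fun=> u) = vnorm u.
  congr Num.sqrt; apply: eq_bigr => i _.
  by rewrite Rintegral_cst_Icc// mulr1 expr2.
by have := L2norm_triangle (cst_L2 y) (cst_L2 z); rewrite !cst_norm.
Qed.

(** * Convergence of the tree series and the nonlinear equation *)

Section FinalProof.
Context {R : realType}.
Variables (T : R) (n m : nat).
Hypothesis T_gt0 : 0 < T.
Let T0 : 0 <= T := ltW T_gt0.
Local Notation mu := (@lebesgue_measure R).
Local Notation D := (Icc 0 T).
Variable F : forall p, ('I_p -> R -> 'cV[R]_n) -> R -> 'cV[R]_n.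
Hypothesis HF : H1hyp T F.
Variables (A : 'M[R]_n) (B : 'M[R]_(n, m)) (x0 : 'cV[R]_n) (y0 : tree -> 'cV[R]_n).
Local Notation ufam := (@ufam R T n m A B x0 y0).
Local Notation vfam := (@vfam R T n m A B y0).
Local Notation star := (@star R T n m A B F x0 y0).
Local Notation source := (@source R T n m F A B x0 y0).
Local Notation star_deriv := (@star_deriv R T n m F A B x0 y0).
Local Notation Fseq := (@Fseq R n F).
Hypothesis hy0 : constructed T A B F x0 y0.
Hypothesis kalman_rank : \rank (kalman A B) = n.

Variable M : nat -> R.
Hypothesis M0 : forall p, 0 <= M p.
Hypothesis hM : forall p xs gs, (2 <= p)%N ->
  (forall i, Sfun T (xs i) /\ H1deriv T (xs i) (gs i)) ->
  L2norm T (@F p xs) <= M p * \prod_i Snorm T (xs i) (gs i).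

Let sigma b := Snorm T (star b) (star_deriv b).
Let kappa b := L2norm T (source b).

Let sigma0 b : 0 <= sigma b. Proof. exact: Snorm_ge0. Qed.

Lemma source_node_bound ps : (1 < size ps)%N ->
  kappa (node_of ps) <= M (size ps) * \prod_(b <- ps) sigma b.
Proof.
move=> s1; have hs := star_H1 T_gt0 HF A B x0 y0.
have := Fseq_bound T0 hM (s := [seq (star b, star_deriv b) | b <- ps]).
rewrite size_map big_map => /(_ s1) h.
have -> : kappa (node_of ps) = L2norm T (Fseq (unzip1 [seq (star b, star_deriv b) | b <- ps])).
  rewrite /kappa /unzip1 -map_comp; congr L2norm.
  by case: ps s1 {h} => [|a [|c l]].
by apply: h; apply: all_prop_map => b; exact: hs.
Qed.

(** The leaf has weight [sigma Leaf], and the unit is what all other trees together may weigh. The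
    majorant below is taken at [rho + 1] to leave room for perturbations of size at most 1. *)
Let rho := sigma Leaf + 1.
Variables (K C lam : R).
Hypothesis K0 : 0 <= K.
Hypothesis hK : forall a c l, let b := Node a c l in
  L2norm T (vfam b) <= K * L2norm T (source b) /\
  Snorm T (star b) (star_deriv b) <= K * L2norm T (source b).
Hypothesis hC : forall N, \sum_(0 <= p < N) M p * (rho + 1) ^+ p <= C.
Hypothesis hlam : `|lam| * (K * C) <= 1.

Let w b := `|lam| ^+ internal b * sigma b.
(** One power of [lam] less than in [w], as the equation multiplies the source by [lam]; the
    truncated exponent at the leaf is harmless because the source is zero there. *)
Let kw b := `|lam| ^+ (internal b).-1 * kappa b.

Let rho0 : 0 <= rho. Proof. by rewrite /rho addr_ge0. Qed.
Let C0 : 0 <= C. Proof. by have := hC 0; rewrite big_geq. Qed.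
Let w0 b : 0 <= w b. Proof. by rewrite mulr_ge0// exprn_ge0. Qed.
Let kw0 b : 0 <= kw b. Proof. by rewrite mulr_ge0 ?exprn_ge0// L2norm_ge0. Qed.

Lemma expr_sumn (V : comPzRingType) (x : V) (s : seq tree) :
  x ^+ sumn (map internal s) = \prod_(b <- s) x ^+ internal b.
Proof. by elim: s => [|b s IH] /=; rewrite ?big_nil ?expr0// big_cons exprD IH. Qed.

(** Leaving out the root, the internal vertices of the tree are those of its children, so the powers
    of [lam] split over them. *)
Lemma kw_node_bound ps : (1 < size ps)%N -> kw (node_of ps) <= M (size ps) * \prod_(b <- ps) w b.
Proof.
move=> s1; rewrite /kw internal_node_of//= expr_sumn big_split /= mulrCA.
by rewrite ler_wpM2l ?prodr_ge0 ?source_node_bound// => b _; rewrite exprn_ge0.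
Qed.

Lemma w_node_bound b : b != Leaf -> w b <= `|lam| * K * kw b.
Proof.
case: b => // a c l _; have [_] := hK a c l; set b := Node a c l => h.
have e : internal b = (internal b).-1.+1 by [].
rewrite /w /kw e exprS -!mulrA ler_wpM2l// mulrCA ler_wpM2l ?exprn_ge0//.
Qed.

Lemma sum_M_le N r : 0 <= r <= rho + 1 -> \sum_(2 <= p < N) M p * r ^+ p <= C.
Proof.
move=> /andP[r0 r1]; have [N2|N2] := leqP N 2; first by rewrite big_geq.
apply: le_trans (hC N); rewrite [leRHS](@big_cat_nat _ _ _ 2)//=; last exact: ltnW.
rewrite -[leLHS]add0r lerD//.
  by apply: sumr_ge0 => p _; rewrite mulr_ge0// exprn_ge0// addr_ge0.
by apply: ler_sum => p _; rewrite ler_wpM2l// lerXn2r ?nnegrE// (le_trans r0).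
Qed.

(** Independent choices of [p] children in [Y] add up to the [p]-th power of the sum over [Y]; the
    majorant series at that value is at most [C]. *)
Lemma sum_kw_nodes Y N : \sum_(b <- Y) w b <= rho -> \sum_(b <- nodes Y N) kw b <= C.
Proof.
move=> hY; rewrite sum_nodes.
apply: (@le_trans _ _ (\sum_(2 <= p < N) M p * (\sum_(b <- Y) w b) ^+ p)).
  rewrite big_nat_cond [leRHS]big_nat_cond; apply: ler_sum => p; rewrite andbT => /andP[p2 _].
  have -> : (\sum_(b <- Y) w b) ^+ p = \sum_(ps <- prodseq (nseq p Y)) \prod_(b <- ps) w b.
    rewrite -prod_sum_prodseq big_nseq; elim: p {p2} => [|p IH] //=; by rewrite exprS IH.
  rewrite mulr_sumr big_seq [leRHS]big_seq; apply: ler_sum => ps /prodseq_nseqP[sz _].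
  by have := kw_node_bound (ps := ps); rewrite sz; apply.
apply: sum_M_le; rewrite sumr_ge0//= (le_trans hY)// lerDl//.
Qed.

Lemma sum_kw_le s Y : uniq s -> uniq Y ->
  (forall b, b \in s -> {subset children b <= Y}) -> \sum_(b <- Y) w b <= rho ->
  \sum_(b <- s | b != Leaf) kw b <= C.
Proof.
move=> us uY sub hY; rewrite -big_filter.
(* Larger than the number of children of any root in [s]. *)
pose N := (\sum_(b <- s) (size (children b)).+1)%N.
apply: le_trans (sum_kw_nodes N hY); apply: ler_sum_subseq => //.
- exact: filter_uniq.
- exact: uniq_nodes.
- move=> b; rewrite mem_filter => /andP[bL bs]; apply: mem_nodes => //; first exact: sub.
  by rewrite /N (big_rem b)//= leq_addr.
Qed.

Lemma children_closure (s : seq tree) : exists Y, [/\ uniq Y,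
  forall b, b \in s -> {subset children b <= Y} &
  forall d, d \in Y -> exists2 b, b \in s & d \in children b].
Proof.
exists (undup (flatten (map children s))); split; first exact: undup_uniq.
  by move=> b bs d db; rewrite mem_undup; apply/flatten_mapP; exists b.
by move=> d; rewrite mem_undup => /flatten_mapP[b bs db]; exists b.
Qed.

Lemma sum_Leaf_le s (f : tree -> R) : uniq s -> 0 <= f Leaf ->
  \sum_(b <- s | b == Leaf) f b <= f Leaf.
Proof.
move=> us f0; elim: s us => [|b s IH] /=; first by rewrite big_nil.
move=> /andP[bs us]; rewrite big_cons; case: eqP bs => [->|_ _]; last exact: IH.
move=> Ls; rewrite big1_seq ?addr0// => b' /andP[/eqP ->].
by rewrite (negPf Ls).
Qed.

(* A finite set of trees of height [h.+1] is contained in the leaf together with [nodes Y N], where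
   [Y] has height [h], so the bound [rho] propagates from [h] to [h.+1]. *)
Lemma sum_w_le s : uniq s -> \sum_(b <- s) w b <= rho.
Proof.
suff H : forall h s, uniq s -> (forall b, b \in s -> (internal b < h)%N) ->
    \sum_(b <- s) w b <= rho.
  move=> us; apply: (H (\sum_(b <- s) (internal b).+1)%N) => // b bs.
  by rewrite (big_rem b)//= leq_addr.
elim=> [|h IH] {}s us hs.
  by case: s us hs => [|b s] _ hs; [rewrite big_nil|have := hs b (mem_head _ _)].
have [Y [uY sub chY]] := children_closure s.
have hY : \sum_(b <- Y) w b <= rho.
  apply: IH => // d /chY[b bs]; case: b bs => // a c l bs /internal_child.
  by move=> /leq_trans; apply; have := hs _ bs; rewrite ltnS.
rewrite (bigID (pred1 Leaf))/= /rho lerD//.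
  apply: le_trans (sum_Leaf_le (f := w) us _) _ => //.
  by rewrite /w expr0 mul1r.
apply: (@le_trans _ _ (`|lam| * K * \sum_(b <- s | b != Leaf) kw b)).
  by rewrite mulr_sumr; apply: ler_sum => b; exact: w_node_bound.
apply: le_trans hlam; rewrite -mulrA ler_wpM2l// ler_wpM2l//.
exact: sum_kw_le hY.
Qed.

Lemma kw_Leaf : kw Leaf = 0.
Proof. by rewrite /kw /kappa /= L2norm0 mulr0. Qed.

Lemma sum_kw_uniq s : uniq s -> \sum_(b <- s) kw b <= C.
Proof.
move=> us; have [Y [uY sub _]] := children_closure s.
rewrite (bigID (pred1 Leaf))/= big1 ?add0r; last by move=> b /eqP ->; exact: kw_Leaf.
by apply: sum_kw_le sub _ => //; exact: sum_w_le.
Qed.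

Let aV b t := lam ^+ internal b *: vfam b t.
Let aQ b t := lam ^+ (internal b).-1 *: source b t.

Lemma aV_L2 b : L2 T (aV b). Proof. exact/L2Z/vfam_L2. Qed.
Lemma aQ_L2 b : L2 T (aQ b). Proof. by apply: L2Z; exact: source_L2. Qed.

Lemma control_series_exists : exists V, L2 T V /\ tree_sum_L2 T aV V.
Proof.
apply: (tree_sum_exists (rho := L2norm T (vfam Leaf) + `|lam| * K * C) T0 aV_L2) => s us.
have nE b : L2norm T (aV b) = `|lam| ^+ internal b * L2norm T (vfam b).
  by rewrite L2normZ ?normrX//; exact: vfam_L2.
rewrite (bigID (pred1 Leaf))/= lerD//.
  apply: le_trans (sum_Leaf_le (f := fun b => L2norm T (aV b)) us (L2norm_ge0 _ _)) _.
  by rewrite nE expr0 mul1r.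
apply: (@le_trans _ _ (`|lam| * K * \sum_(b <- s | b != Leaf) kw b)).
  rewrite mulr_sumr; apply: ler_sum => -[|a c l]// _.
  have [h _] := hK a c l; set b := Node a c l in h *.
  have e : internal b = (internal b).-1.+1 by [].
  by rewrite nE /kw e exprS -!mulrA ler_wpM2l// mulrCA ler_wpM2l ?exprn_ge0.
rewrite ler_wpM2l ?mulr_ge0//.
apply: le_trans (sum_kw_uniq us); rewrite [leRHS](bigID (pred1 Leaf))/= lerDr.
by apply: sumr_ge0.
Qed.

Lemma source_series_exists : exists Q, L2 T Q /\ tree_sum_L2 T aQ Q.
Proof.
apply: (tree_sum_exists (rho := C) T0 aQ_L2) => s us.
apply: le_trans (sum_kw_uniq us); apply: ler_sum => b _.
by rewrite L2normZ ?normrX//; exact: source_L2.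
Qed.

Let xX X t := \sum_(b <- X) lam ^+ internal b *: star b t.
Let gX X t := \sum_(b <- X) lam ^+ internal b *: star_deriv b t.

Lemma xX_H1 X : H1deriv T (xX X) (gX X).
Proof. by apply: H1deriv_sum => b _; apply: H1derivZ; exact: star_H1. Qed.

(** A bound uniform in [X]: it allows [X] to be enlarged without worsening the error estimates on
    F_p. *)
Lemma Snorm_xX X : uniq X -> Snorm T (xX X) (gX X) <= rho.
Proof.
move=> /sum_w_le; apply: le_trans.
have hd b : L2 T (star_deriv b) by have [] := star_H1 T_gt0 HF A B x0 y0 b.
elim: X => [|b X IH].
  rewrite big_nil /Snorm /xX big_nil vnorm0 add0r.
  by under [X in L2norm _ X]eq_fun do rewrite /gX big_nil; rewrite L2norm0.
rewrite big_cons /Snorm /xX big_cons.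
have -> : gX (b :: X) = fun t => lam ^+ internal b *: star_deriv b t + gX X t.
  by apply/funext => t; rewrite /gX big_cons.
have h2 : L2 T (gX X) by apply: L2_sum => d _; exact: L2Z.
apply: le_trans (lerD (vnormD _ _) (L2norm_triangle (L2Z _ (hd b)) h2)) _.
rewrite vnormZ L2normZ// normrX addrACA -mulrDr lerD//.
Qed.

Variables (V : R -> 'cV[R]_m) (Q : R -> 'cV[R]_n).
Hypotheses (hV : L2 T V) (hVs : tree_sum_L2 T aV V).
Hypotheses (hQ : L2 T Q) (hQs : tree_sum_L2 T aQ Q).

(** At this stage [Q] is only the sum of the source series; that it equals the nonlinearity at [x]
    is [Fsum_x]. *)
Let force t := B *m V t + lam *: Q t.
Let x := odesol T A x0 force.

Lemma force_L2 : L2 T force. Proof. by apply: L2D; [exact: L2M|exact: L2Z]. Qed.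

Lemma x_is_sol : is_sol T A x0 force x.
Proof. by apply: odesol_is_sol => //; exact: force_L2. Qed.

(** [X] must contain the leaf because it alone carries the initial value [x0]. *)
Lemma xX_is_sol X : uniq X -> Leaf \in X ->
  is_sol T A x0 (fun t => B *m (\sum_(b <- X) aV b t) + lam *: \sum_(b <- X) aQ b t) (xX X).
Proof.
move=> uX LX.
have hs b := is_solZ T0 (lam ^+ internal b) (star_force_L2 T_gt0 HF A B x0 y0 b)
   (star_is_sol T_gt0 HF A B x0 y0 b).
have := is_sol_sum T0 X (fun b => L2Z (lam ^+ internal b) (star_force_L2 T_gt0 HF A B x0 y0 b)) hs.
have -> : \sum_(b <- X) lam ^+ internal b *: (ufam b).1 = x0.
  rewrite (bigD1_seq Leaf)//= expr0 scale1r big1 ?addr0// => -[|a c l]// _.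
  by rewrite scaler0.
congr is_sol; apply/funext => t.
rewrite mulmx_sumr scaler_sumr -big_split /=; apply: eq_bigr => b _.
rewrite scalerDr scalemxAr; congr (_ + _).
(* Off the leaf the factor [lam] restores the exponent [internal b]; at the leaf both sides are
   zero. *)
by case: b => [|a c l]; rewrite /aQ ?scaler0// scalerA -exprS.
Qed.

(** The difference solves the linear equation with zero initial value and a force made of the two
    series remainders, so [sol_bound] applies. *)
Lemma x_approx eps : 0 < eps -> exists s0 : seq tree,
  forall X : seq tree, uniq X -> {subset s0 <= X} -> exists g : R -> 'cV[R]_n, [/\ H1deriv T (fun t => x t - xX X t) g,
    Snorm T (fun t => x t - xX X t) g <= eps & l1 (x T - xX X T) <= eps].
Proof.
move=> e0; have [K2 K20 hK2] := sol_bound T0 A.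
(* The force has norm at most [(l1 B + |lam|) * e1] and the solution map costs [K2]; the added 1
   keeps the denominator positive. *)
pose e1 := eps / (K2 * (l1 B + `|lam|) + 1).
have den : 0 < K2 * (l1 B + `|lam|) + 1.
  by rewrite ltr_wpDl// mulr_ge0// addr_ge0// l1_ge0.
have e10 : 0 < e1 by rewrite divr_gt0.
have [s1 [_ hs1]] := (tree_sum_L2P T aV V).1 hVs _ e10.
have [s2 [_ hs2]] := (tree_sum_L2P T aQ Q).1 hQs _ e10.
exists (Leaf :: s1 ++ s2) => X uX sub.
have LX : Leaf \in X by apply: sub; exact: mem_head.
have hSV : L2 T (fun t => \sum_(b <- X) aV b t) by apply: L2_sum => b _; exact: aV_L2.
have hSQ : L2 T (fun t => \sum_(b <- X) aQ b t) by apply: L2_sum => b _; exact: aQ_L2.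
have hVX : L2norm T (fun t => V t - \sum_(b <- X) aV b t) <= e1.
  rewrite L2normC// ltW// hs1// => b bs; apply: sub.
  by rewrite inE mem_cat bs orbT.
have hQX : L2norm T (fun t => Q t - \sum_(b <- X) aQ b t) <= e1.
  rewrite L2normC// ltW// hs2// => b bs; apply: sub.
  by rewrite inE mem_cat bs !orbT.
pose f t := B *m (V t - \sum_(b <- X) aV b t) + lam *: (Q t - \sum_(b <- X) aQ b t).
have h1 : L2 T (fun t => B *m (V t - \sum_(b <- X) aV b t)) by apply: L2M; exact: L2B.
have h2 : L2 T (fun t => lam *: (Q t - \sum_(b <- X) aQ b t)) by apply: L2Z; exact: L2B.
have hf : L2 T f by exact: L2D.
have fX_L2 : L2 T (fun t => B *m (\sum_(b <- X) aV b t) + lam *: \sum_(b <- X) aQ b t).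
  by apply: L2D; [exact: L2M|exact: L2Z].
have dsol : is_sol T A 0 f (fun t => x t - xX X t).
  have := is_solD T0 force_L2 (L2Z (-1) fX_L2) x_is_sol (is_solZ T0 (-1) fX_L2 (xX_is_sol uX LX)).
  rewrite scaleN1r subrr.
  have -> : (fun t => force t + -1 *: (B *m (\sum_(b <- X) aV b t) + lam *: \sum_(b <- X) aQ b t)) = f.
    by apply/funext => t; rewrite scaleN1r /f /force mulmxBr scalerBr opprD addrACA.
  have -> // : (fun t => x t + -1 *: xX X t) = (fun t => x t - xX X t).
  by apply/funext => t; rewrite scaleN1r.
have fe : L2norm T f <= (l1 B + `|lam|) * e1.
  apply: le_trans (L2norm_triangle h1 h2) _; rewrite mulrDl lerD//.
    by apply: le_trans (L2normM B (L2B hV hSV)) _; rewrite ler_wpM2l// l1_ge0.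
  by rewrite L2normZ ?ler_wpM2l//; exact: L2B.
have Ke : K2 * (vnorm (0 : 'cV[R]_n) + L2norm T f) <= eps.
  rewrite vnorm0 add0r; apply: (@le_trans _ _ (K2 * ((l1 B + `|lam|) * e1))).
    by rewrite ler_wpM2l.
  rewrite /e1 mulrA mulrCA -[leRHS]mulr1 ler_wpM2l ?(ltW e0)//.
  by rewrite ler_pdivrMr// mul1r lerDl.
have [b1 b2] := hK2 _ _ _ hf dsol.
have [_ Hd] := (is_solP A 0 (fun t => x t - xX X t) T0 hf).1 dsol.
exists (fun t => A *m (x t - xX X t) + f t); split=> //.
  exact: le_trans b2 Ke.
by apply: le_trans (b1 T _) Ke; rewrite /Icc/= T0 lexx.
Qed.

Lemma x_final : x T = 0.
Proof.
apply: l1_eq0; apply/ler_addgt0Pl => e e0; rewrite addr0.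
have [s0 /(_ (undup s0) (undup_uniq s0)) h] := x_approx e0.
have [|g [_ _]] := h; first by move=> b; rewrite mem_undup.
have -> // : xX (undup s0) T = 0; last by rewrite subr0.
rewrite /xX big1// => b _.
by rewrite (star_final T_gt0 HF hy0) scaler0.
Qed.

Lemma Fdiag_Fseq p (y : R -> 'cV[R]_n) : F (fun _ : 'I_p => y) = Fseq (nseq p y).
Proof.
apply/esym; have e := size_nseq p y; apply: (F_cast F (e := e)) => j.
by rewrite nth_nseq; have := ltn_ord j; rewrite {2}e => ->.
Qed.

(** The term of the expansion indexed by [ps] belongs to the tree [node_of ps], and its coefficient
    has exponent the sum of the internal counts of [ps], one less than that of the tree. *)
Lemma Fdiag_xX p X : (1 < p)%N ->
  ae_eq mu D (F (fun _ : 'I_p => xX X))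
    (fun t => \sum_(ps <- prodseq (nseq p X)) aQ (node_of ps) t).
Proof.
move=> p1; rewrite Fdiag_Fseq.
have := Fseq_expand T0 HF (LL := nseq p X) (fun b => lam ^+ internal b) (s1 := [::])
  (z := star) _ I (star_Sfun T_gt0 HF A B x0 y0).
rewrite size_nseq add0n => /(_ p1); rewrite !cat0s map_nseq => /vae_trans; apply.
have -> : (fun t => \sum_(ps <- prodseq (nseq p X)) (\prod_(b <- ps) lam ^+ internal b) *:
      Fseq ([::] ++ [seq star i | i <- ps]) t) =
    (fun t => \sum_(ps <- prodseq (nseq p X)) aQ (node_of ps) t); last exact: vae_refl.
apply/funext => t; apply: eq_big_seq => ps /prodseq_nseqP[sz _].
rewrite /aQ internal_node_of ?sz//= expr_sumn; congr (_ *: _).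
by case: ps sz => [|a [|c l]] // sz; move: p1; rewrite -sz.
Qed.

(* Expand [F_p(y + d, ..., y + d)] over the [2^p] choices of [y] or [d] in each slot. *)
Lemma Fdiag_perturb p (y d gy gd : R -> 'cV[R]_n) (r delta : R) : (1 < p)%N ->
  H1deriv T y gy -> H1deriv T d gd -> Snorm T y gy <= r -> Snorm T d gd <= delta ->
  exists E, [/\ L2 T E,
    ae_eq mu D (F (fun _ : 'I_p => fun t => y t + d t)) (fun t => F (fun _ : 'I_p => y) t + E t) &
    L2norm T E <= M p * ((r + delta) ^+ p - r ^+ p)].
Proof.
move=> p1 Hy Hd yr dd.
pose z (q : bool) := if q then y else d; pose gz (q : bool) := if q then gy else gd.
pose c (q : bool) := if q then r else delta.
have Hz q : H1deriv T (z q) (gz q) by case: q.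
have hz q : Sfun T (z q) by exact: H1deriv_Sfun (Hz q).
have zc q : Snorm T (z q) (gz q) <= c q by case: q.
pose LL := nseq p [:: true; false].
have mem_true : nseq p true \in prodseq LL.
  by have := mem_prodseq_nseq (Y := [:: true; false]) (ps := nseq p true); rewrite size_nseq; apply=> -[].
have uLL : uniq (prodseq LL) by apply: uniq_prodseq; apply/allP => L /nseqP[->].
have szLL ps : ps \in prodseq LL -> size ps = p by move=> /prodseq_nseqP[].
have hG ps : ps \in prodseq LL -> L2 T (Fseq (map z ps)).
  by move=> /szLL sz; apply: (Fseq_L2 T0 HF); [rewrite size_map sz|exact: all_prop_map].
pose G ps := if ps \in prodseq LL then Fseq (map z ps) else fun=> 0.
have hG' ps : L2 T (G ps) by rewrite /G; case: ifP => [/hG//|_]; exact: L2_0.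
exists (fun t => \sum_(ps <- prodseq LL | ps != nseq p true) G ps t); split.
- exact: L2_sum.
- have := Fseq_expand T0 HF (LL := LL) (fun=> 1) (s1 := [::]) (z := z) _ I hz.
  rewrite size_nseq add0n => /(_ p1); rewrite !cat0s map_nseq -Fdiag_Fseq.
  have -> : (fun t => \sum_(q <- [:: true; false]) 1 *: z q t) = (fun t => y t + d t).
    by apply/funext => t; rewrite big_cons big_seq1 !scale1r.
  move=> /vae_trans; apply; rewrite Fdiag_Fseq.
  have -> : (fun t => \sum_(ps <- prodseq LL) (\prod_(q <- ps) 1) *: Fseq ([::] ++ map z ps) t) =
     (fun t => Fseq (nseq p y) t + \sum_(ps <- prodseq LL | ps != nseq p true) G ps t); last first.
    exact: vae_refl.
  apply/funext => t; rewrite (bigD1_seq (nseq p true))//= big1// scale1r map_nseq; congr (_ + _).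
  rewrite big_seq_cond [RHS]big_seq_cond; apply: eq_bigr => ps /andP[hps _].
  by rewrite big1// scale1r /G hps.
- have -> : M p * ((r + delta) ^+ p - r ^+ p) =
     \sum_(ps <- prodseq LL | ps != nseq p true) M p * \prod_(q <- ps) c q.
    have : (r + delta) ^+ p = \sum_(ps <- prodseq LL) \prod_(q <- ps) c q.
      rewrite -prod_sum_prodseq big_nseq big_cons big_seq1.
      by elim: (p) => //= k IH; rewrite exprS IH.
    rewrite (bigD1_seq (nseq p true))//= => ->; rewrite -mulr_sumr; congr (_ * _).
    rewrite big_nseq; have -> : iter p ( *%R (c true)) 1 = r ^+ p.
      by elim: (p) => //= k ->; rewrite exprS.
    by rewrite addrAC subrr add0r.
  have -> : (fun t => \sum_(ps <- prodseq LL | ps != nseq p true) G ps t) =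
      (fun t => \sum_(ps <- [seq ps <- prodseq LL | ps != nseq p true]) G ps t).
    by apply/funext => t; rewrite big_filter.
  apply: le_trans (L2norm_sum_le _ hG') _; rewrite big_filter.
  rewrite big_seq_cond [leRHS]big_seq_cond; apply: ler_sum => ps /andP[hps _].
  rewrite /G hps; have sz := szLL _ hps.
  have := Fseq_bound T0 hM (s := [seq (z q, gz q) | q <- ps]).
  rewrite size_map big_map sz => /(_ p1 (all_prop_map _ (fun q => Hz q))).
  rewrite /unzip1 -map_comp => /le_trans; apply; rewrite ler_wpM2l//.
  by apply: ler_prod => q _; rewrite Snorm_ge0 zc.
Qed.

(** For each [p], F_p at [x] is the sum of [aQ] over the trees whose root has [p] children, all in
    [X], up to an error. Over [2 <= p < N] the main terms sum [aQ] over [nodes X N], which is close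
    to [Q] once it contains the trees of [s1], and the errors total at most [delta * C] for every
    [N]; hence [X] can be fixed before [N]. *)
Lemma Fsum_x : Fsum_to T F x Q.
Proof.
split=> // eps e0.
have e2 : 0 < eps / 2 by rewrite divr_gt0.
have [s1 [us1 hs1]] := (tree_sum_L2P T aQ Q).1 hQs _ e2.
(* At most 1 for [power_increment], and small enough for the total error [delta * C] to stay below
   [eps / 2]. *)
pose delta := Num.min 1 (eps / 2 / (C + 1)).
have C1 : 0 < C + 1 by rewrite ltr_wpDl.
have d0 : 0 < delta by rewrite /delta lt_min ltr01 divr_gt0.
have d1 : delta <= 1 by rewrite /delta ge_min lexx.
have dC : delta * C <= eps / 2.
  apply: (@le_trans _ _ (eps / 2 / (C + 1) * C)).
    by rewrite ler_wpM2r// /delta ge_min lexx orbT.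
  by rewrite mulrAC ler_pdivrMr// ler_wpM2l ?(ltW e2)// lerDl.
have [s0 hs0] := x_approx d0.
(* [s0] makes [xX X] close to [x]; the children of [s1] put the trees of [s1] other than the leaf
   into [nodes X N]. *)
pose X := undup (s0 ++ flatten (map children s1)).
have uX : uniq X by exact: undup_uniq.
have [g [Hd dle _]] : exists g, [/\ H1deriv T (fun t => x t - xX X t) g,
    Snorm T (fun t => x t - xX X t) g <= delta & l1 (x T - xX X T) <= delta].
  by apply: hs0 => // b bs; rewrite mem_undup mem_cat bs.
pose N0 := (\sum_(b <- s1) (size (children b)).+1)%N.
exists N0 => N NN.
have key p : exists E, [/\ L2 T E, (1 < p)%N ->
    ae_eq mu D (F (fun _ : 'I_p => x)) (fun t => F (fun _ : 'I_p => xX X) t + E t) &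
    L2norm T E <= delta * (M p * (rho + 1) ^+ p)].
  (* For [p <= 1] nothing is known about [F] and the error is set to zero; those arities do not
     enter the sum. *)
  have [p1|p1] := ltnP 1 p; last first.
    exists (fun=> 0); split=> //; first exact: L2_0.
    by rewrite L2norm0 !mulr_ge0 ?(ltW d0)// exprn_ge0// addr_ge0.
  have [E [hE aeE nE]] := Fdiag_perturb p1 (xX_H1 X) Hd (Snorm_xX uX) dle.
  exists E; split=> // [_|].
    move: aeE; have -> // : (fun t => xX X t + (x t - xX X t)) = x.
    by apply/funext => t; rewrite addrC subrK.
  apply: le_trans nE _; rewrite mulrCA ler_wpM2l//.
  by apply: power_increment => //; rewrite (ltW d0) d1.
have /choice[E hE] := key.
(* The leaf has zero source, but it may belong to [s1], which the list has to contain. *)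
pose S t := \sum_(b <- Leaf :: nodes X N) aQ b t.
have hS : L2 T S by apply: L2_sum => b _; exact: aQ_L2.
have SQ : L2norm T (fun t => S t - Q t) < eps / 2.
  apply: hs1; first by rewrite /= Leaf_notin_nodes uniq_nodes.
  move=> b bs; rewrite inE; have [//|bL] := eqVneq b Leaf; apply: mem_nodes => //.
    move=> d db; rewrite mem_undup mem_cat; apply/orP; right.
    by apply/flatten_mapP; exists b.
  by apply: leq_trans NN; rewrite /N0 (big_rem b)//= leq_addr.
pose Es t := \sum_(2 <= p < N) E p t.
have hEs : L2 T Es by apply: L2_sum => p _; have [] := hE p.
have xSf : Sfun T x by have [] := x_is_sol.
have hFx : L2 T (fun t => \sum_(2 <= p < N) F (fun _ : 'I_p => x) t).
  under eq_fun do rewrite big_nat_cond; apply: L2_sum => p /andP[/andP[p2 _] _].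
  by case: HF => HF1 _ _ _; exact: HF1.
have ae : ae_eq mu D (fun t => \sum_(2 <= p < N) F (fun _ : 'I_p => x) t - Q t)
    (fun t => (S t - Q t) + Es t).
  (* Both summands are made zero for [p <= 1], because [vae_sum] compares the families at every
     index. *)
  pose Fx p := if (1 < p)%N then F (fun _ : 'I_p => x) else fun=> 0.
  pose Sp p := if (1 < p)%N then
    fun t => \sum_(ps <- prodseq (nseq p X)) aQ (node_of ps) t + E p t else fun=> 0.
  have aep p : ae_eq mu D (Fx p) (Sp p).
    rewrite /Fx /Sp; case: ifP => p1; last exact: vae_refl.
    have [_ /(_ p1) h _] := hE p; apply: vae_trans h _.
    have := vae_lin 1 (Fdiag_xX X p1) (vae_refl T (E p)).
    by congr ae_eq; apply/funext => t; rewrite scale1r.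
  have := vae_lin 1 (vae_sum (index_iota 2 N) aep) (vae_refl T (fun t => - Q t)).
  have -> : (fun t => 1 *: \sum_(p <- index_iota 2 N) Fx p t + - Q t) =
      (fun t => \sum_(2 <= p < N) F (fun _ : 'I_p => x) t - Q t).
    apply/funext => t; rewrite scale1r; congr (_ + _); rewrite big_nat_cond [RHS]big_nat_cond.
    by apply: eq_bigr => p /andP[/andP[p2 _] _]; rewrite /Fx p2.
  have -> // : (fun t => 1 *: \sum_(p <- index_iota 2 N) Sp p t + - Q t) =
      (fun t => (S t - Q t) + Es t).
  apply/funext => t; rewrite scale1r addrAC; congr (_ + _).
  rewrite /S big_cons /aQ /= scaler0 add0r -/(aQ _ t) sum_nodes /Es -big_split /=.
  rewrite big_nat_cond [RHS]big_nat_cond.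
  by apply: eq_bigr => p /andP[/andP[p2 _] _]; rewrite /Sp p2.
rewrite (ae_eq_L2norm (L2B hFx hQ) (L2D (L2B hS hQ) hEs) ae).
apply: le_lt_trans (L2norm_triangle (L2B hS hQ) hEs) _.
have -> : eps = eps / 2 + eps / 2 by rewrite -splitr.
rewrite ltr_leD//; apply: le_trans (L2norm_sum_le _ (fun p => let: And3 h _ _ := hE p in h)) _.
apply: le_trans _ dC; apply: (@le_trans _ _ (delta * \sum_(2 <= p < N) M p * (rho + 1) ^+ p)).
  by rewrite mulr_sumr; apply: ler_sum => p _; have [] := hE p.
by rewrite ler_wpM2l ?(ltW d0)// sum_M_le// lexx addr_ge0.
Qed.

End FinalProof.

Unset Implicit Arguments.

Theorem mainTheorem9 (R : realType) (n m : nat) (T : R)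
  (A : 'M[R]_n) (B : 'M[R]_(n, m))
  (F : forall p : nat, ('I_p -> R -> 'cV[R]_n) -> R -> 'cV[R]_n)
  (x0 : 'cV[R]_n) (y0 : tree -> 'cV[R]_n) :
  (0 < n)%N -> (0 < m)%N -> 0 < T ->
  H1hyp T F ->
  \rank (kalman A B) = n ->
  constructed T A B F x0 y0 ->
  exists lam0 : R, 0 < lam0 /\
    forall lam : R, `|lam| < lam0 ->
      exists V : R -> 'cV[R]_m,
        L2 T V /\
        tree_sum_L2 T (fun b t => lam ^+ internal b *: vfam T A B y0 b t) V /\
        exists x G : R -> 'cV[R]_n,
          Fsum_to T F x G /\
          is_sol T A x0 (fun s => B *m V s + lam *: G s) x /\
          x T = 0.
Proof.
move=> _ _ T_gt0 HF rk hy0.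
have [_ _ _ [M [M0 hM Mcv]]] := HF.
have [K K0 hK] := family_bounds T_gt0 HF hy0 rk.
set rho := Snorm T (star T A B F x0 y0 Leaf) (star_deriv T F A B x0 y0 Leaf) + 1.
have r1 : 0 <= rho + 1 by rewrite /rho; do 2 apply: addr_ge0 => //; exact: Snorm_ge0.
(* Convergence of the majorant at every radius is needed here, since [rho] depends on [x0] and on
   the linear problem. *)
have [C hC] : exists C, forall N, \sum_(0 <= p < N) M p * (rho + 1) ^+ p <= C.
  have /cvg_has_ub[C hC] := Mcv _ r1; exists C => N.
  by apply: le_trans (ler_norm _) (hC _ _); exists N.
have C0 : 0 <= C by have := hC 0%N; rewrite big_geq.
(* Any smaller [|lam|] satisfies [|lam| * (K * C) <= 1], the unit allotted to the non-leaf trees in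
   [rho]; the added 1 covers [K * C = 0]. *)
exists (K * C + 1)^-1; split; first by rewrite invr_gt0 ltr_wpDl// mulr_ge0.
move=> lam llam.
have hlam : `|lam| * (K * C) <= 1.
  have KC0 : 0 <= K * C by rewrite mulr_ge0.
  apply: (@le_trans _ _ (`|lam| * (K * C + 1))); first by rewrite ler_wpM2l// lerDl.
  by rewrite -ler_pdivlMr ?mul1r ?(ltW llam)// ltr_wpDl.
have [V [hV hVs]] := control_series_exists T_gt0 HF M0 hM K0 hK hC hlam.
have [Q [hQ hQs]] := source_series_exists T_gt0 HF M0 hM K0 hK hC hlam.
exists V; split=> //; split=> //.
exists (odesol T A x0 (fun t => B *m V t + lam *: Q t)), Q; split.
  exact: (Fsum_x T_gt0 HF M0 hM K0 hK hC hlam hV hVs hQ hQs).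
split; first exact: (x_is_sol T_gt0 A B x0 lam hV hQ).
exact: (x_final T_gt0 HF hy0 hV hVs hQ hQs).
Qed.
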